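(* Let $(\eta^{ij})$ be a constant symmetric nondegenerate $N\times N$ matrix, and consider the constant local Poisson bracket $$\{ I,J \}_2 = \int \frac{\delta I}{\delta u^i(x)}\, \eta^{ij} \frac{d}{dx}\, \frac{\delta J}{\delta u^j(x)}\, dx .$$ Let $$\{ I,J \}_1 = \int \frac{\delta I}{\delta u^i(x)} \left( g^{ij}_1 (u(x)) \frac{d}{dx} + b^{ij}_{1,k}(u(x))\, u^k_x + K_1 u^i_x \left( \frac{d}{dx}\right)^{-1} u^j_x \right) \frac{\delta J}{\delta u^j(x)}\, dx$$ be an arbitrary nonlocal Poisson bracket of this form ($K_1$ a constant, $g_1^{ij}$ and $b^{ij}_{1,k}$ smooth functions; $g_1^{ij}$ may be degenerate). Then $\{I,J\}_1$ is compatible with $\{I,J\}_2$ if and only if, locally, it has the form $$\{ I,J \}_1 = \int \frac{\delta I}{\delta u^i(x)} \left( \left[ \eta^{is} \frac{\partial H^j}{\partial u^s} + \eta^{js} \frac{\partial H^i}{\partial u^s} - K_1 u^i u^j \right] \frac{d}{dx} + \left[ \eta^{is} \frac{\partial^2 H^j}{\partial u^s \partial u^k} - K_1 \delta^i_k u^j \right] u^k_x + K_1 u^i_x \left( \frac{d}{dx}\right)^{-1} u^j_x \right) \frac{\delta J}{\delta u^j(x)}\, dx,$$ where $H^i(u)$, $1\le i\le N$, are smooth functions defined in a certain domain of local coordinates.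
   Context: Summation over repeated indices is understood; all indices run from $1$ to $N$. $u=(u^1,\dots,u^N)$ are local coordinates on a smooth $N$-dimensional manifold, $u^i(x)$ are functions (fields) of a single independent variable $x$, $u^i_x = du^i/dx$, and $I[u],J[u]$ are functionals on the space of fields. Considerations are formal (integrals of total $x$-derivatives vanish; $(d/dx)^{-1}$ is the formal inverse of $d/dx$) and local in $u$: existence of the functions $H^i$ is understood in a neighbourhood of each point. A bracket of the form $$\int \frac{\delta I}{\delta u^i(x)} \left( g^{ij}(u) \frac{d}{dx} + b^{ij}_k(u) u^k_x + K u^i_x \left(\frac{d}{dx}\right)^{-1} u^j_x\right) \frac{\delta J}{\delta u^j(x)} dx$$ (with $K$ constant; it is local when $K=0$) is a Poisson bracket if it is skew-symmetric and satisfies the Jacobi identity. It is a known fact that (also for degenerate $g^{ij}$) this is equivalent to the relations: (1) $g^{ij}=g^{ji}$; (2) $\partial g^{ij}/\partial u^k = b^{ij}_k + b^{ji}_k$; (3) $g^{is} b^{jr}_s = g^{js} b^{ir}_s$; (4) $g^{is}\left(\frac{\partial b^{jr}_s}{\partial u^k} - \frac{\partial b^{jr}_k}{\partial u^s}\right) + b^{ij}_s b^{sr}_k - b^{ir}_s b^{sj}_k = K(g^{ir}\delta^j_k - g^{ij}\delta^r_k)$; (5) $\sum_{(i,j,r)} \Big[ b^{si}_p \Big(\frac{\partial b^{jr}_k}{\partial u^s} - \frac{\partial b^{jr}_s}{\partial u^k}\Big) + K(b^{ij}_k - b^{ji}_k)\delta^r_p + b^{si}_k \Big(\frac{\partial b^{jr}_p}{\partial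 u^s} - \frac{\partial b^{jr}_s}{\partial u^p}\Big) + K(b^{ij}_p - b^{ji}_p)\delta^r_k \Big] = 0$, the sum being over cyclic permutations of $i,j,r$. Two Poisson brackets $\{\cdot,\cdot\}_1$ and $\{\cdot,\cdot\}_2$ are compatible if every linear combination of them with constant coefficients is a Poisson bracket; equivalently here, $\{\cdot,\cdot\}_1+\lambda\{\cdot,\cdot\}_2$ is a Poisson bracket for every constant $\lambda$. *)

(* Defs.v *)
From HB Require Import structures.
From mathcomp Require Import all_boot all_order all_algebra.
From mathcomp Require Import all_classical all_reals all_analysis.

Set Implicit Arguments.
Unset Strict Implicit.
Unset Printing Implicit Defensive.

Import Order.TTheory GRing.Theory Num.Theory.
Import numFieldNormedType.Exports.

Local Open Scope classical_set_scope.
Local Open Scope ring_scope.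

Definition partial (R : realType) (n : nat) (i : 'I_n) (f : 'rV[R]_n -> R) :
  'rV[R]_n -> R := fun x => 'D_(delta_mx 0 i) f x.

(* C^oo on an open set V: every iterated partial derivative is (Frechet)
   differentiable, hence continuous, at each point of V. *)
Definition smooth_on (R : realType) (n : nat) (V : set 'rV[R]_n)
    (f : 'rV[R]_n -> R) : Prop :=
  forall (s : seq 'I_n) (x : 'rV[R]_n), V x ->
    differentiable (foldr (@partial R n) f s) x.

Definition smooth1 (R : realType) (f : R -> R) : Prop :=
  forall (n : nat) (x : R), derivable (derive1n n f) x 1.

Definition coord (R : realType) (N : nat) (u : R -> 'rV[R]_N) (i : 'I_N) :
  R -> R := fun x => u x 0 i.

Definition smooth_curve (R : realType) (N : nat) (u : R -> 'rV[R]_N) : Prop :=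
  forall i : 'I_N, smooth1 (coord u i).

(* Variations, and variational derivatives of functionals: C_c^oo(R, R^N). *)
Definition test_curve (R : realType) (N : nat) (v : R -> 'rV[R]_N) : Prop :=
  smooth_curve v /\
  exists M : R, forall x : R, M < `|x| -> v x = 0.

(* The space of fields: smooth, with values in the coordinate domain U, and
   with u_x compactly supported.  Such a field stays in a compact subset of U,
   so u + t v is again a field for every test curve v and small t; and all
   the integrals of total derivatives that occur vanish. *)
Definition field_in (R : realType) (N : nat) (U : set 'rV[R]_N)
    (u : R -> 'rV[R]_N) : Prop :=
  [/\ smooth_curve u, forall x : R, U (u x) &
      exists M : R, forall x : R, M < `|x| ->
        forall i : 'I_N, derive1 (coord u i) x = 0].

Definition functional (R : realType) (N : nat) : Type := (R -> 'rV[R]_N) -> R.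

Definition is_vderiv (R : realType) (N : nat) (I : functional R N)
    (u xi : R -> 'rV[R]_N) : Prop :=
  test_curve xi /\
  forall v : R -> 'rV[R]_N, test_curve v ->
    is_derive (0 : R) (1 : R) (fun t : R => I (fun x => u x + t *: v x))
      (\int[@lebesgue_measure R]_x \sum_(i < N) xi x 0 i * v x 0 i).

(* delta I / delta u, with value 0 where it does not exist. *)
Definition vderiv (R : realType) (N : nat) (I : functional R N)
    (u : R -> 'rV[R]_N) : R -> 'rV[R]_N :=
  xget (fun=> 0) [set xi | is_vderiv I u xi].

(* Smooth functionals on the U-valued fields: delta I / delta u exists at every
   field, and along every two-parameter variation u + s v + t w it is, for small
   s and t, smooth in (s, t, x) with support in x bounded uniformly in (s, t).
   Two parameters are what the symmetry of the second variation requires. *)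
Definition smooth_functional (R : realType) (N : nat) (U : set 'rV[R]_N)
    (I : functional R N) : Prop :=
  (forall u : R -> 'rV[R]_N, field_in U u -> exists xi, is_vderiv I u xi) /\
  (forall u v w : R -> 'rV[R]_N, field_in U u -> test_curve v -> test_curve w ->
    let E (s t : R) := vderiv I (fun x => u x + s *: v x + t *: w x) in
    exists e : R,
      [/\ 0 < e,
          exists M : R, forall s t x : R,
            `|s| < e -> `|t| < e -> M < `|x| -> E s t x = 0 &
          forall i : 'I_N,
            smooth_on [set z : 'rV[R]_3 | `|z 0 0| < e /\ `|z 0 1| < e]
              (fun z => E (z 0 0) (z 0 1) (z 0 2) 0 i)]).

(* (d/dx)^{-1}: the inverse of d/dx that is skew-adjoint on compactly supported
   functions. *)
Definition dinv (R : realType) (f : R -> R) : R -> R := fun x =>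
  2^-1 * (\int[@lebesgue_measure R]_(y in `]-oo, x]) f y
          - \int[@lebesgue_measure R]_(y in `[x, +oo[) f y).

(* g^{ij}(u) d/dx + b^{ij}_k(u) u^k_x + K u^i_x (d/dx)^{-1} u^j_x, with
   gcoef i j = g^{ij} and bcoef i j k = b^{ij}_k. *)
Record hydro_op (R : realType) (N : nat) := HydroOp {
  gcoef : 'I_N -> 'I_N -> 'rV[R]_N -> R;
  bcoef : 'I_N -> 'I_N -> 'I_N -> 'rV[R]_N -> R;
  Kcoef : R }.

Definition smooth_op (R : realType) (N : nat) (U : set 'rV[R]_N)
    (P : hydro_op R N) : Prop :=
  (forall i j : 'I_N, smooth_on U (gcoef P i j)) /\
  (forall i j k : 'I_N, smooth_on U (bcoef P i j k)).

Definition apply_op (R : realType) (N : nat) (P : hydro_op R N)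
    (u psi : R -> 'rV[R]_N) (x : R) : 'rV[R]_N :=
  \row_(i < N) \sum_(j < N)
    (gcoef P i j (u x) * derive1 (coord psi j) x
     + (\sum_(k < N) bcoef P i j k (u x) * derive1 (coord u k) x) * psi x 0 j
     + Kcoef P * derive1 (coord u i) x
       * dinv (fun y => derive1 (coord u j) y * psi y 0 j) x).

Definition bracket (R : realType) (N : nat) (P : hydro_op R N)
    (I J : functional R N) : functional R N := fun u =>
  \int[@lebesgue_measure R]_x
    \sum_(i < N) vderiv I u x 0 i * apply_op P u (vderiv J u) x 0 i.

Definition is_poisson (R : realType) (N : nat) (U : set 'rV[R]_N)
    (P : hydro_op R N) : Prop :=
  (forall (I J : functional R N) (u : R -> 'rV[R]_N),
     smooth_functional U I -> smooth_functional U J -> field_in U u ->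
     bracket P I J u = - bracket P J I u) /\
  (forall (I J L : functional R N) (u : R -> 'rV[R]_N),
     smooth_functional U I -> smooth_functional U J ->
     smooth_functional U L -> field_in U u ->
     bracket P (bracket P I J) L u + bracket P (bracket P J L) I u
     + bracket P (bracket P L I) J u = 0).

Definition lincomb_op (R : realType) (N : nat) (a c : R)
    (P Q : hydro_op R N) : hydro_op R N :=
  HydroOp (fun i j u => a * gcoef P i j u + c * gcoef Q i j u)
          (fun i j k u => a * bcoef P i j k u + c * bcoef Q i j k u)
          (a * Kcoef P + c * Kcoef Q).

Definition compatible (R : realType) (N : nat) (U : set 'rV[R]_N)
    (P Q : hydro_op R N) : Prop :=
  [/\ is_poisson U P, is_poisson U Q &
      forall a c : R, is_poisson U (lincomb_op a c P Q)].

Definition const_op (R : realType) (N : nat) (eta : 'M[R]_N) : hydro_op R N :=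
  HydroOp (fun i j _ => eta i j) (fun _ _ _ _ => 0) 0.

(* The operator built from functions H^i in the theorem. *)
Definition potential_op (R : realType) (N : nat) (eta : 'M[R]_N)
    (K : R) (H : 'I_N -> 'rV[R]_N -> R) : hydro_op R N :=
  HydroOp
    (fun i j u =>
       \sum_(s < N) eta i s * partial s (H j) u
       + \sum_(s < N) eta j s * partial s (H i) u
       - K * u 0 i * u 0 j)
    (fun i j k u =>
       \sum_(s < N) eta i s * partial k (partial s (H j)) u
       - K * (i == k)%:R * u 0 j)
    K.

Definition eq_op_on (R : realType) (N : nat) (V : set 'rV[R]_N)
    (P Q : hydro_op R N) : Prop :=
  [/\ forall (i j : 'I_N) (u : 'rV[R]_N), V u -> gcoef P i j u = gcoef Q i j u,
      forall (i j k : 'I_N) (u : 'rV[R]_N), V u ->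
        bcoef P i j k u = bcoef Q i j k u &
      Kcoef P = Kcoef Q].

(* Main.v *)
Require Import Defs.
From HB Require Import structures.
From mathcomp Require Import all_boot all_order all_algebra.
From mathcomp Require Import all_classical all_reals all_analysis.
From mathcomp Require Import ring lra.

Set Implicit Arguments.
Unset Strict Implicit.
Unset Printing Implicit Defensive.

Import Order.TTheory GRing.Theory Num.Theory.
Import numFieldNormedType.Exports.
Import Defs.

Local Open Scope classical_set_scope.
Local Open Scope ring_scope.

(** Why the theorem holds.

    The variational derivative of the bracket of [I] and [J] is computed by varying
    the two variational derivatives and the operator (lemma [bracket_vderiv]).  The
    second variation of a functional is symmetric ([delta_sym]), so in the Jacobi sum
    all second variations cancel and what remains, [cyc], depends only on the
    operator and on three test curves [xi], [psi], [zeta]: the operator, linearised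
    at the field in the direction of its own value on [zeta] and paired with [xi]
    and [psi], summed cyclically ([jacobi_cyc]).  For the pencil
    [a P1 + c eta d/dx] this expression is [a^2] times that of [P1] plus [a c] times
    one mixed expression, because the constant operator has no linearisation.
    Compatibility thus means that the mixed expression vanishes identically
    ([compatible_cyc]).

    After integration by parts the nonlocal terms of the mixed expression cancel
    pointwise in the cyclic sum ([theta_contract], [cyclic_sum]).  Its vanishing is
    equivalent to two linear relations on the coefficients of [P1] ([mixed_rel],
    proved in [mixed_rel_cyc] and [cyc_mixed_rel]):
    - [eta^{is} b^{jr}_s] is symmetric in [i] and [j];
    - [d_l b^{ij}_k - d_k b^{ij}_l = K (delta^i_l delta^j_k - delta^j_l delta^i_k)].
    The relations are extracted by testing with linear functionals, constant fields,
    and fields that move only on a short interval on which two of the three test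
    curves are constant; the third is chosen so that the integral of a square
    vanishes.  In the same way skew-symmetry of the bracket yields that [g] is
    symmetric with [d_k g^{ij} = b^{ij}_k + b^{ji}_k] ([poisson_skew_rel]).

    These relations are integrated by applying the Poincare lemma twice on a ball.
    The second relation says that [b^{ij}_k + K delta^i_k u^j] is closed in [k], so it
    is the gradient of some [A^{ij}]; the first one says that [A^{ij}], with [i]
    lowered by the inverse of [eta], is closed, so that
    [A^{ij} = eta^{is} d_s H^j].  The formula for [g] then holds up to constants,
    which are absorbed in [A] beforehand ([exists_local_potential]).  Conversely, for
    coefficients of this form both relations follow from the symmetry of second and
    third derivatives of [H] ([potential_mixed_rel]).

    On the analytic side, all derivatives with respect to a parameter are taken at
    zero and uniformly in [x] (record [ud]); uniform expansions come from compactness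
    and the mean value theorem, and pass to integrals of functions with a common
    compact support. *)

(** * Smooth functions of one variable *)

Lemma smooth1_derive (R : realType) (f : R -> R) :
  smooth1 f -> forall x, is_derive x (1 : R) f ((derive1 f) x).
Proof. by move=> sf x; rewrite derive1E; apply: derivableP; apply: (sf 0%N). Qed.

Lemma smooth1_derive1 (R : realType) (f : R -> R) : smooth1 f -> smooth1 (derive1 f).
Proof. by move=> sf n x; rewrite -derive1Sn; apply: sf. Qed.

Lemma smooth1_derivable (R : realType) (f : R -> R) x :
  smooth1 f -> derivable f x 1.
Proof. by move=> sf; apply: (sf 0%N). Qed.

Lemma derive1_is (R : realType) (f : R -> R) x df :
  is_derive x (1 : R) f df -> (derive1 f) x = df.
Proof. by rewrite derive1E => -[_ <-]. Qed.

(** Smoothness is coinductive: a class of functions stable under differentiation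
    consists of smooth functions.  This replaces inductions on the order of
    differentiation. *)
Lemma smooth1_class (R : realType) (S : (R -> R) -> Prop) :
  (forall f, S f -> exists2 df, forall x, is_derive x (1 : R) f (df x) & S df) ->
  forall f, S f -> smooth1 f.
Proof.
move=> HS f Sf n; elim: n f Sf => [|n IH] f /HS[df dfE Sdf] x.
  by case: (dfE x).
rewrite derive1Sn (_ : (derive1 f) = df); first exact: IH.
by apply/funext => y; apply: derive1_is.
Qed.

Opaque smooth1.

Lemma smooth1_intro (R : realType) (f df : R -> R) :
  (forall x, is_derive x (1 : R) f (df x)) -> smooth1 df -> smooth1 f.
Proof.
move=> dfE sdf; apply: (@smooth1_class _ (fun g => g = f \/ smooth1 g));
  last by left.
move=> g [->|sg]; first by exists df => //; right.
by exists (derive1 g); [exact: smooth1_derive | right; exact: smooth1_derive1].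
Qed.

Lemma smooth1_cst (R : realType) (c : R) : smooth1 (fun=> c).
Proof.
apply: (@smooth1_class _ (fun g => exists c, g = fun=> c)); last by exists c.
by move=> _ [d ->]; exists (fun=> 0); [move=> x; exact: is_derive_cst|exists 0].
Qed.

Arguments smooth1_cst {R} c.

Lemma smooth1_id (R : realType) : smooth1 (fun x : R => x).
Proof.
have H (x : R) : is_derive x (1 : R) (fun y : R => y) 1 by exact: is_derive_id.
exact: smooth1_intro H (smooth1_cst _).
Qed.

Lemma smooth1_continuous (R : realType) (f : R -> R) : smooth1 f -> continuous f.
Proof.
move=> sf x; apply/differentiable_continuous/derivable1_diffP.
exact: smooth1_derivable.
Qed.

Lemma is_derive1_eq (R : realType) (f : R -> R) x d d' :
  is_derive x (1 : R) f d -> d = d' -> is_derive x (1 : R) f d'.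
Proof. by move=> H <-. Qed.

Lemma is_derive1D (R : realType) (f g : R -> R) x df dg :
  is_derive x (1 : R) f df -> is_derive x (1 : R) g dg ->
  is_derive x (1 : R) (fun y => f y + g y) (df + dg).
Proof. exact: is_deriveD. Qed.

Lemma is_derive1M (R : realType) (f g : R -> R) x df dg :
  is_derive x (1 : R) f df -> is_derive x (1 : R) g dg ->
  is_derive x (1 : R) (fun y => f y * g y) (df * g x + f x * dg).
Proof.
move=> Hf Hg; have H := is_deriveM Hf Hg; move: H.
by rewrite /GRing.scale/= addrC [g x * df]mulrC.
Qed.

Lemma is_derive1_sum (R : realType) n (f : 'I_n -> R -> R) x (df : 'I_n -> R) :
  (forall i, is_derive x (1 : R) (f i) (df i)) ->
  is_derive x (1 : R) (fun y => \sum_i f i y) (\sum_i df i).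
Proof. by move=> H; rewrite -fct_sumE; apply: is_derive_sum. Qed.

Lemma is_derive_partial (R : realType) n (g : 'rV[R]_n -> R) (x h : 'rV[R]_n) :
  differentiable g x -> 'd g x h = \sum_(k < n) partial k g x * h 0 k.
Proof.
move=> dg; rewrite {1}(row_sum_delta h) linear_sum; apply: eq_bigr => k _.
by rewrite linearZ /= /partial deriveE// mulrC.
Qed.

Lemma is_derive_comp_curve (R : realType) n (g : 'rV[R]_n -> R)
    (u : R -> 'rV[R]_n) (x : R) :
  differentiable g (u x) -> (forall i, derivable (coord u i) x 1) ->
  is_derive x (1 : R) (fun y => g (u y))
    (\sum_(k < n) partial k g (u x) * derive1 (coord u k) x).
Proof.
move=> dg du.
have dux : derivable u x 1 by apply/derivable_mxP => i j; rewrite ord1; exact: du.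
have dfu : differentiable u x by apply/derivable1_diffP.
have dgu : differentiable (g \o u) x by exact: differentiable_comp.
apply: DeriveDef; first exact/diff_derivable.
rewrite (deriveE _ dgu) diff_comp//= is_derive_partial//.
by apply: eq_bigr => k _; rewrite -deriveE// derive_mx// mxE derive1E.
Qed.

Lemma smooth_on_partial (R : realType) n (V : set 'rV[R]_n) g i :
  smooth_on V g -> smooth_on V (partial i g).
Proof. by move=> sg s x Vx; move: (sg (rcons s i) x Vx); rewrite foldr_rcons. Qed.

Arguments smooth_on_partial {R n V g i} _ s [x] _.

Lemma smooth_on_differentiable (R : realType) n (V : set 'rV[R]_n) g x :
  smooth_on V g -> V x -> differentiable g x.
Proof. by move=> sg; exact: (sg [::]). Qed.

Opaque smooth_on.

(** The algebra generated by the smooth functions of one variable and the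
    compositions of functions smooth on [V] with a fixed curve in [V] is stable
    under differentiation; hence all its members are smooth. *)
Inductive curve_alg (R : realType) n (V : set 'rV[R]_n) (u : R -> 'rV[R]_n) :
    (R -> R) -> Prop :=
  | curve_alg_smooth f of smooth1 f : curve_alg V u f
  | curve_alg_comp g of smooth_on V g : curve_alg V u (fun x => g (u x))
  | curve_alg_add f g of curve_alg V u f & curve_alg V u g :
      curve_alg V u (fun x => f x + g x)
  | curve_alg_mul f g of curve_alg V u f & curve_alg V u g :
      curve_alg V u (fun x => f x * g x).

Lemma smooth1_curve_alg (R : realType) n (V : set 'rV[R]_n)
    (u : R -> 'rV[R]_n) : smooth_curve u -> (forall x, V (u x)) ->
  forall f, curve_alg V u f -> smooth1 f.
Proof.
move=> su Vu; apply: smooth1_class => f; elim=> {f} [f sf|g sg|f g _ [df dfE Sf] _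
    [dg dgE Sg]|f g Sf [df dfE Sdf] Sg [dg dgE Sdg]].
- by exists (derive1 f); [exact: smooth1_derive|
    apply: curve_alg_smooth; exact: smooth1_derive1].
- exists (fun x => \sum_(k < n) partial k g (u x) * derive1 (coord u k) x).
    move=> x; apply: is_derive_comp_curve; first exact: smooth_on_differentiable sg _.
    by move=> i; apply: smooth1_derivable; exact: su.
  rewrite -[X in curve_alg _ _ X]fct_sumE.
  elim/big_ind: _ => [||k _]; first exact/curve_alg_smooth/smooth1_cst.
    by move=> *; exact: curve_alg_add.
  apply: curve_alg_mul; first exact: curve_alg_comp (smooth_on_partial sg).
  exact/curve_alg_smooth/smooth1_derive1/su.
- exists (fun x => df x + dg x); last exact: curve_alg_add.
  by move=> x; apply: is_derive1D.
- exists (fun x => df x * g x + f x * dg x).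
    by move=> x; apply: is_derive1M.
  by apply: curve_alg_add; apply: curve_alg_mul.
Qed.

Lemma smooth1_comp (R : realType) n (V : set 'rV[R]_n) (u : R -> 'rV[R]_n) g :
  smooth_curve u -> (forall x, V (u x)) -> smooth_on V g ->
  smooth1 (fun x => g (u x)).
Proof.
by move=> su Vu sg; apply: (smooth1_curve_alg su Vu); exact: curve_alg_comp.
Qed.

Lemma smooth1M (R : realType) (f g : R -> R) :
  smooth1 f -> smooth1 g -> smooth1 (fun x => f x * g x).
Proof.
move=> sf sg; have s0 : smooth_curve (fun _ : R => 0 : 'rV[R]_0).
  by move=> i; exact: (smooth1_cst ((0 : 'rV[R]_0) 0 i)).
apply: (@smooth1_curve_alg R 0 setT _ s0 (fun=> I)).
exact: curve_alg_mul (curve_alg_smooth _ _ sf) (curve_alg_smooth _ _ sg).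
Qed.

Lemma smooth1D (R : realType) (f g : R -> R) :
  smooth1 f -> smooth1 g -> smooth1 (fun x => f x + g x).
Proof.
move=> sf sg; have s0 : smooth_curve (fun _ : R => 0 : 'rV[R]_0).
  by move=> i; exact: (smooth1_cst ((0 : 'rV[R]_0) 0 i)).
apply: (@smooth1_curve_alg R 0 setT _ s0 (fun=> I)).
exact: curve_alg_add (curve_alg_smooth _ _ sf) (curve_alg_smooth _ _ sg).
Qed.

Lemma smooth1N (R : realType) (f : R -> R) :
  smooth1 f -> smooth1 (fun x => - f x).
Proof.
move=> sf; have -> : (fun x => - f x) = (fun x => (-1) * f x).
  by apply/funext => x; rewrite mulN1r.
exact: (smooth1M (smooth1_cst _) sf).
Qed.

Lemma smooth1B (R : realType) (f g : R -> R) :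
  smooth1 f -> smooth1 g -> smooth1 (fun x => f x - g x).
Proof. by move=> sf sg; exact: (smooth1D sf (smooth1N sg)). Qed.

Lemma smooth1_sum (R : realType) n (f : 'I_n -> R -> R) :
  (forall i, smooth1 (f i)) -> smooth1 (fun x => \sum_i f i x).
Proof.
move=> sf; rewrite -[X in smooth1 X]fct_sumE.
elim/big_ind: _ => [|f1 f2 s1 s2|i _]; last exact: sf.
  exact: (smooth1_cst 0).
exact: (smooth1D s1 s2).
Qed.

(** * Uniform first-order expansions and symmetry of second derivatives *)

Lemma le_coord_norm (R : realType) n (h : 'rV[R]_n) k : `|h 0 k| <= `|h|.
Proof. by rewrite [leRHS]/Num.Def.normr/= mx_normrE; exact: (le_bigmax _ _ (0, k)). Qed.

Lemma derivable_affine (R : realType) (a b : R) s :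
  is_derive s (1 : R) (fun s : R => a + s * b) b.
Proof.
have := is_derive1D (is_derive_cst a s 1)
  (is_derive1M (@is_derive_id _ _ s (1 : R)) (is_derive_cst b s 1)).
by rewrite mulr0 addr0 mul1r add0r.
Qed.

Lemma is_derive_line (R : realType) n (g : 'rV[R]_n -> R) (q v : 'rV[R]_n) s :
  differentiable g (q + s *: v) ->
  is_derive s (1 : R) (fun s => g (q + s *: v))
    (\sum_(k < n) partial k g (q + s *: v) * v 0 k).
Proof.
move=> dg.
have H i : is_derive s (1 : R) (coord (fun s => q + s *: v) i) (v 0 i).
  have := derivable_affine (q 0 i) (v 0 i) s.
  by rewrite (_ : (fun _ => _) = coord (fun s => q + s *: v) i)//;
     apply/funext => y; rewrite /coord !mxE.
have /= := @is_derive_comp_curve _ _ g (fun s => q + s *: v) s dg.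
move=> /(_ (fun i => @ex_derive _ _ _ _ _ _ _ (H i))).
by under eq_bigr do rewrite (derive1_is (H _)).
Qed.

Lemma sum_mul_le (R : realType) n (a : 'I_n -> R) (h : 'rV[R]_n) e :
  (forall k, `|a k| <= e) -> `|\sum_(k < n) a k * h 0 k| <= n%:R * e * `|h|.
Proof.
move=> ae; apply: (le_trans (ler_norm_sum _ _ _)).
apply: (@le_trans _ _ (\sum_(k < n) e * `|h|)).
  apply: ler_sum => k _; rewrite normrM; apply: ler_pM => //.
  exact: le_coord_norm.
by rewrite sumr_const card_ord -mulrA mulr_natl.
Qed.

(** Strict differentiability: by the mean value theorem the first-order
    expansion is uniform in the base point [q] near [p]. *)
Lemma strict_taylor (R : realType) n (V : set 'rV[R]_n) (g : 'rV[R]_n -> R) p e :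
  open V -> smooth_on V g -> V p -> 0 < e ->
  \forall q \near p & h \near (0 : 'rV[R]_n),
    `|g (q + h) - g q - \sum_(k < n) partial k g q * h 0 k| <= e * `|h|.
Proof.
move=> Vo sg Vp e0.
(* Between two points near [p] each partial derivative varies by at most [2 e']. *)
pose e' := e / (2 * n.+1%:R); have e'0 : 0 < e' by rewrite divr_gt0// mulr_gt0.
have : \forall q \near p, V q /\ forall k, `|partial k g p - partial k g q| <= e'.
  near=> q; split; first by near: q; exact: open_nbhs_nbhs.
  near: q; apply: filter_forall => k.
  have : {for p, continuous (partial k g)}.
    apply: differentiable_continuous.
    exact: smooth_on_differentiable (smooth_on_partial sg) Vp.
  by move/cvgrPdist_le; apply.
case/nbhs_ballP => r /= r0 Hr.
have r20 : 0 < r / 2 by rewrite divr_gt0.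
exists (ball p (r / 2), ball (0 : 'rV[R]_n) (r / 2)) => /=.
  by split; exact: nbhsx_ballx.
case=> q h [/= pq h0].
have hr : `|h| < r / 2 by move: h0; rewrite -ball_normE/= sub0r normrN.
have seg (t : R) : 0 <= t -> t <= 1 -> ball p r (q + t *: h).
  move=> t0 t1; rewrite -ball_normE/= opprD addrA (splitr r).
  apply: (le_lt_trans (ler_normB _ _)); rewrite -ball_normE/= in pq.
  apply: ltr_leD => //; rewrite normrZ ger0_norm//.
  apply: (le_trans _ (ltW hr)); exact: ler_piMl.
have dseg (t : R) : 0 <= t -> t <= 1 -> differentiable g (q + t *: h).
  by move=> t0 t1; apply: smooth_on_differentiable sg (proj1 (Hr _ (seg _ t0 t1))).
have dd (t : R) : 0 <= t -> t <= 1 -> is_derive t (1 : R) (fun s => g (q + s *: h))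
    (\sum_(k < n) partial k g (q + t *: h) * h 0 k).
  by move=> t0 t1; apply: is_derive_line; exact: dseg.
have [||c] := @MVT_segment R (fun s => g (q + s *: h))
  (fun t => \sum_(k < n) partial k g (q + t *: h) * h 0 k) 0 1 ler01.
- by move=> x; rewrite in_itv/= => /andP[x0 x1]; apply: dd; exact: ltW.
- apply: derivable_within_continuous => x; rewrite in_itv/= => /andP[x0 x1].
  by have [] := dd _ x0 x1.
rewrite in_itv/= => /andP[c0 c1]; rewrite scale1r scale0r addr0 subr0 mulr1 => ->.
rewrite -sumrB; under eq_bigr do rewrite -mulrBl.
have H k : `|partial k g (q + c *: h) - partial k g q| <= 2 * e'.
  have [_ /(_ k) H1] := Hr _ (seg _ c0 c1).
  have [_ /(_ k) H2] : V q /\ forall k, `|partial k g p - partial k g q| <= e'.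
    by apply: Hr; rewrite -[q]addr0 -(scale0r h); exact: seg.
  rewrite -(subrKA (partial k g p)).
  apply: (le_trans (ler_normD _ _)); rewrite distrC.
  by apply: le_trans (lerD H1 H2) _; rewrite mulr_natl.
apply: (le_trans (sum_mul_le h H)); apply: ler_wpM2r => //.
rewrite /e' (_ : _ * _ = e * (n%:R / n.+1%:R)).
  by apply: ler_piMr; [exact: ltW|rewrite ler_pdivrMr// mul1r ler_nat].
have n0 : n.+1%:R != 0 :> R by rewrite pnatr_eq0.
by field; rewrite -natr1 in n0 *.
Unshelve. all: by end_near. Qed.

(** By compactness, strict differentiability gives an expansion uniform on [K]. *)
Lemma uniform_taylor (R : realType) n (V K : set 'rV[R]_n) (g : 'rV[R]_n -> R) e :
  open V -> smooth_on V g -> compact K -> K `<=` V -> 0 < e ->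
  \forall h \near (0 : 'rV[R]_n), forall q, K q ->
    `|g (q + h) - g q - \sum_(k < n) partial k g q * h 0 k| <= e * `|h|.
Proof.
move=> Vo sg /compact_near_coveringP Kc KV e0.
apply: (Kc _ (nbhs (0 : 'rV[R]_n)) (fun h q =>
  `|g (q + h) - g q - \sum_(k < n) partial k g q * h 0 k| <= e * `|h|) _) => p Kp.
exact: strict_taylor Vo sg (KV _ Kp) e0.
Qed.

(** The second difference of [f] at the origin, computed by the mean value
    theorem in the first variable. *)
Lemma second_difference (R : realType) (f fs : R -> R -> R) (a b c d : R) :
  0 < d ->
  (forall s t : R, `|s| < d -> `|t| < d -> is_derive s (1 : R) (f ^~ t) (fs s t)) ->
  (forall e : R, 0 < e -> exists2 r : R, 0 < r & forall s t : R, `|s| < r -> `|t| < r ->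
    `|fs s t - a - b * s - c * t| <= e * (`|s| + `|t|)) ->
  forall e : R, 0 < e -> exists2 r : R, 0 < r & forall h : R, 0 < h -> h < r ->
    `|f h h - f h 0 - f 0 h + f 0 0 - c * h ^+ 2| <= e * h ^+ 2.
Proof.
move=> d0 df dfs e e0.
have [r r0 Hr] := dfs (e / 3) (divr_gt0 e0 (ltr0Sn _ 2)).
exists (Num.min r d) => [|h h0]; first by rewrite lt_min r0.
rewrite lt_min => /andP[hr hd].
have nd (s : R) : 0 <= s -> s <= h -> `|s| < d.
  by move=> s0 sh; rewrite ger0_norm//; exact: le_lt_trans hd.
have nr (s : R) : 0 <= s -> s <= h -> `|s| < r.
  by move=> s0 sh; rewrite ger0_norm//; exact: le_lt_trans hr.
have dphi (s : R) : 0 <= s -> s <= h ->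
    is_derive s (1 : R) (fun s => f s h - f s 0) (fs s h - fs s 0).
  by move=> s0 sh; apply: is_deriveB; apply: df; rewrite ?normr0 ?nd// ltW.
have [||s] := @MVT_segment R (fun s => f s h - f s 0)
  (fun s => fs s h - fs s 0) 0 h (ltW h0).
- by move=> x; rewrite in_itv/= => /andP[x0 x1]; apply: dphi; exact: ltW.
- apply: derivable_within_continuous => x; rewrite in_itv/= => /andP[x0 x1].
  by have [] := dphi _ x0 x1.
rewrite in_itv/= subr0 => /andP[s0 sh] E.
have -> : f h h - f h 0 - f 0 h + f 0 0 = (fs s h - fs s 0) * h by rewrite -E; ring.
have H1 := Hr s h (nr _ s0 sh) (nr _ (ltW h0) (lexx _)).
have H2 := Hr s 0 (nr _ s0 sh) ltac:(by rewrite normr0).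
rewrite (_ : _ - _ = (fs s h - a - b * s - c * h - (fs s 0 - a - b * s - c * 0)) * h);
  last by ring.
rewrite normrM (gtr0_norm h0) expr2 mulrA; apply: ler_wpM2r; first exact: ltW.
apply: (le_trans (ler_normB _ _)); apply: (le_trans (lerD H1 H2)).
rewrite normr0 (ger0_norm s0) (gtr0_norm h0).
rewrite -mulrDr -mulrA ler_pM2l//; rewrite mulrC ler_pdivrMr//; nra.
Qed.

(** Young's theorem at the origin.  Only differentiability of both first
    derivatives at the origin is available for the second variation, where they
    are integrals; both mean value estimates of the second difference apply. *)
Lemma young (R : realType) (f fs ft : R -> R -> R) (a b c a' b' c' d : R) :
  0 < d ->
  (forall s t : R, `|s| < d -> `|t| < d -> is_derive s (1 : R) (f ^~ t) (fs s t)) ->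
  (forall s t : R, `|s| < d -> `|t| < d -> is_derive t (1 : R) (f s) (ft s t)) ->
  (forall e : R, 0 < e -> exists2 r : R, 0 < r & forall s t : R, `|s| < r -> `|t| < r ->
    `|fs s t - a - b * s - c * t| <= e * (`|s| + `|t|)) ->
  (forall e : R, 0 < e -> exists2 r : R, 0 < r & forall s t : R, `|s| < r -> `|t| < r ->
    `|ft s t - a' - b' * s - c' * t| <= e * (`|s| + `|t|)) ->
  c = b'.
Proof.
move=> d0 df1 df2 dfs dft; apply/eqP; rewrite -subr_eq0 -normr_le0.
apply/ler_addgt0Pr => e e0; rewrite add0r.
have e20 : 0 < e / 2 by rewrite divr_gt0.
have [r1 r10 H1] := second_difference d0 df1 dfs e20.
have [r2 r20 H2] := @second_difference R (fun s t => f t s) (fun s t => ft t s)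
  a' c' b' d d0 (fun s t sd td => df2 t s td sd)
  ltac:(by move=> e1 /dft[r r0 Hr]; exists r => // s t sr tr;
    rewrite addrAC [`|s| + _]addrC; exact: Hr) _ e20.
pose h := Num.min r1 r2 / 2.
have h0 : 0 < h by rewrite divr_gt0// lt_min r10.
have hm : h < Num.min r1 r2.
  by rewrite ltr_pdivrMr// ltr_pMr ?ltr1n// lt_min r10.
move: hm; rewrite lt_min => /andP[/(H1 _ h0) {}H1 /(H2 _ h0) {}H2].
have h20 : 0 < h ^+ 2 by rewrite exprn_gt0.
rewrite -(ler_pM2r h20) -{1}(gtr0_norm h20) -normrM.
rewrite (_ : (c - b') * _ = (f h h - f 0 h - f h 0 + f 0 0 - b' * h ^+ 2)
  - (f h h - f h 0 - f 0 h + f 0 0 - c * h ^+ 2)); last by ring.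
apply: (le_trans (ler_normB _ _)); apply: (le_trans (lerD H2 H1)).
by rewrite [e in leRHS]splitr mulrDl.
Qed.

Lemma schwarz (R : realType) n (V : set 'rV[R]_n) (g : 'rV[R]_n -> R) i j p :
  open V -> smooth_on V g -> V p ->
  partial i (partial j g) p = partial j (partial i g) p.
Proof.
move=> Vo sg Vp.
pose ei : 'rV[R]_n := delta_mx 0 i; pose ej : 'rV[R]_n := delta_mx 0 j.
have nei k : `|delta_mx 0 k : 'rV[R]_n| <= 1.
  rewrite [leLHS]/Num.Def.normr/= mx_normrE; apply: bigmax_le => //= -[a b] _ /=.
  by rewrite mxE; case: (_ && _); rewrite ?normr0 ?normr1.
have nst (s t : R) : `|s *: ei + t *: ej| <= `|s| + `|t|.
  apply: (le_trans (ler_normD _ _)); rewrite !normrZ.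
  by apply: lerD; (apply: ler_piMr; [exact: normr_ge0|exact: nei]).
have /nbhs_ballP[r /= r0 Hr] : nbhs p V by exact: open_nbhs_nbhs.
have small (d' : R) : 0 < d' -> forall s t : R, `|s| < d' / 2 -> `|t| < d' / 2 ->
    `|s *: ei + t *: ej| < d'.
  move=> d0 s t sd td; apply: (le_lt_trans (nst s t)).
  by rewrite (splitr d') ltrD.
have inV (s t : R) : `|s| < r / 2 -> `|t| < r / 2 -> V (p + (s *: ei + t *: ej)).
  move=> sr tr; apply: Hr; rewrite -ball_normE/= opprD addrA subrr sub0r normrN.
  exact: small.
have pE k f q : partial k f q = \sum_l partial l f q * (delta_mx 0 k : 'rV[R]_n) 0 l.
  rewrite (bigD1 k)//= big1 ?addr0 ?mxE ?eqxx ?mulr1// => l /negPf lk.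
  by rewrite mxE eqxx lk mulr0.
have lin f k : smooth_on V f -> forall e : R, 0 < e -> exists2 r : R, 0 < r &
   forall s t : R, `|s| < r -> `|t| < r ->
    `|partial k f (p + (s *: ei + t *: ej)) - partial k f p
      - partial i (partial k f) p * s - partial j (partial k f) p * t|
     <= e * (`|s| + `|t|).
  move=> sf e e0.
  have := @uniform_taylor R n V [set p] (partial k f) e Vo (smooth_on_partial sf)
     (@compact_set1 _ p) ltac:(by move=> _ ->) e0.
  case/nbhs_ballP => d /= d0 Hd; exists (d / 2) => [|s t sd td]; first by rewrite divr_gt0.
  have := Hd (s *: ei + t *: ej) ltac:(by rewrite -ball_normE/= sub0r normrN; exact: small)
    p erefl.
  under eq_bigr do rewrite !mxE.
  under eq_bigr do rewrite mulrDr.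
  rewrite big_split/= opprD addrA.
  rewrite (pE i _ p) (pE j _ p) !mulr_suml => H.
  apply: (le_trans _ (le_trans H _)); last by rewrite ler_pM2l.
  rewrite le_eqVlt; apply/orP; left; apply/eqP; congr (`|_ - _ - _|);
    by apply: eq_bigr => l _; rewrite mxE eqxx /=; ring.
have r20 : 0 < r / 2 by rewrite divr_gt0.
apply/esym/(@young R (fun s t => g (p + (s *: ei + t *: ej)))
  (fun s t => partial i g (p + (s *: ei + t *: ej)))
  (fun s t => partial j g (p + (s *: ei + t *: ej)))
  _ _ _ _ _ _ (r / 2) r20 _ _ (lin _ _ sg) (lin _ _ sg)).
- move=> s t sr tr.
  have -> : (fun s => g (p + (s *: ei + t *: ej)))
     = (fun s => g (p + t *: ej + s *: ei)).
    by apply/funext => x; rewrite -addrA [t *: _ + _]addrC.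
  rewrite (_ : p + (s *: ei + t *: ej) = p + t *: ej + s *: ei); last by rewrite -addrA [t *: _ + _]addrC.
  rewrite pE; apply: is_derive_line; rewrite -addrA [t *: _ + _]addrC.
  by apply: smooth_on_differentiable sg _; exact: inV.
- move=> s t sr tr.
  have -> : (fun t => g (p + (s *: ei + t *: ej)))
     = (fun t => g (p + s *: ei + t *: ej)).
    by apply/funext => x; rewrite -addrA.
  rewrite (_ : p + (s *: ei + t *: ej) = p + s *: ei + t *: ej); last by rewrite -addrA.
  rewrite pE; apply: is_derive_line; rewrite -addrA.
  by apply: smooth_on_differentiable sg _; exact: inV.
Qed.

(** * Integrals and the skew-adjoint primitive of compactly supported functions *)

Definition Int (R : realType) (f : R -> R) : R := \int[@lebesgue_measure R]_x f x.

Definition csupp (R : realType) (M : R) (f : R -> R) : Prop :=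
  forall x, M < `|x| -> f x = 0.

Lemma csupp_le (R : realType) (M M' : R) f : M <= M' -> csupp M f -> csupp M' f.
Proof. by move=> MM' fM x M'x; apply: fM; exact: le_lt_trans M'x. Qed.

Section integral_basics.
Context {R : realType}.
Notation mu := (@lebesgue_measure R).
Implicit Types (f g : R -> R) (M : R).

Lemma integrable_csupp f M :
  continuous f -> csupp M f -> mu.-integrable setT (EFin \o f).
Proof.
move=> cf fM.
have H : mu.-integrable `[- M, M] (EFin \o f).
  apply: continuous_compact_integrable; first exact: segment_compact.
  exact: continuous_subspaceT.
rewrite integrable_mkcond//= in H; move: H.
rewrite (_ : _ \_ _ = EFin \o f)//; apply/funext => x; rewrite patchE/=.
case: ifPn => //; rewrite notin_setE/= in_itv/= => H.
by rewrite fM// ltNge ler_norml; apply/negP.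
Qed.

(** Expressed through the primitive vanishing at [-oo], the function [dinv f]
    differs from it by half the total integral. *)
Lemma dinvE f M x : continuous f -> csupp M f ->
  dinv f x = \int[mu]_(y in `]-oo, x]) f y - Int f / 2.
Proof.
move=> cf fM; have fi := integrable_csupp cf fM.
have := @Rintegral_itvB R f (BInfty R true) (BInfty R false) x.
rewrite set_itvNyy => /(_ fi isT isT).
have -> : \int[mu]_(y in [set` Interval (BRight x) (BInfty R false)]) f y
    = \int[mu]_(y in `[x, +oo[) f y.
  rewrite Rintegral_itv_obnd_cbnd//; apply: integrableS fi => //.
rewrite -/(Int f) /dinv => <-; lra.
Qed.

Lemma dinv_derive f M x : continuous f -> csupp M f ->
  is_derive x (1 : R) (dinv f) (f x).
Proof.
move=> cf fM; have fi := integrable_csupp cf fM.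
rewrite (_ : dinv f = fun x => \int[mu]_(y in `]-oo, x]) f y + - (Int f / 2));
  last by apply/funext => y; rewrite (dinvE y cf fM).
rewrite -[X in is_derive _ _ _ X]addr0; apply: is_derive1D.
have x1 : x < x + 1 by rewrite ltrDl.
have [|d e] := @continuous_FTC1 R f (BInfty R true) x (x + 1) x1 _ (ltNyr _) (cf x).
  exact: integrableS fi.
by apply: DeriveDef; [exact: d|rewrite -derive1E; exact: e].
Qed.

Lemma dinv_left f M x : continuous f -> csupp M f -> x < - M ->
  dinv f x = - (Int f / 2).
Proof.
move=> cf fM xM; rewrite (dinvE x cf fM) (_ : Rintegral _ _ _ = 0) ?add0r//.
rewrite (@eq_Rintegral _ _ _ _ _ (cst 0)) ?Rintegral_cst ?mul0r// => y.
rewrite inE/= in_itv/= => yx; apply: fM.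
rewrite lter_normr; apply/orP; right; rewrite ltrNr.
exact: le_lt_trans xM.
Qed.

Lemma dinv_right f M x : continuous f -> csupp M f -> M < x ->
  dinv f x = Int f / 2.
Proof.
move=> cf fM xM; have fi := integrable_csupp cf fM.
suff E : \int[mu]_(y in `]-oo, x]) f y = Int f.
  by rewrite (dinvE x cf fM) E; lra.
have := @Rintegral_itvB R f (BInfty R true) (BInfty R false) x.
rewrite set_itvNyy => /(_ fi isT isT); rewrite -/(Int f).
have -> : \int[mu]_(y in [set` Interval (BRight x) (BInfty R false)]) f y = 0.
  rewrite (@eq_Rintegral _ _ _ _ _ (cst 0)) ?Rintegral_cst ?mul0r// => y.
  rewrite inE/= in_itv/= andbT => xy; apply: fM.
  by rewrite lter_normr (lt_trans xM xy).
by move/eqP; rewrite subr_eq0 => /eqP.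
Qed.

(** The difference of [F] and [dinv f] is constant, and [dinv f] runs from minus to
    plus half the total integral. *)
Lemma Int_primitive f F M a b : continuous f -> csupp M f ->
  (forall x, is_derive x (1 : R) F (f x)) -> a < - M -> M < b ->
  Int f = F b - F a.
Proof.
move=> cf fM dF aM Mb.
have H x : is_derive x (1 : R) (fun y => F y - dinv f y) 0.
  rewrite -(subrr (f x)); apply: is_deriveB.
  exact: dinv_derive fM.
have := is_derive_0_is_cst a b H.
by rewrite (dinv_left cf fM aM) (dinv_right cf fM Mb); lra.
Qed.

Lemma csupp_norm (M x : R) : `|x| <= M -> - M <= x /\ x <= M.
Proof. by rewrite ler_norml => /andP[]. Qed.

Lemma continuous_derive f df : (forall x, is_derive x (1 : R) f (df x)) ->
  continuous f.
Proof.
by move=> H x; apply/differentiable_continuous/derivable1_diffP; case: (H x).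
Qed.

Lemma mvt f df a b : (forall x, is_derive x (1 : R) f (df x)) -> a < b ->
  exists2 c, a < c < b & f b - f a = df c * (b - a).
Proof.
move=> H ab; have [c] := @MVT R f df a b ab (fun x _ => H x)
  (continuous_subspaceT (continuous_derive H)).
by rewrite in_itv/=; exists c.
Qed.

Lemma dinv_bound f M e x : 0 <= M -> 0 <= e -> continuous f -> csupp M f ->
  (forall x, `|f x| <= e) -> `|dinv f x| <= e * (4 * M + 4).
Proof.
move=> M0 e0 cf fM fe.
have ad y : is_derive y (1 : R) (dinv f) (f y) by exact: dinv_derive fM.
have M1 : - (M + 1) < - M by rewrite ltrN2 ltrDl.
have M2 : M < M + 1 by rewrite ltrDl.
(* Over [-M-1, M+1] the primitive varies by at most [e (2 M + 2)], and it starts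
   from half the total integral. *)
have Il : `|Int f| <= e * (2 * M + 2).
  have [|c _] := mvt ad (_ : - (M + 1) < M + 1); first lra.
  rewrite (dinv_left cf fM M1) (dinv_right cf fM M2).
  rewrite (_ : _ - _ = Int f); last lra.
  move=> ->; rewrite normrM; apply: ler_pM => //.
  by rewrite ger0_norm; lra.
have E2 : `|Int f / 2| <= e * (2 * M + 2).
  by apply: le_trans Il; rewrite normrM ler_piMr// ger0_norm//; lra.
have E4 : e * (2 * M + 2) <= e * (4 * M + 4) by rewrite ler_wpM2l//; lra.
case: (ltrP x (- M)) => [xM|xM].
  by rewrite (dinv_left cf fM xM) normrN; exact: le_trans E4.
case: (ltrP M x) => [Mx|Mx].
  by rewrite (dinv_right cf fM Mx); exact: le_trans E4.
have [c _] := mvt ad (lt_le_trans M1 xM).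
rewrite (dinv_left cf fM M1) opprK => H.
have -> : dinv f x = f c * (x + (M + 1)) - Int f / 2 by move: H; rewrite opprK; lra.
apply: (le_trans (ler_normB _ _)).
have -> : e * (4 * M + 4) = e * (2 * M + 2) + e * (2 * M + 2) by ring.
apply: lerD => //; rewrite normrM; apply: ler_pM => //.
by rewrite ger0_norm; lra.
Qed.

Lemma Int_bound f M e : 0 <= M -> 0 <= e -> continuous f -> csupp M f ->
  (forall x, `|f x| <= e) -> `|Int f| <= e * (8 * M + 8).
Proof.
move=> M0 e0 cf fM fe; have := dinv_bound (M + 1) M0 e0 cf fM fe.
rewrite (dinv_right cf fM) ?ltrDl// normrM (ger0_norm (_ : 0 <= 2^-1))//; lra.
Qed.

(** The primitive [dinv f] is monotone with equal values at both ends, hence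
    constant. *)
Lemma Int_eq0 f M : continuous f -> csupp M f -> (forall x, 0 <= f x) ->
  Int f = 0 -> forall x, f x = 0.
Proof.
move=> cf fM f0 I0.
have ad y : is_derive y (1 : R) (dinv f) (f y) by exact: dinv_derive fM.
have mono a b : a <= b -> dinv f a <= dinv f b.
  rewrite le_eqVlt => /predU1P[->//|ab].
  have [c _ E] := mvt ad ab; rewrite -subr_ge0 E mulr_ge0// subr_ge0.
  exact: ltW.
have z x : dinv f x = 0.
  pose A := `|M| + `|x| + 1.
  have Mn := ler_norm M; have xn := ler_norm x; have xn' := ler_normr (- x).
  have xl : - x <= `|x| by rewrite -normrN ler_norm.
  have nM := normr_ge0 M; have nx := normr_ge0 x.
  have [h1 h2] : A > M /\ - A < - M by rewrite /A; split; lra.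
  have := mono x A; have := mono (- A) x.
  rewrite (dinv_left cf fM h2) (dinv_right cf fM h1) I0 mul0r oppr0 => h3 h4.
  by apply/eqP; rewrite eq_le h3 ?h4// /A; lra.
move=> x; rewrite -(derive1_is (ad x)) (_ : dinv f = cst 0) ?derive1_cst//.
by apply/funext.
Qed.

End integral_basics.

(** * Bump functions *)

(** Derivatives are handled through explicit first-order estimates, which can be
    made uniform in a parameter. *)
Lemma is_derive1_eps (R : realType) (f : R -> R) x d :
  (forall e : R, 0 < e ->
     \forall h \near (0 : R), `|f (x + h) - f x - d * h| <= e * `|h|) ->
  is_derive x (1 : R) f d.
Proof.
move=> H.
have C : h^-1 *: ((f \o shift x) (h *: 1) - f x) @[h --> 0^'] --> d.
  apply/cvgrPdist_le => e e0; near=> h.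
  have h0 : h != 0 by near: h; exact: nbhs_dnbhs_neq.
  have : `|f (x + h) - f x - d * h| <= e * `|h|.
    by near: h; apply: nbhs_dnbhs; exact: H.
  rewrite -[h *: 1]/(h * 1) mulr1 /= [h + x]addrC -ler_pdivrMr ?normr_gt0//.
  rewrite -normfV -normrM distrC; apply: le_trans; rewrite le_eqVlt; apply/orP; left.
  by apply/eqP; congr (`| _ |); rewrite -[_ *: _]/(_ * _); field.
by apply: DeriveDef; [apply/cvg_ex; exists d|exact: (cvg_lim _ C)].
Unshelve. all: by end_near. Qed.

Lemma is_derive1_epsP (R : realType) (f : R -> R) x d :
  is_derive x (1 : R) f d ->
  forall e : R, 0 < e ->
     \forall h \near (0 : R), `|f (x + h) - f x - d * h| <= e * `|h|.
Proof.
move=> [/cvg_ex[/= l Hl] dE] e e0.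
have {}dE : l = d by rewrite -dE; apply/esym/(cvg_lim _ Hl).
rewrite {}dE in Hl.
have C := (cvgrPdist_le _ _).1 Hl e e0.
have {}C : \forall h \near (0 : R), h != 0 ->
  `|d - h^-1 *: ((f \o shift x) (h *: 1) - f x)| <= e.
  exact: C.
near=> h; have [->|h0] := eqVneq h 0.
  by rewrite addr0 subrr mulr0 subr0 normr0 mulr0.
have : `|d - h^-1 *: ((f \o shift x) (h *: 1) - f x)| <= e by move: h0; near: h.
rewrite -[h *: 1]/(h * 1) mulr1 /= [h + x]addrC.
rewrite -ler_pdivrMr ?normr_gt0// -normfV -normrM distrC.
apply: le_trans; rewrite le_eqVlt; apply/orP; left.
by apply/eqP; congr (`| _ |); rewrite -[_ *: _]/(_ * _); field.
Unshelve. all: by end_near. Qed.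

Section bump.
Context {R : realType}.

Lemma poly_le_expR (p : {poly R}) :
  exists2 C : R, 0 <= C & forall y, 0 <= y -> `|p.[y]| <= C * expR y.
Proof.
exists (\sum_(i < size p) `|p`_i| * i`!%:R).
  by apply: sumr_ge0 => i _; rewrite mulr_ge0.
move=> y y0; rewrite horner_coef mulr_suml.
apply: (le_trans (ler_norm_sum _ _ _)); apply: ler_sum => i _.
rewrite normrM -mulrA; apply: ler_wpM2l => //; rewrite normrX ger0_norm//.
case: (nat_of_ord i) => [|n].
  by rewrite expr0 fact0 mul1r; rewrite -expR0 ler_expR.
rewrite mulrC -ler_pdivrMr ?ltr0n ?fact_gt0//.
by apply: le_trans (expR_ge1Dxn n y0); rewrite lerDr.
Qed.

(** The functions [p(1/x) exp(-1/x)], extended by zero to [x <= 0], form a class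
    stable under differentiation; [p = 1] gives the standard flat function. *)
Definition flatp (p : {poly R}) (x : R) : R :=
  if 0 < x then p.[x^-1] * expR (- x^-1) else 0.

Lemma is_derive_flatp p x :
  is_derive x (1 : R) (flatp p) (flatp ('X^2 * (p - p^`())) x).
Proof.
have [x0|x0|x0] := ltgtP x 0.
- rewrite {2}/flatp ltNge (ltW x0)/=.
  apply: (near_eq_is_derive _ (is_derive_cst 0 x 1)).
  near=> y; rewrite /flatp ltNge (_ : y <= 0)//.
  by apply: ltW; near: y; exact: lt_nbhsl.
- rewrite {2}/flatp x0.
  suff H : is_derive x (1 : R) (fun x => p.[x^-1] * expR (- x^-1))
      (('X^2 * (p - p^`())).[x^-1] * expR (- x^-1)).
    apply: near_eq_is_derive H.
    near=> y; rewrite /flatp (_ : 0 < y)//.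
    by near: y; exact: lt_nbhsr.
  have xn : x != 0 by rewrite gt_eqF.
  have di : is_derive x (1 : R) (fun x : R => x^-1) (- x ^- 2).
    have := @is_deriveV R id x 1 1 xn.
    by rewrite /GRing.scale/= mulr1; apply.
  have d1 := @is_derive1_comp R (horner p) (fun x => x^-1) x _ _
     (is_derive_poly p _) di.
  have d2 := @is_derive1_comp R expR (fun x => - x^-1) x _ _
     (is_derive_expR _) (is_deriveN di).
  apply: (is_derive1_eq (is_derive1M d1 d2)).
  by rewrite !hornerE /=; field.
(* At 0 the difference quotient is at most [C h], as [y^2 |p(y)| <= C exp y]. *)
- rewrite x0 {2}/flatp ltxx; apply: is_derive1_eps => e e0.
  have [C C0 HC] := poly_le_expR ('X^2 * p).
  have C1 : 0 < C + 1 by rewrite ltr_wpDl.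
  have NE : \forall h \near (0 : R), `|h| < e / (C + 1).
    by apply: nbhs0_lt; rewrite divr_gt0.
  near=> h; rewrite add0r mul0r subr0 {2}/flatp ltxx subr0 /flatp.
  case: ifPn => h0; last by rewrite normr0 mulr_ge0// ltW.
  have := HC h^-1 ltac:(by rewrite invr_ge0 ltW).
  rewrite hornerE hornerXn normrM normrX normfV (gtr0_norm h0) => H.
  have hC : h * C <= e.
    have : `|h| < e / (C + 1).
      by near: h; exact: NE.
    rewrite (gtr0_norm h0) ltr_pdivlMr// mulrDr mulr1 => hC; apply: ltW (le_lt_trans _ hC).
    by rewrite lerDl ltW.
  rewrite normrM (ger0_norm (expR_ge0 _)).
  have -> : `|p.[h^-1]| = h ^+ 2 * (h^-1 ^+ 2 * `|p.[h^-1]|) by field; rewrite gt_eqF.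
  have E0 : expR (- h^-1) * expR h^-1 = 1 by rewrite mulrC expRxMexpNx_1.
  apply: (@le_trans _ _ (h ^+ 2 * (C * expR h^-1) * expR (- h^-1))).
    by rewrite ler_wpM2r ?expR_ge0// ler_wpM2l// exprn_ge0// ltW.
  have -> : h ^+ 2 * (C * expR h^-1) * expR (- h^-1)
    = h * C * h * (expR (- h^-1) * expR h^-1) by ring.
  by rewrite E0 mulr1 ler_wpM2r// ltW.
Unshelve. all: by end_near. Qed.

Lemma smooth1_flat : smooth1 (flatp 1).
Proof.
apply: (@smooth1_class _ (fun f => exists p, f = flatp p)); last by exists 1.
move=> _ [p ->]; exists (flatp ('X^2 * (p - p^`()))); last by eexists.
exact: is_derive_flatp.
Qed.


Lemma smooth1_affine (f : R -> R) (a b : R) : smooth1 f -> smooth1 (fun x => f (a + x * b)).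
Proof.
move=> sf; apply: (@smooth1_class _
  (fun g => exists c, exists2 f, smooth1 f & g = fun x => c * f (a + x * b))).
  move=> _ [c [{sf}f sf ->]].
  exists (fun x => (c * b) * derive1 f (a + x * b)).
    move=> x.
    have d1 := @is_derive1_comp R f (fun x => a + x * b) x _ _
      (smooth1_derive sf _) (derivable_affine a b x).
    apply: (is_derive1_eq (is_derive1M (is_derive_cst c x 1) d1)).
    by rewrite mul0r add0r /cst; ring.
  by exists (c * b), (derive1 f) => //; exact: smooth1_derive1.
by exists 1, f => //; apply/funext => x; rewrite mul1r.
Qed.

Arguments smooth1_affine {f} a b _.

Definition bump (x : R) : R := flatp 1 (1 + x * 1) * flatp 1 (1 + x * -1).

Lemma smooth1_bump : smooth1 bump.
Proof. exact (smooth1M (smooth1_affine 1 1 smooth1_flat) (smooth1_affine 1 (-1) smooth1_flat)). Qed.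

Lemma flat_ge0 x : 0 <= flatp 1 x.
Proof. by rewrite /flatp; case: ifP => // _; rewrite hornerC mul1r expR_ge0. Qed.

Lemma bump_ge0 x : 0 <= bump x.
Proof. by rewrite mulr_ge0 ?flat_ge0. Qed.

Lemma csupp_bump : csupp 1 bump.
Proof.
move=> x; rewrite lter_normr /bump /flatp mulr1 mulrN1 => /orP[x1|x1].
  by rewrite [X in _ * (if X then _ else _)]ltNge (_ : 1 - x <= 0) ?mulr0//; lra.
by rewrite ltNge (_ : 1 + x <= 0) ?mul0r//; lra.
Qed.

Lemma bump0 : 0 < bump 0.
Proof.
by rewrite /bump /flatp !mul0r addr0 ltr01 hornerC mul1r mulr_gt0 ?expR_gt0.
Qed.

(** The normalised primitive of [bump] rises from 0 to 1, and [plateau] is the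
    product of a shifted copy of it with the mirror image. *)
Definition step (x : R) : R := (Int bump)^-1 * dinv bump x + 2^-1.

Definition plateau (x : R) : R := step (5 + x * 1) * step (5 + x * -1).

Let cbump : continuous bump := smooth1_continuous smooth1_bump.

Lemma Int_bump_neq0 : Int bump != 0.
Proof.
apply/eqP => /(Int_eq0 cbump csupp_bump bump_ge0)/(_ 0) b0.
by have := bump0; rewrite b0 ltxx.
Qed.

Lemma smooth1_step : smooth1 step.
Proof.
apply: smooth1D (smooth1_cst _); apply: smooth1M (smooth1_cst _) _.
apply: smooth1_intro smooth1_bump => x; exact: dinv_derive csupp_bump.
Qed.

Lemma step_left x : x < -1 -> step x = 0.
Proof.
move=> x1; rewrite /step (dinv_left cbump csupp_bump x1).
have := Int_bump_neq0 => ?; by field.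
Qed.

Lemma step_right x : 1 < x -> step x = 1.
Proof.
move=> x1; rewrite /step (dinv_right cbump csupp_bump x1).
have := Int_bump_neq0 => ?; by field.
Qed.

Lemma smooth1_plateau : smooth1 plateau.
Proof. exact (smooth1M (smooth1_affine 5 1 smooth1_step) (smooth1_affine 5 (-1) smooth1_step)). Qed.

Lemma csupp_plateau : csupp 6 plateau.
Proof.
move=> x; rewrite lter_normr /plateau mulr1 mulrN1 => /orP[x1|x1].
  by rewrite (@step_left (5 - x)) ?mulr0//; lra.
by rewrite step_left ?mul0r//; lra.
Qed.

Lemma plateau1 x : `|x| < 4 -> plateau x = 1.
Proof.
rewrite ltr_norml /plateau mulr1 mulrN1 => /andP[x1 x2].
by rewrite !step_right ?mul1r//; lra.
Qed.

End bump.

(** * Test functions *)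

Definition tf (R : realType) (f : R -> R) : Prop :=
  smooth1 f /\ exists M, csupp M f.

Section test_functions.
Context {R : realType}.
Implicit Types f g : R -> R.

Lemma tf_smooth f : tf f -> smooth1 f. Proof. by case. Qed.

Lemma tf_continuous f : tf f -> continuous f.
Proof. by case=> /smooth1_continuous. Qed.

Lemma tf_common f g : tf f -> tf g -> exists M, csupp M f /\ csupp M g.
Proof.
case=> _ [M fM] [_ [M' gM']]; exists (Num.max M M'); split.
  by apply: csupp_le fM; rewrite le_max lexx.
by apply: csupp_le gM'; rewrite le_max lexx orbT.
Qed.

Lemma tf_cst0 : tf (fun _ : R => 0).
Proof. by split; [exact: smooth1_cst|exists 0]. Qed.

Lemma tfD f g : tf f -> tf g -> tf (fun x => f x + g x).
Proof.
move=> Tf Tg; split; first exact: smooth1D (tf_smooth Tf) (tf_smooth Tg).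
have [M [fM gM]] := tf_common Tf Tg.
by exists M => x Mx; rewrite fM// gM// addr0.
Qed.

Lemma tfMl f g : tf f -> smooth1 g -> tf (fun x => f x * g x).
Proof.
move=> Tf sg; split; first exact: smooth1M (tf_smooth Tf) sg.
by case: Tf => _ [M fM]; exists M => x Mx; rewrite fM// mul0r.
Qed.

Lemma tfMr f g : smooth1 f -> tf g -> tf (fun x => f x * g x).
Proof.
move=> sf Tg; split; first exact: smooth1M sf (tf_smooth Tg).
by case: Tg => _ [M fM]; exists M => x Mx; rewrite fM// mulr0.
Qed.

Lemma tfN f : tf f -> tf (fun x => - f x).
Proof.
move=> Tf; split; first exact: smooth1N (tf_smooth Tf).
by case: Tf => _ [M fM]; exists M => x Mx; rewrite fM// oppr0.
Qed.

Lemma tfB f g : tf f -> tf g -> tf (fun x => f x - g x).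
Proof. by move=> Tf Tg; exact: tfD Tf (tfN Tg). Qed.

Lemma tf_sum n (F : 'I_n -> R -> R) :
  (forall i, tf (F i)) -> tf (fun x => \sum_i F i x).
Proof.
move=> H; rewrite -[X in tf X]fct_sumE; elim/big_ind: _ => [|f g Tf Tg|i _].
- exact: tf_cst0.
- exact: tfD Tf Tg.
- exact: H.
Qed.

Lemma csupp_derive1 f M : csupp M f -> csupp M (derive1 f).
Proof.
move=> fM x Mx; rewrite derive1E (@near_eq_derive _ _ _ _ (cst 0)) ?derive_cst//.
near=> y; apply: fM; near: y.
have : open [set y : R | M < `|y|].
  apply: (@open_comp _ _ (fun y : R => `|y|) [set y | M < y]); last exact: open_gt.
  by move=> y _; exact: norm_continuous.
by move=> oM; apply: open_nbhs_nbhs; split.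
Unshelve. all: by end_near. Qed.

Lemma tf_derive1 f : tf f -> tf (derive1 f).
Proof.
case=> sf [M fM]; split; first exact: smooth1_derive1.
by exists M; exact: csupp_derive1.
Qed.

Lemma is_derive_dinv f x : tf f -> is_derive x (1 : R) (dinv f) (f x).
Proof. by case=> sf [M fM]; exact: dinv_derive (smooth1_continuous sf) fM. Qed.

Lemma smooth1_dinv f : tf f -> smooth1 (dinv f).
Proof.
by move=> Tf; apply: smooth1_intro (tf_smooth Tf) => x; exact: is_derive_dinv.
Qed.

Lemma tf_integrable f : tf f -> (@lebesgue_measure R).-integrable setT (EFin \o f).
Proof. by case=> sf [M fM]; exact: integrable_csupp (smooth1_continuous sf) fM. Qed.

Lemma IntD f g : tf f -> tf g -> Int (fun x => f x + g x) = Int f + Int g.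
Proof. by move=> Tf Tg; rewrite /Int RintegralD//; exact: tf_integrable. Qed.

Lemma IntZ f c : tf f -> Int (fun x => c * f x) = c * Int f.
Proof. by move=> Tf; rewrite /Int RintegralZl//; exact: tf_integrable. Qed.

Lemma IntN f : tf f -> Int (fun x => - f x) = - Int f.
Proof.
move=> Tf; rewrite -mulN1r -IntZ//; congr Int.
by apply/funext => x; rewrite mulN1r.
Qed.

Lemma IntB f g : tf f -> tf g -> Int (fun x => f x - g x) = Int f - Int g.
Proof. by move=> Tf Tg; rewrite (IntD Tf (tfN Tg)) IntN. Qed.

Lemma Int0 : Int (fun _ : R => 0) = 0.
Proof. by rewrite /Int Rintegral_cst// mul0r. Qed.

Lemma Int_sum n (F : 'I_n -> R -> R) : (forall i, tf (F i)) ->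
  Int (fun x => \sum_i F i x) = \sum_i Int (F i).
Proof.
elim: n F => [|n IH] F HF.
  by rewrite big_ord0 -[RHS]Int0; congr Int; apply/funext => x; rewrite big_ord0.
rewrite big_ord_recl -IH; last by move=> i; exact: HF.
rewrite -IntD; [|exact: HF|by apply: tf_sum => i; exact: HF].
by congr Int; apply/funext => x; rewrite big_ord_recl.
Qed.

Lemma Int_derive1 f df : tf f -> (forall x, is_derive x (1 : R) f (df x)) ->
  Int df = 0.
Proof.
move=> Tf H; have [_ [M fM]] := Tf; pose A := `|M| + 1.
have MA : M < A by rewrite /A ltr_pwDr// ler_norm.
have A1 : `|A| = A by rewrite ger0_norm// addr_ge0.
have E : df = derive1 f by apply/funext => x; rewrite (derive1_is (H x)).
have [sdf _] := tf_derive1 Tf; rewrite -E in sdf.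
have dM : csupp M df by rewrite E; exact: csupp_derive1.
have AM : - A < - M by rewrite ltrN2.
rewrite (Int_primitive (smooth1_continuous sdf) dM H AM MA).
by rewrite !fM ?subrr// ?normrN A1.
Qed.

Lemma dinvD f g : tf f -> tf g ->
  dinv (fun x => f x + g x) = fun x => dinv f x + dinv g x.
Proof.
move=> Tf Tg; apply/funext => x.
have fi := tf_integrable Tf; have gi := tf_integrable Tg.
rewrite /dinv !RintegralD//; first ring; exact: integrableS fi || exact: integrableS gi.
Qed.

Lemma dinvZ f c : tf f -> dinv (fun x => c * f x) = fun x => c * dinv f x.
Proof.
move=> Tf; apply/funext => x; have fi := tf_integrable Tf.
by rewrite /dinv !RintegralZl//; [ring|exact: integrableS fi|exact: integrableS fi].
Qed.

(** Integration by parts: the boundary values of [dinv f * dinv g] at both ends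
    agree. *)
Lemma Int_dinv_skew f g : tf f -> tf g ->
  Int (fun x => f x * dinv g x) = - Int (fun x => g x * dinv f x).
Proof.
move=> Tf Tg; have [M [fM gM]] := tf_common Tf Tg.
have T1 := tfMl Tf (smooth1_dinv Tg); have T2 := tfMl Tg (smooth1_dinv Tf).
have cT := tf_continuous (tfD T1 T2).
apply/eqP; rewrite -subr_eq0 opprK -(IntD T1 T2); pose A := `|M| + 1.
have h1 : M < A by rewrite /A ltr_pwDr// ler_norm.
have h2 : - A < - M by rewrite ltrN2.
have sT : csupp M (fun x => f x * dinv g x + g x * dinv f x).
  by move=> x Mx; rewrite fM// gM// !mul0r addr0.
have dT x : is_derive x (1 : R) (fun x => dinv f x * dinv g x)
    (f x * dinv g x + g x * dinv f x).
  rewrite [g x * _]mulrC; exact: is_derive1M (is_derive_dinv x Tf) (is_derive_dinv x Tg).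
have cf := tf_continuous Tf; have cg := tf_continuous Tg.
rewrite (Int_primitive cT sT dT h2 h1) (dinv_left cf fM h2) (dinv_left cg gM h2).
by rewrite (dinv_right cf fM h1) (dinv_right cg gM h1); apply/eqP; ring.
Qed.

Lemma Int_sqr_eq0 f : tf f -> Int (fun x => f x * f x) = 0 -> forall x, f x = 0.
Proof.
move=> Tf I0 x; apply/eqP; rewrite -sqrf_eq0 expr2; apply/eqP.
have [s [M fM]] := tfMl Tf (tf_smooth Tf).
apply: (Int_eq0 (smooth1_continuous s) fM _ I0) => y.
by rewrite -expr2 sqr_ge0.
Qed.

Lemma tf_bump : tf (@bump R).
Proof. by split; [exact: smooth1_bump|exists 1; exact: csupp_bump]. Qed.

Lemma tf_plateau : tf (@plateau R).
Proof. by split; [exact: smooth1_plateau|exists 6; exact: csupp_plateau]. Qed.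

End test_functions.

(** * Curves of test functions *)

Section curves.
Context {R : realType} {N : nat}.
Implicit Types u v xi : R -> 'rV[R]_N.

Lemma test_curveP v : test_curve v <-> forall i : 'I_N, tf (coord v i).
Proof.
split=> [[sv [M vM]] i|H].
  by split; [exact: sv|exists M => x Mx; rewrite /coord vM// mxE].
split=> [i|]; first by case: (H i).
pose M i : R := sval (cid (proj2 (H i))).
have HM i : csupp (M i) (coord v i) by exact: (svalP (cid (proj2 (H i)))).
exists (\sum_i `|M i|) => x Mx; apply/rowP => i; rewrite mxE.
apply: (HM i x); apply: le_lt_trans Mx; rewrite (bigD1 i)//=.
apply: (le_trans (ler_norm _)); rewrite lerDl.
by apply: sumr_ge0 => j _.
Qed.

Lemma test_curve_tf v (i : 'I_N) : test_curve v -> tf (coord v i).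
Proof. by move/test_curveP. Qed.

Lemma test_curve_row (f : 'I_N -> R -> R) :
  (forall i, tf (f i)) -> test_curve (fun x => \row_i f i x).
Proof.
move=> H; apply/test_curveP => i; rewrite (_ : coord _ _ = f i)//.
by apply/funext => x; rewrite /coord mxE.
Qed.

Lemma field_derive1_tf (U : set 'rV[R]_N) u (i : 'I_N) : field_in U u -> tf (derive1 (coord u i)).
Proof.
case=> su _ [M uM]; split; first exact/smooth1_derive1/su.
by exists M => x Mx; exact: uM.
Qed.

Lemma field_comp (U : set 'rV[R]_N) u g : field_in U u -> smooth_on U g -> smooth1 (fun x => g (u x)).
Proof. by case=> su Uu _ sg; exact: smooth1_comp su Uu sg. Qed.

End curves.

(** * The operator and its linearisation, integrated against test functions *)

(* Hypotheses are matched syntactically: comparing families of functions up to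
   conversion would unfold the derivatives. *)
Ltac hyp :=
  lazymatch goal with |- ?P (fun x => ?f x) => change (P f) | _ => idtac end;
  match goal with
  | H : ?P ?f |- ?P ?f => exact H
  | H : forall i, ?P (?f i) |- ?P (?f ?a) => exact (H a)
  | H : forall i j, ?P (?f i j) |- ?P (?f ?a ?b) => exact (H a b)
  | H : forall i j k, ?P (?f i j k) |- ?P (?f ?a ?b ?c) => exact (H a b c)
  | H : forall i j k l, ?P (?f i j k l) |- ?P (?f ?a ?b ?c ?d) => exact (H a b c d)
  | H : forall i, ?P (derive1 (?f i)) |- ?P (derive1 (?f ?a)) => exact (H a)
  end.

Ltac sm :=
  lazymatch goal with
  | |- smooth1 (fun x => bigop _ _ _) => refine (smooth1_sum (fun i => _)); sm
  | |- smooth1 (fun x => @?f x + - @?g x) => refine (@smooth1B _ f g _ _); sm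
  | |- smooth1 (fun x => @?f x + @?g x) => refine (@smooth1D _ f g _ _); sm
  | |- smooth1 (fun x => - @?f x) => refine (@smooth1N _ f _); sm
  | |- smooth1 (fun x => @?f x * @?g x) => refine (@smooth1M _ f g _ _); sm
  | |- smooth1 (fun=> ?c) => exact (smooth1_cst c)
  | |- smooth1 (fun x => dinv _ x) => refine (smooth1_dinv _); tft
  | |- smooth1 (dinv _) => refine (smooth1_dinv _); tft
  | |- _ => first [hyp | refine (tf_smooth _); hyp]
  end
with tft :=
  lazymatch goal with
  | |- tf (fun x => bigop _ _ _) => refine (tf_sum (fun i => _)); tft
  | |- tf (fun x => @?f x + - @?g x) => refine (@tfB _ f g _ _); tft
  | |- tf (fun x => @?f x + @?g x) => refine (@tfD _ f g _ _); tft
  | |- tf (fun x => - @?f x) => refine (@tfN _ f _); tft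
  | |- tf (fun x => @?f x * @?g x) =>
      first [solve [refine (@tfMl _ f g _ _); [tft|sm]]
            |solve [refine (@tfMr _ f g _ _); [sm|tft]]]
  | |- tf (fun=> 0) => exact: tf_cst0
  | |- _ => hyp
  end.

(** Along a fixed field the coefficients of the operator are functions of [x]
    alone, with [c k] for the velocity of the field.  The integral identities only
    use the chain rule for these functions, hence are proved for abstract
    families. *)
Section families.
Context {R : realType} {N : nat}.
Implicit Types (a d xi psi : 'I_N -> R -> R).

Variables (g : 'I_N -> 'I_N -> R -> R) (b : 'I_N -> 'I_N -> 'I_N -> R -> R).
Variables (K : R) (c : 'I_N -> R -> R).
Variables (G : 'I_N -> 'I_N -> 'I_N -> R -> R).
Variables (B : 'I_N -> 'I_N -> 'I_N -> 'I_N -> R -> R).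
Hypothesis sg : forall i j, smooth1 (g i j).
Hypothesis sb : forall i j k, smooth1 (b i j k).
Hypothesis tc : forall k, tf (c k).
Hypothesis sG : forall i j k, smooth1 (G i j k).
Hypothesis sB : forall i j k l, smooth1 (B i j k l).
Hypothesis dg : forall i j x,
  is_derive x (1 : R) (g i j) (\sum_k G i j k x * c k x).
Hypothesis db : forall i j k x,
  is_derive x (1 : R) (b i j k) (\sum_l B i j k l x * c l x).

Definition fam_op (psi : 'I_N -> R -> R) (i : 'I_N) (x : R) : R :=
  \sum_(j < N)
    (g i j x * derive1 (psi j) x
     + (\sum_(k < N) b i j k x * c k x) * psi j x
     + K * c i x * dinv (fun y => c j y * psi j y) x).

(** [fam_op] with its coefficients differentiated in the direction [w] of the
    field; [G] and [B] stand for the gradients of [g] and [b] along the field. *)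
Definition fam_dop (w psi : 'I_N -> R -> R) (i : 'I_N) (x : R) : R :=
  \sum_(j < N)
    ((\sum_(k < N) G i j k x * w k x) * derive1 (psi j) x
     + (\sum_(k < N) ((\sum_(l < N) B i j k l x * w l x) * c k x
                      + b i j k x * derive1 (w k) x)) * psi j x
     + K * (derive1 (w i) x * dinv (fun y => c j y * psi j y) x
            + c i x * dinv (fun y => derive1 (w j) y * psi j y) x)).

(** The covector representing the linear form
    [w |-> Int (sum_i xi i * fam_dop w psi i)]; see [adjoint]. *)
Definition fam_theta (xi psi : 'I_N -> R -> R) (k : 'I_N) (x : R) : R :=
  \sum_(i < N) \sum_(j < N)
    (G i j k x * xi i x * derive1 (psi j) x
     + (\sum_(l < N) (B i j l k x - B i j k l x) * c l x) * xi i x * psi j x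
     - b i j k x * (derive1 (xi i) x * psi j x + xi i x * derive1 (psi j) x))
  + K * (derive1 (psi k) x * (\sum_(j < N) dinv (fun y => c j y * xi j y) x)
         + psi k x * (\sum_(j < N) c j x * xi j x)
         - derive1 (xi k) x * (\sum_(j < N) dinv (fun y => c j y * psi j y) x)
         - xi k x * (\sum_(j < N) c j x * psi j x)).

Lemma tf_fam_op psi i : (forall j, tf (psi j)) -> tf (fam_op psi i).
Proof.
move=> tp; have tp' j : tf (derive1 (psi j)) by exact: tf_derive1.
rewrite /fam_op; tft.
Qed.

Lemma tf_fam_theta xi psi k : (forall j, tf (xi j)) -> (forall j, tf (psi j)) ->
  tf (fam_theta xi psi k).
Proof.
move=> tx tp; have tp' j : tf (derive1 (psi j)) by exact: tf_derive1.
have tx' j : tf (derive1 (xi j)) by exact: tf_derive1.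
rewrite /fam_theta; tft.
Qed.

(** The failure of skew-symmetry.  After integration by parts the nonlocal terms
    cancel by the skew-adjointness of [dinv], and the derivative of
    [g_ij xi_i psi_j] has integral zero. *)
Lemma skew_defect xi psi :
  (forall j, tf (xi j)) -> (forall j, tf (psi j)) ->
  Int (fun x => \sum_i xi i x * fam_op psi i x)
  + Int (fun x => \sum_i psi i x * fam_op xi i x)
  = Int (fun x => \sum_i \sum_j ((g j i x - g i j x) * (psi j x * derive1 (xi i) x)
      + (\sum_k (b i j k x + b j i k x - G i j k x) * c k x) * (xi i x * psi j x))).
Proof.
move=> tx tp; have tp' j : tf (derive1 (psi j)) by exact: tf_derive1.
have tx' j : tf (derive1 (xi j)) by exact: tf_derive1.
have to1 i : tf (fam_op psi i) by exact: tf_fam_op.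
have to2 i : tf (fam_op xi i) by exact: tf_fam_op.
rewrite -IntD; [|tft|tft].
pose q j := dinv (fun y => c j y * psi j y).
pose r i := dinv (fun y => c i y * xi i y).
pose D i j x := (\sum_k G i j k x * c k x) * (xi i x * psi j x)
  + g i j x * (derive1 (xi i) x * psi j x + xi i x * derive1 (psi j) x).
pose E i j x := (c i x * xi i x) * q j x + (c j x * psi j x) * r i x.
pose A i j x := (g j i x - g i j x) * (psi j x * derive1 (xi i) x)
      + (\sum_k (b i j k x + b j i k x - G i j k x) * c k x) * (xi i x * psi j x).
have tA i j : tf (A i j) by rewrite /A; tft.
have tD i j : tf (D i j) by rewrite /D; tft.
have tE i j : tf (E i j) by rewrite /E /q /r; tft.
have D0 i j : Int (D i j) = 0.
  apply: (@Int_derive1 _ (fun x => g i j x * (xi i x * psi j x))); first tft.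
  move=> x; rewrite /D; refine (is_derive1M (dg i j x) (is_derive1M _ _)).
    exact: smooth1_derive (tf_smooth (tx i)) x.
  exact: smooth1_derive (tf_smooth (tp j)) x.
have E0 i j : Int (E i j) = 0.
  rewrite /E IntD; [|rewrite /q; tft|rewrite /r; tft].
  rewrite /q /r (@Int_dinv_skew _ (fun x => c i x * xi i x)); [|tft|tft].
  by rewrite addNr.
transitivity (Int (fun x => \sum_i \sum_j (A i j x + D i j x + K * E i j x))).
  congr Int; apply/funext => x.
  rewrite /fam_op; under eq_bigr do rewrite mulr_sumr.
  under [X in _ + X]eq_bigr do rewrite mulr_sumr.
  rewrite [X in _ + X]exchange_big -big_split /=; apply: eq_bigr => i _.
  rewrite -big_split /=; apply: eq_bigr => j _; rewrite /A /D /E /q /r.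
  have -> : \sum_k (b i j k x + b j i k x - G i j k x) * c k x
     = \sum_k b i j k x * c k x + \sum_k b j i k x * c k x
       - \sum_k G i j k x * c k x.
    rewrite -big_split -sumrB /=; apply: eq_bigr => k _; ring.
  ring.
rewrite Int_sum => [|i]; last tft.
rewrite Int_sum => [|i]; last tft.
apply: eq_bigr => i _; rewrite Int_sum => [|j]; last tft.
rewrite Int_sum => [|j]; last tft.
apply: eq_bigr => j _; rewrite IntD; [|tft|tft].
by rewrite IntD; [rewrite IntZ ?E0 ?D0 ?mulr0 ?addr0|tft|tft].
Qed.

(** Integration by parts moves the derivatives off [w]: the local terms in
    [derive1 (w k)] and the term [xi i * derive1 (w i) * dinv (c j psi j)] are
    completed to total derivatives, and the term with [derive1 (w j)] under [dinv]
    is transposed by the skew-adjointness of [dinv]. *)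
Lemma adjoint w xi psi : (forall j, tf (w j)) ->
  (forall j, tf (xi j)) -> (forall j, tf (psi j)) ->
  Int (fun x => \sum_i xi i x * fam_dop w psi i x)
  = Int (fun x => \sum_k fam_theta xi psi k x * w k x).
Proof.
move=> tw tx tp; have tp' j : tf (derive1 (psi j)) by exact: tf_derive1.
have tx' j : tf (derive1 (xi j)) by exact: tf_derive1.
have tw' j : tf (derive1 (w j)) by exact: tf_derive1.
pose q j := dinv (fun y => c j y * psi j y).
pose r i := dinv (fun y => c i y * xi i y).
have sq j : smooth1 (q j) by rewrite /q; sm.
have sr j : smooth1 (r j) by rewrite /r; sm.
pose T i j x := \sum_k (G i j k x * xi i x * derive1 (psi j) x
     + (\sum_(l < N) (B i j l k x - B i j k l x) * c l x) * xi i x * psi j x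
     - b i j k x * (derive1 (xi i) x * psi j x + xi i x * derive1 (psi j) x)) * w k x
   + K * ((derive1 (psi j) x * r i x + psi j x * (c i x * xi i x)) * w j x
     - (derive1 (xi i) x * q j x + xi i x * (c j x * psi j x)) * w i x).
pose D i j x := (\sum_k ((\sum_l B i j k l x * c l x) * w k x
      + b i j k x * derive1 (w k) x)) * (xi i x * psi j x)
   + (\sum_k b i j k x * w k x) * (derive1 (xi i) x * psi j x + xi i x * derive1 (psi j) x)
   + K * ((derive1 (xi i) x * q j x + xi i x * (c j x * psi j x)) * w i x
       + xi i x * q j x * derive1 (w i) x)
   - K * ((derive1 (psi j) x * r i x + psi j x * (c i x * xi i x)) * w j x
       + psi j x * r i x * derive1 (w j) x).
pose E i j x := (c i x * xi i x) * dinv (fun y => derive1 (w j) y * psi j y) x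
   + (derive1 (w j) x * psi j x) * r i x.
have tT i j : tf (T i j) by rewrite /T; tft.
have tD i j : tf (D i j) by rewrite /D; tft.
have tE i j : tf (E i j) by rewrite /E; tft.
have dq j x : is_derive x (1 : R) (q j) (c j x * psi j x).
  by apply: (@is_derive_dinv R (fun y => c j y * psi j y)); tft.
have dr j x : is_derive x (1 : R) (r j) (c j x * xi j x).
  by apply: (@is_derive_dinv R (fun y => c j y * xi j y)); tft.
have D0 i j : Int (D i j) = 0.
  apply: (@Int_derive1 _ (fun x => (\sum_k b i j k x * w k x) * (xi i x * psi j x)
     + K * (xi i x * q j x * w i x) - K * (psi j x * r i x * w j x))); first tft.
  have d1 (f : R -> R) x : tf f -> is_derive x (1 : R) f (derive1 f x).
    by move=> tF; apply: smooth1_derive; exact: tf_smooth.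
  have dK (f : R -> R) df x : is_derive x (1 : R) f df ->
      is_derive x (1 : R) (fun y => K * f y) (K * df).
    move=> H; apply: (is_derive1_eq (is_derive1M (is_derive_cst K x 1) H)).
    by rewrite mul0r add0r.
  move=> x; rewrite /D; refine (is_deriveB (is_derive1D
    (is_derive1M (is_derive1_sum (fun k => is_derive1M (db i j k x) (d1 _ x (tw k))))
       (is_derive1M (d1 _ x (tx i)) (d1 _ x (tp j))))
    (dK _ _ _ (is_derive1M (is_derive1M (d1 _ x (tx i)) (dq j x)) (d1 _ x (tw i)))))
    (dK _ _ _ (is_derive1M (is_derive1M (d1 _ x (tp j)) (dr i x)) (d1 _ x (tw j))))).
have E0 i j : Int (E i j) = 0.
  rewrite /E IntD; [|tft|tft].
  rewrite /r (@Int_dinv_skew _ (fun x => c i x * xi i x)); [|tft|tft].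
  by rewrite addNr.
transitivity (Int (fun x => \sum_i \sum_j (T i j x + D i j x + K * E i j x))).
  congr Int; apply/funext => x; apply: eq_bigr => i _.
  rewrite /fam_dop mulr_sumr; apply: eq_bigr => j _; rewrite /T /D /E.
  have -> : \sum_(k < N) ((\sum_(l < N) B i j k l x * w l x) * c k x
                      + b i j k x * derive1 (w k) x)
    = \sum_k (\sum_(l < N) B i j l k x * c l x) * w k x
      + \sum_k b i j k x * derive1 (w k) x.
    rewrite big_split /=; congr (_ + _).
    under eq_bigr do rewrite mulr_suml.
    rewrite exchange_big /=; apply: eq_bigr => k _; rewrite mulr_suml.
    by apply: eq_bigr => l _; ring.
  have -> : \sum_k (G i j k x * xi i x * derive1 (psi j) x
     + (\sum_(l < N) (B i j l k x - B i j k l x) * c l x) * xi i x * psi j x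
     - b i j k x * (derive1 (xi i) x * psi j x + xi i x * derive1 (psi j) x)) * w k x
    = (\sum_k G i j k x * w k x) * (xi i x * derive1 (psi j) x)
      + (\sum_k (\sum_(l < N) B i j l k x * c l x) * w k x) * (xi i x * psi j x)
      - (\sum_k (\sum_(l < N) B i j k l x * c l x) * w k x) * (xi i x * psi j x)
      - (\sum_k b i j k x * w k x)
        * (derive1 (xi i) x * psi j x + xi i x * derive1 (psi j) x).
    rewrite !mulr_suml -big_split -!sumrB /=; apply: eq_bigr => k _.
    under eq_bigr do rewrite mulrBl.
    rewrite sumrB; ring.
  rewrite [in RHS]big_split /= /q; ring.
transitivity (Int (fun x => \sum_i \sum_j T i j x)).
  rewrite Int_sum => [|i]; last tft.
  rewrite Int_sum => [|i]; last tft.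
  apply: eq_bigr => i _; rewrite Int_sum => [|j]; last tft.
  rewrite Int_sum => [|j]; last tft.
  apply: eq_bigr => j _; rewrite IntD; [|tft|tft].
  by rewrite IntD; [rewrite IntZ ?E0 ?D0 ?mulr0 ?addr0|tft|tft].
congr Int; apply/funext => x; rewrite /T.
under eq_bigr do rewrite big_split /=.
rewrite big_split /=.
under [RHS]eq_bigr do rewrite /fam_theta mulrDl.
rewrite [RHS]big_split /=; congr (_ + _).
  under [RHS]eq_bigr do rewrite mulr_suml.
  rewrite [RHS]exchange_big /=; apply: eq_bigr => i _.
  under [RHS]eq_bigr do rewrite mulr_suml.
  by rewrite [RHS]exchange_big.
under eq_bigr do rewrite -mulr_sumr sumrB.
rewrite -mulr_sumr sumrB.
under [RHS]eq_bigr do rewrite -mulrA.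
rewrite -[RHS]mulr_sumr; congr (_ * _).
rewrite [X in X - _]exchange_big -sumrB /=; apply: eq_bigr => k _.
rewrite -!mulr_suml !big_split /= -!mulr_sumr /q /r; ring.
Qed.

End families.

(** * The mixed Jacobi expression *)

Section cyclic.
Context {R : comRingType} {N : nat}.
Implicit Types (a p q z : 'I_N -> R).

Variables (b : 'I_N -> 'I_N -> 'I_N -> R) (K : R) (c : 'I_N -> R).
Variables (B : 'I_N -> 'I_N -> 'I_N -> 'I_N -> R) (eta : 'I_N -> 'I_N -> R).

Definition dotf (a p : 'I_N -> R) : R := \sum_i a i * p i.

(** The operator [eta d/dx] applied to a test curve with derivative [z]. *)
Definition lower (z : 'I_N -> R) (k : 'I_N) : R := \sum_l eta k l * z l.

(** Its vanishing says that [b^{ij}_k + K delta^i_k u^j] is closed as a one-form in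
    the index [k]. *)
Definition omega (i j k l : 'I_N) : R :=
  B i j l k - B i j k l
  + K * ((i == l)%:R * (j == k)%:R - (j == l)%:R * (i == k)%:R).

Definition trib (a p z : 'I_N -> R) : R :=
  \sum_i \sum_j \sum_k b j i k * a i * p j * z k.

Definition curv (a p z : 'I_N -> R) : R :=
  \sum_i \sum_j \sum_k (\sum_l omega i j k l * c l) * a i * p j * z k.

(** The failure of [eta^{is} b^{jr}_s] to be symmetric in [i], [j]; compare
    [symdefE]. *)
Definition symdef (a p q : 'I_N -> R) : R :=
  trib a p (lower q) - trib a q (lower p).

Lemma dotf_lower_sym a p : (forall i j, eta i j = eta j i) ->
  dotf a (lower p) = dotf p (lower a).
Proof.
move=> es; rewrite /dotf /lower; under eq_bigr do rewrite mulr_sumr.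
rewrite exchange_big; apply: eq_bigr => i _ /=.
by rewrite mulr_sumr; apply: eq_bigr => j _; rewrite es; ring.
Qed.

Lemma delta_sum (f : 'I_N -> R) i : \sum_l (i == l)%:R * f l = f i.
Proof.
rewrite (bigD1 i)//= eqxx mul1r big1 ?addr0// => l /negPf li.
by rewrite eq_sym li mul0r.
Qed.

(** The hypothesis on [G] is the relation that makes the bracket skew-symmetric;
    with it the terms in [psi'] and [xi'] combine into [trib].  The undifferentiated
    terms proportional to [K] are what turns the antisymmetrised derivative of [b]
    into [omega]. *)
Lemma theta_contract G a a' p p' (Qa Qp : R) z :
  (forall i j k, G i j k = b i j k + b j i k) ->
  \sum_k (\sum_(i < N) \sum_(j < N)
    (G i j k * a i * p' j
     + (\sum_(l < N) (B i j l k - B i j k l) * c l) * a i * p j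
     - b i j k * (a' i * p j + a i * p' j))
  + K * (p' k * Qa + p k * (\sum_(j < N) c j * a j)
         - a' k * Qp - a k * (\sum_(j < N) c j * p j))) * z k
  = trib a p' z - trib p a' z + K * (dotf p' z * Qa - dotf a' z * Qp)
    + curv a p z.
Proof.
move=> HG.
have E1 : curv a p z
    = \sum_i \sum_j \sum_k (\sum_l (B i j l k - B i j k l) * c l) * a i * p j * z k
      + K * (dotf c a * dotf p z - dotf c p * dotf a z).
  have -> : K * (dotf c a * dotf p z - dotf c p * dotf a z)
     = \sum_i \sum_j \sum_k
        K * ((j == k)%:R * c i - (i == k)%:R * c j) * a i * p j * z k.
    rewrite mulrBr /dotf [in RHS](eq_bigr (fun i => K * (c i * a i * \sum_j p j * z j)
       - K * (a i * z i * \sum_j c j * p j))); last first.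
      move=> i _; rewrite !mulr_sumr -sumrB; apply: eq_bigr => j _.
      rewrite (eq_bigr (fun k => (j == k)%:R * (K * c i * a i * p j * z k)
        - (i == k)%:R * (K * c j * a i * p j * z k))); last by move=> k _; ring.
      by rewrite sumrB !delta_sum; ring.
    rewrite sumrB -!mulr_sumr -!mulr_suml; ring.
  rewrite /curv -big_split; apply: eq_bigr => i _ /=.
  rewrite -big_split; apply: eq_bigr => j _ /=.
  rewrite -big_split; apply: eq_bigr => k _ /=.
  rewrite -!mulrDl; do 3 congr (_ * _).
  rewrite /omega; under eq_bigr do rewrite mulrDl.
  rewrite big_split /=; congr (_ + _).
  rewrite (eq_bigr (fun l => (i == l)%:R * (K * (j == k)%:R * c l)
     - (j == l)%:R * (K * (i == k)%:R * c l))); last by move=> l _; ring.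
  by rewrite sumrB !delta_sum; ring.
rewrite E1; under eq_bigr do rewrite mulrDl.
rewrite big_split /=.
have -> : \sum_k K * (p' k * Qa + p k * (\sum_(j < N) c j * a j)
         - a' k * Qp - a k * (\sum_(j < N) c j * p j)) * z k
   = K * (dotf p' z * Qa - dotf a' z * Qp)
     + K * (dotf c a * dotf p z - dotf c p * dotf a z).
  rewrite /dotf -mulrDr; under eq_bigr do rewrite -mulrA.
  rewrite -mulr_sumr; congr (_ * _).
  rewrite mulr_suml mulr_suml mulr_sumr mulr_sumr -!sumrB -!big_split /=.
  by apply: eq_bigr => k _; ring.
have -> : trib p a' z = \sum_i \sum_j \sum_k b i j k * a' i * p j * z k.
  rewrite /trib exchange_big; apply: eq_bigr => i _; apply: eq_bigr => j _.
  by apply: eq_bigr => k _; ring.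
suff -> : \sum_(k < N) (\sum_(i < N) \sum_(j < N)
    (G i j k * a i * p' j
     + (\sum_(l < N) (B i j l k - B i j k l) * c l) * a i * p j
     - b i j k * (a' i * p j + a i * p' j))) * z k
  = trib a p' z - \sum_i \sum_j \sum_k b i j k * a' i * p j * z k
    + \sum_i \sum_j \sum_k (\sum_l (B i j l k - B i j k l) * c l) * a i * p j * z k.
  ring.
under eq_bigr do rewrite mulr_suml.
rewrite exchange_big /trib -sumrB -big_split; apply: eq_bigr => i _ /=.
under eq_bigr do rewrite mulr_suml.
rewrite exchange_big -sumrB -big_split; apply: eq_bigr => j _ /=.
by rewrite -sumrB -big_split; apply: eq_bigr => k _ /=; rewrite HG; ring.
Qed.

(** Summed cyclically the nonlocal terms of [theta_contract] cancel in pairs, by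
    the symmetry of [eta]. *)
Lemma cyclic_sum a a' p p' q q' (Qa Qp Qq : R) : (forall i j, eta i j = eta j i) ->
  (trib a p' (lower q') - trib p a' (lower q')
    + K * (dotf p' (lower q') * Qa - dotf a' (lower q') * Qp)
    + curv a p (lower q'))
  + (trib p q' (lower a') - trib q p' (lower a')
    + K * (dotf q' (lower a') * Qp - dotf p' (lower a') * Qq)
    + curv p q (lower a'))
  + (trib q a' (lower p') - trib a q' (lower p')
    + K * (dotf a' (lower p') * Qq - dotf q' (lower p') * Qa)
    + curv q a (lower p'))
  = symdef a p' q' + symdef p q' a' + symdef q a' p'
    + (curv a p (lower q') + curv p q (lower a') + curv q a (lower p')).
Proof.
move=> es; rewrite /symdef (dotf_lower_sym q' p')// (dotf_lower_sym q' a')//.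
rewrite (dotf_lower_sym p' a')//; ring.
Qed.

Lemma tribE a p z : trib a p (lower z)
  = \sum_i \sum_j \sum_l (\sum_k b j i k * eta k l) * (a i * p j * z l).
Proof.
apply: eq_bigr => i _; apply: eq_bigr => j _; rewrite /lower.
under eq_bigr do rewrite mulr_sumr.
rewrite exchange_big; apply: eq_bigr => l _ /=; rewrite mulr_suml.
by apply: eq_bigr => k _; ring.
Qed.

Lemma symdefE a p q : symdef a p q
  = \sum_i \sum_j \sum_l
     (\sum_k b j i k * eta k l - \sum_k b l i k * eta k j) * (a i * p j * q l).
Proof.
rewrite /symdef !tribE -sumrB; apply: eq_bigr => i _.
rewrite [X in _ - X]exchange_big -sumrB /=; apply: eq_bigr => j _.
by rewrite -sumrB; apply: eq_bigr => l _; ring.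
Qed.

End cyclic.

(** * Differentiation at [t = 0], uniformly in [x] *)

Section uniform_derivative.
Context {R : realType}.
Implicit Types (A B : R -> R -> R) (F G dF dG f g : R -> R).

Definition bnd (f : R -> R) : Prop := exists2 C : R, 0 < C & forall x, `|f x| <= C.

(** [A t = F0 + t dF + o(t)] uniformly in [x]; the bounds are what makes this
    notion stable under products. *)
Record ud A F0 dF : Prop := Ud {
  ud_exp : forall e : R, 0 < e -> \forall t \near (0 : R), forall x,
    `|A t x - F0 x - t * dF x| <= e * `|t|;
  ud_bnd0 : bnd F0;
  ud_bnd1 : bnd dF;
  ud_smooth : \forall t \near (0 : R), smooth1 (A t);
  ud_smooth0 : smooth1 F0;
  ud_smooth1 : smooth1 dF }.

Definition udc A F0 dF : Prop :=
  ud A F0 dF /\ exists M, [/\ \forall t \near (0 : R), csupp M (A t),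
    csupp M F0 & csupp M dF].

Lemma udc_ud A F0 dF : udc A F0 dF -> ud A F0 dF. Proof. by case. Qed.

Lemma bnd_csupp f M : continuous f -> csupp M f -> bnd f.
Proof.
move=> cf fM; have sc := @segment_compact R (- M) M.
have [C [_ HC]] := compact_bounded (continuous_compact (continuous_subspaceT cf) sc).
exists (`|C| + 1); first by rewrite ltr_wpDl.
move=> x; have [Mx|xM] := ltrP M `|x|; first by rewrite fM// normr0 addr_ge0.
apply: (HC (`|C| + 1)); first by rewrite ltr_pwDr// ler_norm.
by exists x => //=; rewrite in_itv/= -ler_norml.
Qed.

Lemma bnd_tf f : tf f -> bnd f.
Proof. by case=> sf [M fM]; exact: bnd_csupp (smooth1_continuous sf) fM. Qed.

Lemma bndD f g : bnd f -> bnd g -> bnd (fun x => f x + g x).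
Proof.
move=> [C C0 fC] [D D0 gD]; exists (C + D) => [|x]; first exact: addr_gt0.
by apply: (le_trans (ler_normD _ _)); exact: lerD.
Qed.

Lemma bndM f g : bnd f -> bnd g -> bnd (fun x => f x * g x).
Proof.
move=> [C C0 fC] [D D0 gD]; exists (C * D) => [|x]; first exact: mulr_gt0.
by rewrite normrM; apply: ler_pM.
Qed.

Lemma ud_lip A F0 dF : ud A F0 dF -> exists2 C : R, 0 < C &
  \forall t \near (0 : R), forall x, `|A t x - F0 x| <= C * `|t|.
Proof.
move=> [E _ [C C0 HC] _ _ _]; exists (1 + C); first exact: addr_gt0.
near=> t => x.
have /(_ x) H : forall x, `|A t x - F0 x - t * dF x| <= 1 * `|t| by near: t; exact: E.
rewrite -(subrK (t * dF x) (A t x - F0 x)).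
apply: (le_trans (ler_normD _ _)); rewrite mulrDl lerD// normrM mulrC.
by rewrite ler_wpM2r.
Unshelve. all: by end_near. Qed.

Lemma udD A F0 dF B G0 dG : ud A F0 dF -> ud B G0 dG ->
  ud (fun t x => A t x + B t x) (fun x => F0 x + G0 x) (fun x => dF x + dG x).
Proof.
move=> [E1 b1 b1' s1 s10 s1'] [E2 b2 b2' s2 s20 s2']; split.
- move=> e e0; near=> t => x.
  have /(_ x) H1 : forall x, `|A t x - F0 x - t * dF x| <= e / 2 * `|t|.
    by near: t; apply: E1; rewrite divr_gt0.
  have /(_ x) H2 : forall x, `|B t x - G0 x - t * dG x| <= e / 2 * `|t|.
    by near: t; apply: E2; rewrite divr_gt0.
  rewrite (_ : _ - _ * _ = (A t x - F0 x - t * dF x) + (B t x - G0 x - t * dG x)); last ring.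
  by apply: (le_trans (ler_normD _ _)); rewrite [e in leRHS]splitr mulrDl; exact: lerD.
- exact: bndD.
- exact: bndD.
- by apply: filterS2 s1 s2 => t sF sG; exact: smooth1D sF sG.
- exact: smooth1D s10 s20.
- exact: smooth1D s1' s2'.
Unshelve. all: by end_near. Qed.

Lemma udM A F0 dF B G0 dG : ud A F0 dF -> ud B G0 dG ->
  ud (fun t x => A t x * B t x) (fun x => F0 x * G0 x)
     (fun x => dF x * G0 x + F0 x * dG x).
Proof.
move=> uF uG; have [C C0 HC] := ud_lip uF; have [D D0 HD] := ud_lip uG.
case: uF uG => [E1 b1 b1' s1 s10 s1'] [E2 b2 b2' s2 s20 s2']; split.
(* A third of the error for each term of the product expansion. *)
- have [X X0 HX] := b1; have [Y Y0 HY] := b2.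
  move=> e e0.
  have N5 : \forall t \near (0 : R), `|t| <= e / (3 * C * D).
    by apply: nbhs0_le; rewrite divr_gt0// !mulr_gt0.
  near=> t => x.
  have /(_ x) H1 : forall x, `|A t x - F0 x - t * dF x| <= e / (3 * Y) * `|t|.
    by near: t; apply: E1; rewrite divr_gt0// mulr_gt0.
  have /(_ x) H2 : forall x, `|B t x - G0 x - t * dG x| <= e / (3 * X) * `|t|.
    by near: t; apply: E2; rewrite divr_gt0// mulr_gt0.
  have /(_ x) H3 : forall x, `|A t x - F0 x| <= C * `|t| by near: t; exact: HC.
  have /(_ x) H4 : forall x, `|B t x - G0 x| <= D * `|t| by near: t; exact: HD.
  have H5 : `|t| <= e / (3 * C * D) by near: t; exact: N5.
  rewrite (_ : _ - _ * _ = (A t x - F0 x - t * dF x) * G0 x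
     + F0 x * (B t x - G0 x - t * dG x) + (A t x - F0 x) * (B t x - G0 x)); last ring.
  have -> : e * `|t| = e / (3 * Y) * `|t| * Y + X * (e / (3 * X) * `|t|)
      + C * `|t| * (D * (e / (3 * C * D))).
    by field; rewrite !gt_eqF.
  apply: (le_trans (ler_normD _ _)); apply: lerD.
    apply: (le_trans (ler_normD _ _)); rewrite !normrM.
    by apply: lerD; apply: ler_pM.
  rewrite normrM; apply: ler_pM => //; apply: (le_trans H4).
  by rewrite ler_pM2l.
- exact: bndM.
- by apply: bndD; exact: bndM.
- by apply: filterS2 s1 s2 => t sF sG; exact: smooth1M sF sG.
- exact: smooth1M s10 s20.
- exact: smooth1D (smooth1M s1' s20) (smooth1M s10 s2').
Unshelve. all: by end_near. Qed.

Lemma ud_cst f : bnd f -> smooth1 f -> ud (fun=> f) f (fun=> 0).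
Proof.
move=> bf sf; split; [|exact: bf| | |exact: sf|exact: smooth1_cst].
- move=> e e0; near=> t => x; rewrite mulr0 subrr subr0 normr0.
  by rewrite mulr_ge0// ltW.
- by exists 1 => // x; rewrite normr0.
- by near=> t; exact: sf.
Unshelve. all: by end_near. Qed.

Lemma ud_eq A F0 dF B G0 dG : ud A F0 dF ->
  (forall t x, A t x = B t x) -> F0 = G0 -> dF = dG -> ud B G0 dG.
Proof.
move=> H E <- <-; suff <- : A = B by [].
by apply/funext => t; apply/funext => x.
Qed.

Lemma bnd_cst c : bnd (fun=> c).
Proof. by exists (`|c| + 1) => [|x]; rewrite ?ltr_wpDl// lerDl. Qed.

Lemma ud_sum n (A : 'I_n -> R -> R -> R) (F0 dF : 'I_n -> R -> R) :
  (forall i, ud (A i) (F0 i) (dF i)) ->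
  ud (fun t x => \sum_i A i t x) (fun x => \sum_i F0 i x) (fun x => \sum_i dF i x).
Proof.
elim: n A F0 dF => [|n IH] A F0 dF H.
  apply: (ud_eq (ud_cst (bnd_cst 0) (smooth1_cst 0))) => [t x||];
    rewrite ?big_ord0//; by apply/funext => x; rewrite big_ord0.
apply: (ud_eq (udD (H ord0) (IH _ _ _ (fun i => H (lift ord0 i))))) => [t x||].
- by rewrite big_ord_recl.
- by apply/funext => x; rewrite big_ord_recl.
- by apply/funext => x; rewrite big_ord_recl.
Qed.

Lemma udcD A F0 dF B G0 dG : udc A F0 dF -> udc B G0 dG ->
  udc (fun t x => A t x + B t x) (fun x => F0 x + G0 x) (fun x => dF x + dG x).
Proof.
move=> [uF [M [M1 M2 M3]]] [uG [M' [M1' M2' M3']]]; split; first exact: udD.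
have l1 : M <= Num.max M M' by rewrite le_max lexx.
have l2 : M' <= Num.max M M' by rewrite le_max lexx orbT.
exists (Num.max M M'); split.
- apply: filterS2 M1 M1' => t HF HG.
  by move=> x xM; rewrite (csupp_le l1 HF)// (csupp_le l2 HG)// addr0.
- by move=> x xM; rewrite (csupp_le l1 M2)// (csupp_le l2 M2')// addr0.
- by move=> x xM; rewrite (csupp_le l1 M3)// (csupp_le l2 M3')// addr0.
Unshelve. all: by end_near. Qed.

Lemma udcMl A F0 dF B G0 dG : udc A F0 dF -> ud B G0 dG ->
  udc (fun t x => A t x * B t x) (fun x => F0 x * G0 x)
     (fun x => dF x * G0 x + F0 x * dG x).
Proof.
move=> [uF [M [M1 M2 M3]]] uG; split; first exact: udM.
exists M; split.
- apply: filterS M1 => t HF.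
  by move=> x xM; rewrite HF// mul0r.
- by move=> x xM; rewrite M2// mul0r.
- by move=> x xM; rewrite M2// M3// !mul0r addr0.
Unshelve. all: by end_near. Qed.

Lemma udc_eq A F0 dF B G0 dG : udc A F0 dF ->
  (forall t x, A t x = B t x) -> F0 = G0 -> dF = dG -> udc B G0 dG.
Proof.
move=> H E <- <-; suff <- : A = B by [].
by apply/funext => t; apply/funext => x.
Qed.

Lemma udcMr A F0 dF B G0 dG : ud A F0 dF -> udc B G0 dG ->
  udc (fun t x => A t x * B t x) (fun x => F0 x * G0 x)
     (fun x => dF x * G0 x + F0 x * dG x).
Proof.
move=> uA uB; apply: (udc_eq (udcMl uB uA)) => [t x||]; first exact: mulrC.
  by apply/funext => x; exact: mulrC.
by apply/funext => x; rewrite addrC; congr (_ + _); exact: mulrC.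
Qed.

Lemma udc0 : udc (fun _ _ => 0) (fun=> 0) (fun=> 0).
Proof.
split; first exact: ud_cst (bnd_cst 0) (smooth1_cst 0).
by exists 0; split => //; near=> t.
Unshelve. all: by end_near. Qed.

Lemma udc_sum n (A : 'I_n -> R -> R -> R) (F0 dF : 'I_n -> R -> R) :
  (forall i, udc (A i) (F0 i) (dF i)) ->
  udc (fun t x => \sum_i A i t x) (fun x => \sum_i F0 i x) (fun x => \sum_i dF i x).
Proof.
elim: n A F0 dF => [|n IH] A F0 dF H.
  apply: (udc_eq udc0) => [t x||];
    rewrite ?big_ord0//; by apply/funext => x; rewrite big_ord0.
apply: (udc_eq (udcD (H ord0) (IH _ _ _ (fun i => H (lift ord0 i))))) => [t x||].
- by rewrite big_ord_recl.
- by apply/funext => x; rewrite big_ord_recl.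
- by apply/funext => x; rewrite big_ord_recl.
Qed.

Lemma udc_tf A F0 dF : udc A F0 dF ->
  [/\ \forall t \near (0 : R), tf (A t), tf F0 & tf dF].
Proof.
move=> [[_ _ _ s s0 s1] [M [M1 M2 M3]]]; split.
- by apply: filterS2 s M1 => t st Mt; split=> //; exists M.
- by split => //; exists M.
- by split => //; exists M.
Unshelve. all: by end_near. Qed.

Lemma bnd_dinv f : tf f -> bnd (dinv f).
Proof.
move=> Tf; have [C C0 HC] := bnd_tf Tf; case: Tf => sf [M fM].
have M0 : 0 <= `|M| by [].
have fM' := csupp_le (ler_norm M) fM.
exists (C * (4 * `|M| + 4)) => [|x]; first by rewrite mulr_gt0// ltr_wpDl// mulr_ge0.
exact: dinv_bound M0 (ltW C0) (smooth1_continuous sf) fM' HC.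
Qed.

(** The remainder of a compactly supported expansion has small integral and small
    primitive, since its support is fixed. *)
Lemma udc_rem A F0 dF : udc A F0 dF -> exists2 M : R, 0 <= M &
  forall e : R, 0 < e -> \forall t \near (0 : R),
   [/\ tf (fun x => A t x - F0 x - t * dF x),
      csupp M (fun x => A t x - F0 x - t * dF x) &
      forall x, `|A t x - F0 x - t * dF x| <= e * `|t| ].
Proof.
move=> [[E _ _ s s0 s1] [M [M1 M2 M3]]]; exists `|M| => // e e0; near=> t.
have st : smooth1 (A t) by near: t; exact: s.
have Mt : csupp M (A t) by near: t; exact: M1.
have c : csupp `|M| (fun x => A t x - F0 x - t * dF x).
  move=> x xM; have {}xM := le_lt_trans (ler_norm M) xM.
  by rewrite Mt// M2// M3// mulr0 !subr0.
split; [|exact: c|by near: t; exact: E].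
split; last by exists `|M|.
exact: smooth1B (smooth1B st s0) (smooth1M (smooth1_cst t) s1).
Unshelve. all: by end_near. Qed.

Lemma tfZ (f : R -> R) c : tf f -> tf (fun x => c * f x).
Proof. by move=> Tf; exact: tfMr (smooth1_cst c) Tf. Qed.

(** Differentiation under the integral sign. *)
Lemma udc_Int A F0 dF : udc A F0 dF ->
  is_derive (0 : R) (1 : R) (fun t => Int (A t)) (Int dF).
Proof.
move=> uF; have [M M0 HM] := udc_rem uF; have [t1 t2 t3] := udc_tf uF.
have F00 x : A 0 x = F0 x.
  have := nbhs_singleton (ud_exp (udc_ud uF) ltr01).
  by move=> /(_ x); rewrite normr0 mulr0 mul0r subr0 normr_le0 subr_eq0 => /eqP.
have F0E : A 0 = F0 by apply/funext.
apply: is_derive1_eps => e e0.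
have e'0 : 0 < e / (8 * M + 8) by rewrite divr_gt0// ltr_wpDl// mulr_ge0.
near=> t; rewrite add0r F0E.
have Ft : tf (A t) by near: t; exact: t1.
have [r1 r2 r3] : [/\ tf (fun x => A t x - F0 x - t * dF x),
      csupp M (fun x => A t x - F0 x - t * dF x) &
      forall x, `|A t x - F0 x - t * dF x| <= e / (8 * M + 8) * `|t| ].
  by near: t; exact: HM.
rewrite mulrC -IntZ// -IntB// -IntB; [|exact: tfB|exact: tfZ].
apply: (le_trans (Int_bound M0 _ (tf_continuous r1) r2 r3)).
  by rewrite mulr_ge0// ltW.
rewrite mulrAC divfK// gt_eqF// ltr_wpDl// mulr_ge0//.
Unshelve. all: by end_near. Qed.

Lemma ud_dinv A F0 dF : udc A F0 dF ->
  ud (fun t => dinv (A t)) (dinv F0) (dinv dF).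
Proof.
move=> uF; have [M M0 HM] := udc_rem uF; have [t1 t2 t3] := udc_tf uF; split.
- move=> e e0.
  have e'0 : 0 < e / (4 * M + 4) by rewrite divr_gt0// ltr_wpDl// mulr_ge0.
  near=> t => x.
  have Ft : tf (A t) by near: t; exact: t1.
  have [r1 r2 r3] : [/\ tf (fun x => A t x - F0 x - t * dF x),
      csupp M (fun x => A t x - F0 x - t * dF x) &
      forall x, `|A t x - F0 x - t * dF x| <= e / (4 * M + 4) * `|t| ].
    by near: t; exact: HM.
  have e't : 0 <= e / (4 * M + 4) * `|t| by rewrite mulr_ge0// ltW.
  have := dinv_bound x M0 e't (tf_continuous r1) r2 r3.
  rewrite (_ : (fun x => _) = (fun x => A t x + ((-1) * F0 x + (- t) * dF x))); last first.
    by apply/funext => y; ring.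
  rewrite dinvD//; last by apply: tfD; exact: tfZ.
  rewrite dinvD; [|exact: tfZ|exact: tfZ].
  rewrite !dinvZ// mulrAC divfK ?gt_eqF// ?ltr_wpDl// ?mulr_ge0//.
  by rewrite mulN1r mulNr addrA.
- exact: bnd_dinv.
- exact: bnd_dinv.
- by apply: filterS t1 => t; exact: smooth1_dinv.
- exact: smooth1_dinv.
- exact: smooth1_dinv.
Unshelve. all: by end_near. Qed.

End uniform_derivative.

(** * Variations of fields *)

Section fields.
Context {R : realType} {N : nat}.
Implicit Types (u v w : R -> 'rV[R]_N) (U : set 'rV[R]_N).

Lemma smooth_curve_continuous u : smooth_curve u -> continuous u.
Proof.
move=> su x; apply/differentiable_continuous/derivable1_diffP/derivable_mxP.
by move=> i j; rewrite ord1; exact: smooth1_derivable (su j).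
Qed.

(** A field is constant outside a segment, so it has a compact range. *)
Lemma field_range_compact U u : field_in U u ->
  exists K : set 'rV[R]_N, [/\ compact K, K `<=` U & forall x, K (u x)].
Proof.
move=> [su Uu [M uM]]; pose A := `|M| + 1.
have MA : M < A by rewrite /A ltr_pwDr// ler_norm.
have A0 : 0 < A by rewrite /A ltr_wpDl.
have cc : continuous u := smooth_curve_continuous su.
exists (u @` `[- A, A]); split.
- apply: continuous_compact; first exact: continuous_subspaceT.
  exact: segment_compact.
- by move=> _ [x _ <-].
move=> x; have [xA|Ax] := lerP `|x| A.
  by exists x => //=; rewrite in_itv/= -ler_norml.
have const a b : a < b -> (forall c, a < c < b -> A < `|c|) -> u a = u b.
  move=> ab H; apply/rowP => i; apply/esym/eqP; rewrite -subr_eq0; apply/eqP.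
  have [c /H Ac E] := mvt (smooth1_derive (su i)) ab.
  by move: E; rewrite uM ?mul0r//; exact: lt_trans Ac.
move: (Ax); rewrite lter_normr => /orP[Ax1|Ax1].
  exists A; first by rewrite /= in_itv/= lexx andbT ge0_cp// ltW.
  apply: const => // c /andP[Ac _]; exact: lt_le_trans (ler_norm c).
exists (- A); first by rewrite /= in_itv/= lexx /= ge0_cp// ltW.
apply/esym; apply: const => [|c /andP[_ Ac]]; first by rewrite ltrNr.
by rewrite -normrN; apply: lt_le_trans (ler_norm _); rewrite ltrNr.
Qed.

(** A compact set contained in an open one keeps a uniform distance from its
    complement. *)
Lemma compact_nbhs_sub U (K : set 'rV[R]_N) : open U -> compact K -> K `<=` U ->
  \forall h \near (0 : 'rV[R]_N), forall q, K q -> U (q + h).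
Proof.
move=> Uo /compact_near_coveringP Kc KU.
apply: (Kc _ (nbhs (0 : 'rV[R]_N)) (fun h q => U (q + h)) _) => p Kp.
have /nbhs_ballP[r /= r0 Hr] : nbhs p U by apply: open_nbhs_nbhs; split=> //; exact: KU.
have r20 : 0 < r / 2 by rewrite divr_gt0.
exists (ball p (r / 2), ball (0 : 'rV[R]_N) (r / 2)) => /=.
  by split; exact: nbhsx_ballx.
case=> q h [/= pq h0]; apply: Hr; move: pq h0.
rewrite -!ball_normE/= sub0r normrN => pq h0.
by rewrite opprD addrA (splitr r); apply: (le_lt_trans (ler_normB _ _)); exact: ltrD.
Qed.

Lemma test_curve_bnd w : test_curve w -> exists2 C : R, 0 < C & forall x, `|w x| <= C.
Proof.
move=> tw.
have H (i : 'I_N) : exists C : R, 0 < C /\ forall x, `|w x 0 i| <= C.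
  by have [C C0 HC] := bnd_tf (test_curve_tf i tw); exists C.
pose C i := sval (cid (H i)); have HC i := svalP (cid (H i)).
exists (1 + \sum_i C i).
  by rewrite ltr_wpDr// sumr_ge0// => i _; rewrite ltW; case: (HC i).
move=> x; rewrite [leLHS]/Num.Def.normr/= mx_normrE.
have S0 : 0 <= \sum_i C i by rewrite sumr_ge0// => i _; rewrite ltW; case: (HC i).
apply: bigmax_le => [|[a i] _ /=]; first exact: addr_ge0.
rewrite ord1 (bigD1 i)//=; have [_ /(_ x) Hx] := HC i; apply: (le_trans Hx).
rewrite addrCA lerDl addr_ge0// sumr_ge0// => j _; rewrite ltW//; by case: (HC j).
Qed.

Lemma derive1_affine_curve u w t (i : 'I_N) x : smooth_curve u -> smooth_curve w ->
  is_derive x (1 : R) (coord (fun x => u x + t *: w x) i)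
    (derive1 (coord u i) x + t * derive1 (coord w i) x).
Proof.
move=> su sw.
have -> : coord (fun x => u x + t *: w x) i = fun x => coord u i x + t * coord w i x.
  by apply/funext => y; rewrite /coord !mxE.
apply: is_derive1D; first exact: smooth1_derive (su i) x.
apply: (is_derive1_eq (is_derive1M (is_derive_cst t x 1) (smooth1_derive (sw i) x))).
by rewrite mul0r add0r.
Qed.

Lemma smooth_curve_affine u w t : smooth_curve u -> smooth_curve w ->
  smooth_curve (fun x => u x + t *: w x).
Proof.
move=> su sw i.
have -> : coord (fun x => u x + t *: w x) i = fun x => coord u i x + t * coord w i x.
  by apply/funext => y; rewrite /coord !mxE.
exact: smooth1D (su i) (smooth1M (smooth1_cst t) (sw i)).
Qed.

Lemma field_affine U u w t : field_in U u -> test_curve w ->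
  (forall x, U (u x + t *: w x)) -> field_in U (fun x => u x + t *: w x).
Proof.
move=> fu tw Ux; have [su _ [M uM]] := fu; have [sw [M' wM]] := tw.
split; [exact: smooth_curve_affine|exact: Ux|].
exists (Num.max M M') => x; rewrite gt_max => /andP[Mx M'x] i.
rewrite (derive1_is (derive1_affine_curve t i x su sw)) uM//.
have [_ [B _]] := tw; rewrite (@csupp_derive1 _ (coord w i) M') ?mulr0 ?addr0//.
by move=> y yM; rewrite /coord wM// mxE.
Qed.

Lemma field_near U u w : open U -> field_in U u -> test_curve w ->
  \forall t \near (0 : R), field_in U (fun x => u x + t *: w x).
Proof.
move=> Uo fu tw; have [K [cK KU Ku]] := field_range_compact fu.
have [C C0 HC] := test_curve_bnd tw.
have /nbhs_ballP[d /= d0 Hd] := compact_nbhs_sub Uo cK KU.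
have N1 : \forall t \near (0 : R), `|t| < d / C by apply: nbhs0_lt; rewrite divr_gt0.
apply: filterS N1 => t td; apply: field_affine => // x; apply: Hd => //.
rewrite -ball_normE/= sub0r normrN normrZ.
apply: (@le_lt_trans _ _ (`|t| * C)); first by rewrite ler_wpM2l.
by rewrite -ltr_pdivlMr.
Qed.

Lemma field_near2 U u v w : open U -> field_in U u -> test_curve v -> test_curve w ->
  exists2 r : R, 0 < r & forall s t : R, `|s| < r -> `|t| < r ->
    field_in U (fun x => u x + s *: v x + t *: w x).
Proof.
move=> Uo fu tv tw; have [K [cK KU Ku]] := field_range_compact fu.
have [C C0 HC] := test_curve_bnd tv; have [D D0 HD] := test_curve_bnd tw.
have /nbhs_ballP[d /= d0 Hd] := compact_nbhs_sub Uo cK KU.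
exists (d / (C + D)) => [|s t]; first by rewrite divr_gt0// addr_gt0.
rewrite !ltr_pdivlMr ?addr_gt0// => sr tr.
have key t' : `|t'| * (C + D) < d -> forall x, U (u x + s *: v x + t' *: w x).
  move=> {}tr x; rewrite -addrA; apply: Hd => //.
  rewrite -ball_normE/= sub0r normrN; apply: (le_lt_trans (ler_normD _ _)).
  rewrite !normrZ; apply: (@le_lt_trans _ _ (`|s| * C + `|t'| * D)).
    by apply: lerD; rewrite ler_wpM2l.
  have [st|st] := lerP `|s| `|t'|.
    apply: le_lt_trans tr; rewrite mulrDr lerD2r ler_wpM2r//; exact: ltW.
  by apply: le_lt_trans sr; rewrite mulrDr lerD2l ler_wpM2r// ltW.
apply: field_affine => //; last exact: key.
apply: field_affine => // x; have := key 0 _ x.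
by rewrite scale0r addr0; apply; rewrite normr0 mul0r.
Qed.

Lemma ud_field_comp U u w g : open U -> smooth_on U g -> field_in U u ->
  test_curve w ->
  ud (fun t x => g (u x + t *: w x)) (fun x => g (u x))
    (fun x => \sum_k partial k g (u x) * coord w k x).
Proof.
move=> Uo sg fu tw; have [K [cK KU Ku]] := field_range_compact fu.
have [C C0 HC] := test_curve_bnd tw.
have tdF : tf (fun x => \sum_k partial k g (u x) * coord w k x).
  apply: tf_sum => k; apply: tfMr; last exact: test_curve_tf.
  exact: field_comp fu (smooth_on_partial sg).
have sF : smooth1 (fun x => g (u x)) by exact: field_comp fu sg.
split; [| |exact: bnd_tf| |exact: sF|exact: tf_smooth].
- move=> e e0; have eC : 0 < e / C by rewrite divr_gt0.
  have /nbhs_ballP[d /= d0 Hd] := uniform_taylor Uo sg cK KU eC.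
  have N1 : \forall t \near (0 : R), `|t| < d / C by apply: nbhs0_lt; rewrite divr_gt0.
  apply: filterS N1 => t td x.
  have tw_small : `|t *: w x| < d.
    rewrite normrZ; apply: (@le_lt_trans _ _ (`|t| * C)); first by rewrite ler_wpM2l.
    by rewrite -ltr_pdivlMr.
  have := Hd (t *: w x) ltac:(by rewrite -ball_normE/= sub0r normrN) (u x) (Ku x).
  rewrite mulr_sumr (eq_bigr (fun k => t * (partial k g (u x) * coord w k x)));
    last by move=> k _; rewrite mxE /coord mulrCA.
  move=> H; apply: (le_trans H); rewrite normrZ.
  have -> : e * `|t| = e / C * (`|t| * C) by field; rewrite gt_eqF.
  by rewrite ler_pM2l// ler_wpM2l.
- have cg : {within K, continuous g}.
    apply: continuous_in_subspaceT => p /set_mem Kp.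
    exact/differentiable_continuous/(smooth_on_differentiable sg)/KU.
  have [B [_ HB]] := compact_bounded (continuous_compact cg cK).
  exists (`|B| + 1); first by rewrite ltr_wpDl.
  by move=> x; apply: (HB (`|B| + 1)); [rewrite ltr_pwDr// ler_norm|exists (u x)].
- apply: filterS (field_near Uo fu tw) => t ft; exact: field_comp ft sg.
Qed.

Lemma udc_tfield U u w (i : 'I_N) : field_in U u -> test_curve w ->
  udc (fun t => derive1 (coord (fun x => u x + t *: w x) i))
    (derive1 (coord u i)) (derive1 (coord w i)).
Proof.
move=> fu tw; have [su _ _] := fu; have [sw _] := tw.
have tu := field_derive1_tf i fu; have tw' := tf_derive1 (test_curve_tf i tw).
have E t : derive1 (coord (fun x => u x + t *: w x) i)
    = fun x => derive1 (coord u i) x + t * derive1 (coord w i) x.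
  by apply/funext => x; rewrite (derive1_is (derive1_affine_curve t i x su sw)).
split.
  split; [|exact: bnd_tf|exact: bnd_tf| |exact: tf_smooth|exact: tf_smooth].
  - move=> e e0; near=> t => x.
    rewrite E [X in `|X|](_ : _ = 0); last by ring.
    by rewrite normr0 mulr_ge0// ltW.
  - near=> t; rewrite E; apply: smooth1D (tf_smooth tu) _.
    exact: smooth1M (smooth1_cst t) (tf_smooth tw').
have [M [uM wM]] := tf_common tu tw'; exists M; split => //.
by near=> t; rewrite E => x xM; rewrite uM// wM// mulr0 addr0.
Unshelve. all: by end_near. Qed.

End fields.

(** * Smooth functionals and their second variation *)

Section three_parameters.
Context {R : realType}.

Definition mk3 (s t x : R) : 'rV[R]_3 := \row_(i < 3) nth 0 [:: s; t; x] i.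

Lemma mk3_0 s t x : mk3 s t x 0 0 = s. Proof. by rewrite mxE. Qed.
Lemma mk3_1 s t x : mk3 s t x 0 1 = t. Proof. by rewrite mxE. Qed.
Lemma mk3_2 s t x : mk3 s t x 0 2 = x. Proof. by rewrite mxE. Qed.

Definition box (e : R) : set 'rV[R]_3 := [set z | `|z 0 0| < e /\ `|z 0 1| < e].

Lemma open_box e : open (box e).
Proof.
have H (i : 'I_3) : open [set z : 'rV[R]_3 | `|z 0 i| < e].
  apply: (@open_comp _ _ (fun z : 'rV[R]_3 => `|z 0 i|) [set y | y < e]);
    last exact: open_lt.
  move=> z _; apply: continuous_comp; last exact: norm_continuous.
  exact/differentiable_continuous/differentiable_coord.
exact: openI (H 0) (H 1).
Qed.

Lemma mk3E s t x : mk3 s t x = mk3 0 0 x + mk3 s t 0.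
Proof. by apply/rowP => -[[|[|[]]] //] i; rewrite !mxE /= ?add0r ?addr0. Qed.

Lemma mk3_norm s t : `|mk3 s t 0| <= `|s| + `|t|.
Proof.
rewrite [leLHS]/Num.Def.normr/= mx_normrE; apply: bigmax_le; first by rewrite addr_ge0.
move=> [a [[|[|[|//]]] i]] _ /=.
- by rewrite mxE /= lerDl.
- by rewrite mxE /= lerDr.
- by rewrite mxE /= normr0 addr_ge0.
Qed.

Lemma sum3_mk3 (f : 'I_3 -> R) s t x :
  \sum_k f k * mk3 s t x 0 k = f 0 * s + f 1 * t + f 2 * x.
Proof.
rewrite !big_ord_recl big_ord0 addr0 !mxE /= addrA.
by congr (f _ * _ + f _ * _ + f _ * _); apply: val_inj.
Qed.

Lemma mk3_box e s t x : `|s| < e -> `|t| < e -> box e (mk3 s t x).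
Proof. by move=> se te; rewrite /box/= mk3_0 mk3_1. Qed.

Lemma smooth_curve_mk3 s t : smooth_curve (mk3 s t).
Proof.
move=> [[|[|[|//]]] i].
- have -> : coord (mk3 s t) (Ordinal i) = fun=> s by apply/funext => x; rewrite /coord mxE.
  exact: smooth1_cst.
- have -> : coord (mk3 s t) (Ordinal i) = fun=> t by apply/funext => x; rewrite /coord mxE.
  exact: smooth1_cst.
- have -> : coord (mk3 s t) (Ordinal i) = fun x => x by apply/funext => x; rewrite /coord mxE.
  exact: smooth1_id.
Qed.

Lemma derive_mk3 (g : 'rV[R]_3 -> R) e s t x : smooth_on (box e) g ->
  `|s| < e -> `|t| < e ->
  is_derive x (1 : R) (fun x => g (mk3 s t x)) (partial 2 g (mk3 s t x)).
Proof.
move=> sg se te.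
have dg := smooth_on_differentiable sg (mk3_box x se te).
have := is_derive_comp_curve dg
  (fun i => @smooth1_derivable _ _ x (@smooth_curve_mk3 s t i)).
rewrite (eq_bigr (fun k => partial k g (mk3 s t x) * mk3 0 0 1 0 k)); last first.
  move=> [[|[|[|//]]] i] _; congr (_ * _); rewrite mxE /=.
  - rewrite (_ : coord _ _ = fun=> s) ?derive1_cst//.
    by apply/funext => y; rewrite /coord mxE.
  - rewrite (_ : coord _ _ = fun=> t) ?derive1_cst//.
    by apply/funext => y; rewrite /coord mxE.
  - rewrite (_ : coord _ _ = id) ?derive1_id//.
    by apply/funext => y; rewrite /coord mxE.
by rewrite sum3_mk3 !mulr0 !add0r mulr1.
Qed.

(** The shape of a coordinate of the variational derivative along a two-parameter
    variation: [z 0 0] and [z 0 1] are the parameters, [z 0 2] is the point [x]. *)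
Definition fam3 (e M : R) (g : 'rV[R]_3 -> R) : Prop :=
  smooth_on (box e) g /\ forall z, box e z -> M < `|z 0 2| -> g z = 0.

Lemma fam3_partial e M g k : fam3 e M g -> fam3 e M (partial k g).
Proof.
move=> [sg g0]; split; first exact: smooth_on_partial.
move=> z ze zM; rewrite /partial (@near_eq_derive _ _ _ _ (cst 0)) ?derive_cst//.
have H : open (box e `&` [set z : 'rV[R]_3 | M < `|z 0 2|]).
  apply: openI; first exact: open_box.
  apply: (@open_comp _ _ (fun z : 'rV[R]_3 => `|z 0 2|) [set y | M < y]);
    last exact: open_gt.
  move=> y _; apply: continuous_comp; last exact: norm_continuous.
  exact/differentiable_continuous/differentiable_coord.
have : \forall y \near z, (box e `&` [set z : 'rV[R]_3 | M < `|z 0 2|]) y.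
  by apply: open_nbhs_nbhs.
by apply: filterS => y [ye yM]; rewrite g0.
Qed.

Lemma fam3_tf e M g s t : fam3 e M g -> `|s| < e -> `|t| < e ->
  tf (fun x => g (mk3 s t x)).
Proof.
move=> [sg g0] se te; split.
  apply: smooth1_comp sg => [|x]; [exact: smooth_curve_mk3|exact: mk3_box].
by exists M => x Mx; apply: g0; [exact: mk3_box|rewrite mk3_2].
Qed.

Lemma fam3_taylor e M g a : 0 < e -> fam3 e M g -> 0 < a ->
  exists2 r : R, 0 < r & forall s t x : R, `|s| < r -> `|t| < r ->
    `|g (mk3 s t x) - g (mk3 0 0 x) - s * partial 0 g (mk3 0 0 x)
      - t * partial 1 g (mk3 0 0 x)| <= a * (`|s| + `|t|).
Proof.
move=> e0 fg a0; have [sg g0] := fg.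
have n0 : `|0 : R| < e by rewrite normr0.
pose K := mk3 0 0 @` `[- M, M].
have cK : compact K.
  apply: continuous_compact; last exact: segment_compact.
  apply: continuous_subspaceT; apply: smooth_curve_continuous.
  exact: smooth_curve_mk3.
have KU : K `<=` box e by move=> _ [x _ <-]; exact: mk3_box.
have /nbhs_ballP[d /= d0 Hd] := uniform_taylor (open_box (e:=e)) sg cK KU a0.
exists (Num.min (d / 2) e); first by rewrite lt_min e0 divr_gt0.
move=> s t x; rewrite !lt_min => /andP[sd se] /andP[td te].
(* Where [x] is outside the common support every term vanishes; the remaining [x]
   range over a compact set. *)
have [Mx|xM] := ltrP M `|x|.
  have z (f : 'rV[R]_3 -> R) s' t' : fam3 e M f -> `|s'| < e -> `|t'| < e ->
      f (mk3 s' t' x) = 0.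
    by move=> [_ f0] s'e t'e; apply: f0; [exact: mk3_box|rewrite mk3_2].
  rewrite !z//; try exact: fam3_partial.
  by rewrite !mulr0 !subr0 normr0 mulr_ge0 ?addr_ge0// ltW.
have st : `|mk3 s t 0| < d.
  by apply: (le_lt_trans (mk3_norm s t)); rewrite (splitr d) ltrD.
have := Hd (mk3 s t 0) ltac:(by rewrite -ball_normE/= sub0r normrN) (mk3 0 0 x)
  ltac:(by exists x => //=; rewrite in_itv/= -ler_norml).
rewrite -mk3E sum3_mk3 mulr0 addr0 opprD addrA [_ * s]mulrC [_ * t]mulrC => H.
by apply: (le_trans H); rewrite ler_pM2l// mk3_norm.
Qed.

Lemma fam3_udc e M g : 0 < e -> fam3 e M g ->
  udc (fun t x => g (mk3 0 t x)) (fun x => g (mk3 0 0 x))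
    (fun x => partial 1 g (mk3 0 0 x)).
Proof.
move=> e0 fg; have n0 : `|0 : R| < e by rewrite normr0.
have N1 : \forall t \near (0 : R), `|t| < e by exact: nbhs0_lt.
have t0 := fam3_tf fg n0 n0; have t1 := fam3_tf (fam3_partial 1 fg) n0 n0.
have c (f : 'rV[R]_3 -> R) t : fam3 e M f -> `|t| < e -> csupp M (fun x => f (mk3 0 t x)).
  by move=> [_ f0] te x Mx; apply: f0; [exact: mk3_box|rewrite mk3_2].
split.
  split; [|exact: bnd_tf|exact: bnd_tf| |exact: tf_smooth|exact: tf_smooth].
  - move=> a a0; have [r r0 Hr] := fam3_taylor e0 fg a0.
    have N2 : \forall t \near (0 : R), `|t| < r by exact: nbhs0_lt.
    apply: filterS N2 => t tr x.
    have := Hr 0 t x ltac:(by rewrite normr0) tr.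
    by rewrite mul0r subr0 normr0 add0r.
  - by apply: filterS N1 => t te; exact: tf_smooth (fam3_tf fg n0 te).
exists M; split; [|exact: c|exact: (c _ _ (fam3_partial 1 fg))].
by apply: filterS N1 => t te; exact: c.
Qed.

Lemma udc_near_eq (A B : R -> R -> R) (F dF : R -> R) : udc A F dF ->
  (\forall t \near (0 : R), A t = B t) -> udc B F dF.
Proof.
move=> [[E b b' s s0 s1] [M [M1 M2 M3]]] AB.
split; [split; [|exact: b|exact: b'| |exact: s0|exact: s1]|].
- by move=> e e0; apply: filterS2 AB (E e e0) => t ->.
- by apply: filterS2 AB s => t ->.
- by exists M; split; [apply: filterS2 AB M1 => t ->|exact: M2|exact: M3].
Qed.

(** Differentiation in [x] and in the parameter commute. *)
Lemma fam3_udc_derive1 e M g : 0 < e -> fam3 e M g ->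
  udc (fun t => derive1 (fun x => g (mk3 0 t x)))
    (derive1 (fun x => g (mk3 0 0 x)))
    (derive1 (fun x => partial 1 g (mk3 0 0 x))).
Proof.
move=> e0 fg; have n0 : `|0 : R| < e by rewrite normr0.
have N1 : \forall t \near (0 : R), `|t| < e by exact: nbhs0_lt.
have [sg _] := fg; have [sg1 _] := fam3_partial 1 fg.
have E (f : 'rV[R]_3 -> R) t : smooth_on (box e) f -> `|t| < e ->
    derive1 (fun x => f (mk3 0 t x)) = fun x => partial 2 f (mk3 0 t x).
  by move=> sf te; apply/funext => x; apply: derive1_is; exact: derive_mk3 sf n0 te.
apply: (@udc_near_eq (fun t x => partial 2 g (mk3 0 t x))); last first.
  by apply: filterS N1 => t te; rewrite E.
rewrite (E g 0 sg n0) (E _ 0 sg1 n0).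
have SE : (fun x => partial 1 (partial 2 g) (mk3 0 0 x))
    = (fun x => partial 2 (partial 1 g) (mk3 0 0 x)).
  apply/funext => x; apply: (@schwarz R 3 (box e)); first exact: open_box.
    exact: sg.
  exact: mk3_box.
rewrite -SE; exact: fam3_udc e0 (fam3_partial 2 fg).
Qed.

End three_parameters.

Section second_variation.
Context {R : realType} {N : nat}.
Implicit Types (u v w xi : R -> 'rV[R]_N) (U : set 'rV[R]_N) (J : functional R N).

Definition ipair (xi v : R -> 'rV[R]_N) : R :=
  Int (fun x => \sum_i coord xi i x * coord v i x).

Lemma tf_ipair xi v : test_curve xi -> smooth_curve v ->
  tf (fun x => \sum_i coord xi i x * coord v i x).
Proof. by move=> tx sv; apply: tf_sum => i; apply: tfMl (test_curve_tf i tx) (sv i). Qed.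

Lemma ipair_sum xi v : test_curve xi -> smooth_curve v ->
  ipair xi v = \sum_i Int (fun x => coord xi i x * coord v i x).
Proof.
move=> tx sv; rewrite /ipair Int_sum// => i.
exact: tfMl (test_curve_tf i tx) (sv i).
Qed.

(** Two candidates are tested against their difference. *)
Lemma is_vderiv_unique J u xi xi' : is_vderiv J u xi -> is_vderiv J u xi' -> xi = xi'.
Proof.
move=> [tx Hx] [tx' Hx'].
pose v x := \row_i (coord xi i x - coord xi' i x).
have tv : test_curve v.
  by apply: test_curve_row => i; apply: tfB; exact: test_curve_tf.
have vE i : coord v i = fun x => coord xi i x - coord xi' i x.
  by apply/funext => x; rewrite /coord mxE.
have E : ipair xi v = ipair xi' v.
  exact: etrans (esym (derive1_is (Hx v tv))) (derive1_is (Hx' v tv)).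
have sv : smooth_curve v by case: tv.
have := E; rewrite (ipair_sum tx sv) (ipair_sum tx' sv) => /eqP.
rewrite -subr_eq0 -sumrB.
rewrite (eq_bigr (fun i => Int (fun x => coord v i x * coord v i x))); last first.
  move=> i _; rewrite -IntB; [|exact: tfMl (test_curve_tf i tx) (sv i)|
    exact: tfMl (test_curve_tf i tx') (sv i)].
  by congr Int; apply/funext => x; rewrite -mulrBl vE.
rewrite psumr_eq0 => [/allP H|i _]; last first.
  by apply: Rintegral_ge0 => x _; rewrite -expr2 sqr_ge0.
apply/funext => x; apply/rowP => i.
have /= /eqP I0 := H i (mem_index_enum i).
have := Int_sqr_eq0 (test_curve_tf i tv) I0 x.
by rewrite vE => /eqP; rewrite subr_eq0 => /eqP.
Qed.

Lemma vderivE J u xi : is_vderiv J u xi -> vderiv J u = xi.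
Proof.
move=> H; apply: (is_vderiv_unique _ H).
exact: (@xgetPex _ (fun=> 0) [set xi | is_vderiv J u xi] (ex_intro _ xi H)).
Qed.

Lemma vderivP U J u : smooth_functional U J -> field_in U u ->
  is_vderiv J u (vderiv J u).
Proof. by move=> [H _] /H[xi Hxi]; rewrite (vderivE Hxi). Qed.

(** The second variation of [J] at [u], as an operator on the direction [w]. *)
Definition delta J u w (x : R) : 'rV[R]_N :=
  \row_i derive1 (fun t => vderiv J (fun y => u y + t *: w y) x 0 i) 0.

Lemma functional_fam3 U J u v w : smooth_functional U J -> field_in U u ->
  test_curve v -> test_curve w ->
  exists e M, 0 < e /\ forall i, fam3 e M (fun z =>
    vderiv J (fun x => u x + z 0 0 *: v x + z 0 1 *: w x) (z 0 2) 0 i).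
Proof.
move=> [_ H] fu tv tw; have [e [e0 [M HM] Hs]] := H u v w fu tv tw.
exists e, M; split => // i; split; first exact: Hs.
by move=> z [z0 z1] zM; rewrite HM// mxE.
Qed.

Lemma partial1_mk3 e M (g : 'rV[R]_3 -> R) x : 0 < e -> fam3 e M g ->
  partial 1 g (mk3 0 0 x) = derive1 (fun t => g (mk3 0 t x)) 0.
Proof.
move=> e0 [sg _]; have n0 : `|0 : R| < e by rewrite normr0.
have E t : mk3 0 t x = mk3 0 0 x + t *: mk3 0 1 0.
  by apply/rowP => -[[|[|[|//]]] i]; rewrite !mxE /= ?mulr0 ?mulr1 ?add0r ?addr0.
have := @is_derive_line _ _ g (mk3 0 0 x) (mk3 0 1 0) 0.
rewrite -E => /(_ (smooth_on_differentiable sg (mk3_box x n0 n0))).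
rewrite sum3_mk3 !mulr0 add0r addr0 mulr1 => /derive1_is <-.
by congr (derive1 _ 0); apply/funext => t; rewrite -E.
Qed.

Lemma partial0_mk3 e M (g : 'rV[R]_3 -> R) x : 0 < e -> fam3 e M g ->
  partial 0 g (mk3 0 0 x) = derive1 (fun s => g (mk3 s 0 x)) 0.
Proof.
move=> e0 [sg _]; have n0 : `|0 : R| < e by rewrite normr0.
have E t : mk3 t 0 x = mk3 0 0 x + t *: mk3 1 0 0.
  by apply/rowP => -[[|[|[|//]]] i]; rewrite !mxE /= ?mulr0 ?mulr1 ?add0r ?addr0.
have := @is_derive_line _ _ g (mk3 0 0 x) (mk3 1 0 0) 0.
rewrite -E => /(_ (smooth_on_differentiable sg (mk3_box x n0 n0))).
rewrite sum3_mk3 !mulr0 !addr0 mulr1 => /derive1_is <-.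
by congr (derive1 _ 0); apply/funext => t; rewrite -E.
Qed.

Lemma var2_0t u v w t : (fun x => u x + 0 *: v x + t *: w x) = fun x => u x + t *: w x.
Proof. by apply/funext => x; rewrite scale0r addr0. Qed.

Lemma var2_s0 u v w s : (fun x => u x + s *: v x + 0 *: w x) = fun x => u x + s *: v x.
Proof. by apply/funext => x; rewrite scale0r addr0. Qed.

Lemma var1_0 u w : (fun x => u x + 0 *: w x) = u.
Proof. by apply/funext => x; rewrite scale0r addr0. Qed.

Lemma functional_udc U J u w i : smooth_functional U J -> field_in U u ->
  test_curve w ->
  udc (fun t => coord (vderiv J (fun y => u y + t *: w y)) i)
    (coord (vderiv J u) i) (coord (delta J u w) i)
  /\ udc (fun t => derive1 (coord (vderiv J (fun y => u y + t *: w y)) i))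
    (derive1 (coord (vderiv J u) i)) (derive1 (coord (delta J u w) i)).
Proof.
move=> sJ fu tw; have [e [M [e0 /(_ i) Hf]]] := functional_fam3 sJ fu tw tw.
set g := (fun z => _) in Hf.
have gE t : (fun x => g (mk3 0 t x)) = coord (vderiv J (fun y => u y + t *: w y)) i.
  apply/funext => x; rewrite /g mk3_0 mk3_1 mk3_2.
  by rewrite var2_0t.
have gE0 : (fun x => g (mk3 0 0 x)) = coord (vderiv J u) i by rewrite gE var1_0.
have gE1 : (fun x => partial 1 g (mk3 0 0 x)) = coord (delta J u w) i.
  apply/funext => x; rewrite (partial1_mk3 x e0 Hf) /coord /delta mxE.
  by congr (derive1 _ 0); apply/funext => t; exact: (congr1 (@^~ x) (gE t)).
have H1 := fam3_udc e0 Hf; have H2 := fam3_udc_derive1 e0 Hf.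
rewrite gE0 gE1 in H1 H2; split.
  apply: (udc_eq H1) => // t x; exact: (congr1 (@^~ x) (gE t)).
by apply: (udc_eq H2) => // t x; rewrite gE.
Qed.

Lemma test_curve_delta U J u w : smooth_functional U J -> field_in U u ->
  test_curve w -> test_curve (delta J u w).
Proof.
move=> sJ fu tw; apply/test_curveP => i.
by have [/udc_tf[]] := functional_udc i sJ fu tw.
Qed.

Definition expands (phi : R -> R -> R) (a b c : R) : Prop :=
  forall e : R, 0 < e -> exists2 r : R, 0 < r & forall s t : R, `|s| < r -> `|t| < r ->
    `|phi s t - a - b * s - c * t| <= e * (`|s| + `|t|).

Lemma expands_sum n (phi : 'I_n -> R -> R -> R) (a b c : 'I_n -> R) :
  (forall i, expands (phi i) (a i) (b i) (c i)) ->
  expands (fun s t => \sum_i phi i s t) (\sum_i a i) (\sum_i b i) (\sum_i c i).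
Proof.
elim: n phi a b c => [|n IH] phi a b c H e e0.
  exists 1 => // s t _ _; rewrite !big_ord0 !mul0r !subr0 normr0.
  by rewrite mulr_ge0 ?addr_ge0// ltW.
have e20 : 0 < e / 2 by rewrite divr_gt0.
have [r1 r10 H1] := H ord0 _ e20.
have [r2 r20 H2] := IH _ _ _ _ (fun i => H (lift ord0 i)) _ e20.
exists (Num.min r1 r2); first by rewrite lt_min r10.
move=> s t; rewrite !lt_min => /andP[s1 s2] /andP[t1 t2].
rewrite !big_ord_recl /=.
have := lerD (H1 s t s1 t1) (H2 s t s2 t2); rewrite -mulrDl -splitr.
apply: le_trans; apply: le_trans (ler_normD _ _).
by rewrite le_eqVlt; apply/orP; left; apply/eqP; congr (`|_|); ring.
Qed.

Lemma Int_lin4 (A B C D : R -> R) s t : tf A -> tf B -> tf C -> tf D ->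
  Int A - Int B - Int C * s - Int D * t
  = Int (fun x => A x - B x - s * C x - t * D x).
Proof.
move=> TA TB TC TD; rewrite (IntB (tfB (tfB TA TB) (tfZ s TC)) (tfZ t TD)).
by rewrite (IntB (tfB TA TB) (tfZ s TC)) IntB// !IntZ// [s * _]mulrC [t * _]mulrC.
Qed.

Lemma expands_pair e M (g : 'rV[R]_3 -> R) (f : R -> R) : 0 < e -> fam3 e M g -> tf f ->
  expands (fun s t => Int (fun x => g (mk3 s t x) * f x))
    (Int (fun x => g (mk3 0 0 x) * f x))
    (Int (fun x => partial 0 g (mk3 0 0 x) * f x))
    (Int (fun x => partial 1 g (mk3 0 0 x) * f x)).
Proof.
move=> e0 fg Tf a a0; have n0 : `|0 : R| < e by rewrite normr0.
have [B B0 HB] := bnd_tf Tf.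
have [M' fM'] : exists M', csupp M' f by case: Tf.
have M0 : 0 <= `|M'| by []. have fM := csupp_le (ler_norm M') fM'.
have D0 : 0 < 8 * `|M'| + 8 by rewrite ltr_wpDl// mulr_ge0.
have [r r0 Hr] := fam3_taylor e0 fg (divr_gt0 a0 (mulr_gt0 B0 D0)).
exists (Num.min r e); first by rewrite lt_min r0.
move=> s t; rewrite !lt_min => /andP[sr se] /andP[tr te].
have T s' t' h : fam3 e M h -> `|s'| < e -> `|t'| < e -> tf (fun x => h (mk3 s' t' x) * f x).
  by move=> fh s'e t'e; apply: tfMl (tf_smooth Tf); exact: fam3_tf fh s'e t'e.
have T1 := T _ _ _ fg se te; have T2 := T _ _ _ fg n0 n0.
have T3 := T _ _ _ (fam3_partial 0 fg) n0 n0.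
have T4 := T _ _ _ (fam3_partial 1 fg) n0 n0.
rewrite (Int_lin4 s t T1 T2 T3 T4).
set h := (fun x => _).
have hE : h = fun x => (g (mk3 s t x) - g (mk3 0 0 x) - s * partial 0 g (mk3 0 0 x)
      - t * partial 1 g (mk3 0 0 x)) * f x by apply/funext => x; rewrite /h; ring.
have th : tf h := tfB (tfB (tfB T1 T2) (tfZ s T3)) (tfZ t T4).
have hM : csupp `|M'| h by move=> x xM; rewrite hE fM// mulr0.
have st0 : 0 <= `|s| + `|t| by exact: addr_ge0.
have -> : a * (`|s| + `|t|)
   = a / (B * (8 * `|M'| + 8)) * (`|s| + `|t|) * B * (8 * `|M'| + 8).
  by field; rewrite !gt_eqF.
have p0 : 0 <= a / (B * (8 * `|M'| + 8)) * (`|s| + `|t|).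
  by rewrite mulr_ge0// divr_ge0 ?mulr_ge0// ltW.
apply: (Int_bound M0 _ (tf_continuous th) hM); first by rewrite mulr_ge0// ltW.
move=> x; rewrite hE normrM.
by apply: ler_pM; [exact: normr_ge0|exact: normr_ge0|exact: Hr|exact: HB].
Qed.

Lemma is_derive_shift0 (f : R -> R) s d :
  is_derive (0 : R) (1 : R) (fun h => f (s + h)) d -> is_derive s (1 : R) f d.
Proof.
move=> H; apply: is_derive1_eps => e e0.
by apply: filterS (is_derive1_epsP H e0) => h; rewrite add0r addr0.
Qed.

(** The second variation is symmetric, being the mixed second derivative of the
    two-parameter function [J (u + s v + t w)]. *)
Lemma delta_sym U J u v w : open U -> smooth_functional U J -> field_in U u ->
  test_curve v -> test_curve w ->
  ipair (delta J u w) v = ipair (delta J u v) w.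
Proof.
move=> Uo sJ fu tv tw; have [e [M [e0 Hf]]] := functional_fam3 sJ fu tv tw.
have [r r0 Hr] := field_near2 Uo fu tv tw.
pose E (s t : R) := vderiv J (fun x => u x + s *: v x + t *: w x).
pose g i (z : 'rV[R]_3) := vderiv J (fun x => u x + z 0 0 *: v x + z 0 1 *: w x) (z 0 2) 0 i.
have Hg i : fam3 e M (g i) := Hf i.
have gE i s t x : g i (mk3 s t x) = coord (E s t) i x by rewrite /g mk3_0 mk3_1 mk3_2.
have d1 i : coord (delta J u w) i = fun x => partial 1 (g i) (mk3 0 0 x).
  apply/funext => x; rewrite (partial1_mk3 x e0 (Hg i)) /coord /delta mxE.
  by congr (derive1 _ 0); apply/funext => t; rewrite gE /E var2_0t.
have d0 i : coord (delta J u v) i = fun x => partial 0 (g i) (mk3 0 0 x).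
  apply/funext => x; rewrite (partial0_mk3 x e0 (Hg i)) /coord /delta mxE.
  by congr (derive1 _ 0); apply/funext => t; rewrite gE /E var2_s0.
have tE s t : `|s| < r -> `|t| < r -> is_vderiv J (fun x => u x + s *: v x + t *: w x) (E s t).
  by move=> sr tr; apply: vderivP sJ _; exact: Hr.
have X z : test_curve z -> expands
    (fun s t => \sum_i Int (fun x => g i (mk3 s t x) * coord z i x))
    (\sum_i Int (fun x => g i (mk3 0 0 x) * coord z i x))
    (\sum_i Int (fun x => partial 0 (g i) (mk3 0 0 x) * coord z i x))
    (\sum_i Int (fun x => partial 1 (g i) (mk3 0 0 x) * coord z i x)).
  move=> tz; apply: expands_sum => i.
  exact: (expands_pair e0 (Hg i) (test_curve_tf i tz)).
have PE s t z : `|s| < r -> `|t| < r -> test_curve z ->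
   \sum_i Int (fun x => g i (mk3 s t x) * coord z i x) = ipair (E s t) z.
  move=> sr tr tz; rewrite ipair_sum; [|by case: (tE s t sr tr)|by case: tz].
  by apply: eq_bigr => i _; congr Int; apply/funext => x; rewrite gE.
rewrite (ipair_sum (test_curve_delta sJ fu tw)); last by case: tv.
rewrite (ipair_sum (test_curve_delta sJ fu tv)); last by case: tw.
under eq_bigr do rewrite d1; under [RHS]eq_bigr do rewrite d0.
apply: (@young R (fun s t => J (fun x => u x + s *: v x + t *: w x)) _ _
   _ _ _ _ _ _ r r0 _ _ (X v tv) (X w tw)).
- move=> s t sr tr; apply: is_derive_shift0; rewrite PE//.
  have [_ /(_ v tv)] := tE s t sr tr.
  rewrite (_ : (fun h => J (fun x => u x + s *: v x + t *: w x + h *: v x))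
     = (fun h => J (fun x => u x + (s + h) *: v x + t *: w x)))//.
  apply/funext => h; congr J; apply/funext => x.
  by rewrite scalerDl addrA -!addrA; congr (_ + (_ + _)); rewrite addrC.
- move=> s t sr tr; apply: is_derive_shift0; rewrite PE//.
  have [_ /(_ w tw)] := tE s t sr tr.
  rewrite (_ : (fun h => J (fun x => u x + s *: v x + t *: w x + h *: w x))
     = (fun h => J (fun x => u x + s *: v x + (t + h) *: w x)))//.
  by apply/funext => h; congr J; apply/funext => x; rewrite scalerDl addrA.
Qed.

End second_variation.

(** * Linear functionals *)

Section linear_functionals.
Context {R : realType} {N : nat}.
Implicit Types (u v w a : R -> 'rV[R]_N).

Lemma lin_vderiv a u : test_curve a -> smooth_curve u -> is_vderiv (ipair a) u a.
Proof.
move=> ta su; split=> // v tv; have [sv _] := tv.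
have E t : ipair a (fun x => u x + t *: v x) = ipair a u + t * ipair a v.
  rewrite /ipair -IntZ; last exact: tf_ipair.
  rewrite -IntD; [|exact: tf_ipair|apply: tfZ; exact: tf_ipair].
  congr Int; apply/funext => x; rewrite mulr_sumr -big_split; apply: eq_bigr => i _ /=.
  by rewrite /coord !mxE; ring.
rewrite (_ : (fun t => _) = fun t => ipair a u + t * ipair a v); last exact/funext.
exact: derivable_affine.
Qed.

Lemma smooth_on_proj n (f : R -> R) (k : 'I_n) (V : set 'rV[R]_n) :
  smooth1 f -> smooth_on V (fun z => f (z 0 k)).
Proof.
move=> sf s x _.
have D (h : R -> R) (z : 'rV[R]_n) : smooth1 h ->
    differentiable (fun z : 'rV[R]_n => h (z 0 k)) z.
  move=> sh; apply: (@differentiable_comp _ _ _ _ (fun z : 'rV[R]_n => z 0 k) h).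
    exact: differentiable_coord.
  by apply/derivable1_diffP; exact: smooth1_derivable.
suff [h sh ->] : exists2 h : R -> R, smooth1 h &
    foldr (@partial R n) (fun z => f (z 0 k)) s = fun z => h (z 0 k) by exact: D.
elim: s => [|i s [h sh IH]] /=; first by exists f.
exists (fun y => derive1 h y * (i == k)%:R).
  exact: smooth1M (smooth1_derive1 sh) (smooth1_cst _).
rewrite IH; apply/funext => z.
have := @is_derive_line _ _ (fun z : 'rV[R]_n => h (z 0 k)) z (delta_mx 0 i) 0.
rewrite scale0r addr0 => /(_ (D h z sh)).
rewrite (bigD1 i)//= mxE !eqxx mulr1 big1 ?addr0; last first.
  by move=> j ji; rewrite mxE eqxx (negPf ji) mulr0.
move=> /derive1_is <-.
have d1 := derivable_affine (z 0 k) ((i == k)%:R : R) 0.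
have d2 := @is_derive1_comp R h (fun s => z 0 k + s * (i == k)%:R) 0 _ _
  (smooth1_derive sh _) d1.
rewrite mul0r addr0 in d2; rewrite -(derive1_is d2).
congr (derive1 _ 0); apply/funext => y /=; rewrite !mxE eqxx /=.
by rewrite [k == i]eq_sym.
Qed.

(** Linear functionals suffice to recover the coefficients: their variational
    derivatives are arbitrary test curves, the same at every field. *)
Lemma lin_smooth U a : test_curve a -> smooth_functional U (@ipair R N a).
Proof.
move=> ta; split=> [u [su _ _]|u v w fu tv tw E].
  by exists a; exact: lin_vderiv.
have [su _ _] := fu; have [sv _] := tv; have [sw _] := tw.
have EE s t : E s t = a.
  apply: vderivE; apply: lin_vderiv; first exact: ta.
  have s1 := @smooth_curve_affine _ _ u v s su sv.
  exact: (@smooth_curve_affine _ _ _ w t s1 sw).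
exists 1; split; first exact: ltr01.
  by have [_ [M HM]] := ta; exists M => s t x _ _ /HM; rewrite EE.
move=> i; have -> : (fun z : 'rV[R]_3 => E (z 0 0) (z 0 1) (z 0 2) 0 i)
    = fun z : 'rV[R]_3 => coord a i (z 0 2) by apply/funext => z; rewrite EE.
by case: ta => sa _; exact: smooth_on_proj (sa i).
Qed.

Lemma lin_vderivE U a u : test_curve a -> field_in U u -> vderiv (@ipair R N a) u = a.
Proof. by move=> ta [su _ _]; apply: vderivE; exact: lin_vderiv. Qed.

End linear_functionals.

(** * The variational derivative of a bracket *)

Lemma is_derive1_congr (R : realType) (f g : R -> R) x d d' :
  is_derive x (1 : R) f d -> (forall t, g t = f t) -> d = d' ->
  is_derive x (1 : R) g d'.
Proof. by move=> H /funext -> <-. Qed.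

Section bracket_derivative.
Context {R : realType} {N : nat}.
Variables (U : set 'rV[R]_N) (P : hydro_op R N).
Hypotheses (Uo : open U) (sP : smooth_op U P).
Implicit Types (u w xi psi : R -> 'rV[R]_N).

Definition op_g u (i j : 'I_N) (x : R) := gcoef P i j (u x).
Definition op_b u (i j k : 'I_N) (x : R) := bcoef P i j k (u x).
Definition op_c u (k : 'I_N) : R -> R := derive1 (coord u k).
Definition op_G u (i j k : 'I_N) (x : R) := partial k (gcoef P i j) (u x).
Definition op_B u (i j k l : 'I_N) (x : R) := partial l (bcoef P i j k) (u x).

Definition op_fam u psi := fam_op (op_g u) (op_b u) (Kcoef P) (op_c u) (coord psi).
Definition op_dop u w psi := fam_dop (op_b u) (Kcoef P) (op_c u) (op_G u)
  (op_B u) (coord w) (coord psi).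
Definition op_theta u xi psi := fam_theta (op_b u) (Kcoef P) (op_c u) (op_G u)
  (op_B u) (coord xi) (coord psi).

Lemma apply_opE u psi i : coord (apply_op P u psi) i = op_fam u psi i.
Proof. by apply/funext => x; rewrite /coord mxE. Qed.

Section at_field.
Variables (u : R -> 'rV[R]_N) (fu : field_in U u).

Lemma op_sg i j : smooth1 (op_g u i j).
Proof. exact: field_comp fu (sP.1 i j). Qed.

Lemma op_sb i j k : smooth1 (op_b u i j k).
Proof. exact: field_comp fu (sP.2 i j k). Qed.

Lemma op_tc k : tf (op_c u k).
Proof. exact: field_derive1_tf fu. Qed.

Lemma op_sG i j k : smooth1 (op_G u i j k).
Proof. exact: field_comp fu (smooth_on_partial (sP.1 i j)). Qed.

Lemma op_sB i j k l : smooth1 (op_B u i j k l).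
Proof. exact: field_comp fu (smooth_on_partial (sP.2 i j k)). Qed.

Lemma op_dg i j x :
  is_derive x (1 : R) (op_g u i j) (\sum_k op_G u i j k x * op_c u k x).
Proof.
have [su Uu _] := fu; apply: is_derive_comp_curve => [|k].
  exact: smooth_on_differentiable (sP.1 i j) (Uu x).
exact: smooth1_derivable (su k).
Qed.

Lemma op_db i j k x :
  is_derive x (1 : R) (op_b u i j k) (\sum_l op_B u i j k l x * op_c u l x).
Proof.
have [su Uu _] := fu; apply: is_derive_comp_curve => [|l].
  exact: smooth_on_differentiable (sP.2 i j k) (Uu x).
exact: smooth1_derivable (su l).
Qed.

Lemma test_curve_apply psi : test_curve psi -> test_curve (apply_op P u psi).
Proof.
move=> tp; apply/test_curveP => i; rewrite apply_opE.
apply: tf_fam_op; [exact: op_sg|exact: op_sb|exact: op_tc|].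
by move=> j; exact: test_curve_tf.
Qed.

Lemma tf_op_theta xi psi k : test_curve xi -> test_curve psi ->
  tf (op_theta u xi psi k).
Proof.
move=> tx tp; apply: tf_fam_theta; [exact: op_sb|exact: op_tc|exact: op_sG|
  exact: op_sB|by move=> j; exact: test_curve_tf|by move=> j; exact: test_curve_tf].
Qed.

Definition defect xi psi (x : R) : R :=
  \sum_i \sum_j ((op_g u j i x - op_g u i j x) * (coord psi j x * derive1 (coord xi i) x)
      + (\sum_k (op_b u i j k x + op_b u j i k x - op_G u i j k x) * op_c u k x)
        * (coord xi i x * coord psi j x)).

Lemma pairing_defect xi psi : test_curve xi -> test_curve psi ->
  ipair xi (apply_op P u psi) + ipair psi (apply_op P u xi) = Int (defect xi psi).
Proof.
move=> tx tp.
have E a q : ipair a (apply_op P u q) = Int (fun x => \sum_i coord a i x * op_fam u q i x).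
  by congr Int; apply/funext => x; apply: eq_bigr => i _; rewrite apply_opE.
rewrite !E; apply: skew_defect; [exact: op_sg|exact: op_sb|exact: op_tc|exact: op_sG|
 exact: op_dg|by move=> j; exact: test_curve_tf|by move=> j; exact: test_curve_tf].
Qed.

End at_field.

(** The coefficient form of skew-symmetry: the factors in [defect] that come from the
    operator vanish. *)
Definition skew_rel : Prop := forall q, U q -> forall i j,
  gcoef P i j q = gcoef P j i q /\
  forall k, partial k (gcoef P i j) q = bcoef P i j k q + bcoef P j i k q.

Hypothesis rel : skew_rel.

Lemma pairing_skew u xi psi : field_in U u -> test_curve xi -> test_curve psi ->
  ipair xi (apply_op P u psi) = - ipair psi (apply_op P u xi).
Proof.
move=> fu tx tp; apply/eqP; rewrite -subr_eq0 opprK pairing_defect//.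
rewrite (_ : defect _ _ _ = fun=> 0) ?Int0//; apply/funext => x.
have [_ Uu _] := fu; rewrite /defect big1// => i _; rewrite big1// => j _.
rewrite /op_g (rel (Uu x) i j).1 subrr mul0r add0r big1 ?mul0r// => k _.
by rewrite /op_G (rel (Uu x) i j).2 /op_b subrr mul0r.
Qed.

Section derivative.
Variables (I J : functional R N).
Hypotheses (sI : smooth_functional U I) (sJ : smooth_functional U J).
Variables (u : R -> 'rV[R]_N) (fu : field_in U u).
Let xi := vderiv I u.
Let psi := vderiv J u.

Let txi : test_curve xi. Proof. by case: (vderivP sI fu). Qed.
Let tpsi : test_curve psi. Proof. by case: (vderivP sJ fu). Qed.

Definition bracket_vd (x : R) : 'rV[R]_N := \row_k
  (coord (delta I u (apply_op P u psi)) k x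
   - coord (delta J u (apply_op P u xi)) k x + op_theta u xi psi k x).

Lemma bracket_linearisation w : test_curve w ->
  is_derive (0 : R) (1 : R) (fun t => bracket P I J (fun x => u x + t *: w x))
    (ipair (delta I u w) (apply_op P u psi)
     + Int (fun x => \sum_i coord xi i x * op_dop u w psi i x)
     + ipair xi (apply_op P u (delta J u w))).
Proof.
move=> tw.
pose uI i := (functional_udc i sI fu tw).1.
pose uJ i := (functional_udc i sJ fu tw).1.
pose uJ' i := (functional_udc i sJ fu tw).2.
pose ug i j := ud_field_comp Uo (sP.1 i j) fu tw.
pose ub i j k := ud_field_comp Uo (sP.2 i j k) fu tw.
pose uc k := udc_tfield k fu tw.
pose uK := ud_cst (bnd_cst (Kcoef P)) (smooth1_cst (Kcoef P)).
(* The integrand of the bracket along the variation, with its derivative assembled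
   by the sum and product rules. *)
have H := udc_Int (udc_sum (fun i => udcMl (uI i) (ud_sum (fun j =>
  udD (udD (udM (ug i j) (udc_ud (uJ' j)))
           (udM (ud_sum (fun k => udM (ub i j k) (udc_ud (uc k)))) (udc_ud (uJ j))))
      (udM (udM uK (udc_ud (uc i))) (ud_dinv (udcMl (uc j) (udc_ud (uJ j))))))))).
apply: (is_derive1_congr H) => [t|].
  congr Int; apply/funext => x; apply: eq_bigr => i _.
  by rewrite /apply_op mxE.
have txi' := test_curve_delta sI fu tw; have tpsi' := test_curve_delta sJ fu tw.
have tP q : test_curve q -> smooth_curve (apply_op P u q).
  by move=> tq; case: (test_curve_apply fu tq).
have tw' i : tf (derive1 (coord w i)) by apply: tf_derive1; exact: test_curve_tf.
have tdop i : tf (op_dop u w psi i).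
  have tp j : tf (coord psi j) by exact: test_curve_tf.
  have tp' j : tf (derive1 (coord psi j)) by exact: tf_derive1.
  have tw0 j : tf (coord w j) by exact: test_curve_tf.
  have h1 := op_sb fu; have h2 := op_tc fu; have h3 := op_sG fu; have h4 := op_sB fu.
  rewrite /op_dop /fam_dop; tft.
have tdopS : tf (fun x => \sum_i coord xi i x * op_dop u w psi i x).
  by apply: tf_sum => i; apply: tfMr (tdop i); case: txi.
have T1 := tf_ipair txi' (tP _ tpsi); have T2 := tf_ipair txi (tP _ tpsi').
rewrite /ipair -(IntD T1 tdopS) -(IntD (tfD T1 tdopS) T2).
congr Int; apply/funext => x; rewrite -!big_split; apply: eq_bigr => i _ /=.
rewrite -[RHS]addrA -mulrDr !apply_opE; congr (_ + _ * _).
rewrite /op_dop /op_fam /fam_dop /fam_op -big_split; apply: eq_bigr => j _ /=.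
have -> : dinv (fun y => derive1 (coord w j) y * coord (vderiv J u) j y
      + derive1 (coord u j) y * coord (delta J u w) j y)
  = fun y => dinv (fun y => derive1 (coord w j) y * coord (vderiv J u) j y) y
    + dinv (fun y => derive1 (coord u j) y * coord (delta J u w) j y) y.
  apply: dinvD.
    exact: tfMl (tw' j) (tf_smooth (test_curve_tf j tpsi)).
  exact: tfMl (op_tc fu j) (tf_smooth (test_curve_tf j tpsi')).
have alg (s1 p' g dp' s2 p sb dp K c w' q d2 d3 : R) :
    s1 * p' + g * dp' + (s2 * p + sb * dp) + ((0 * c + K * w') * q + K * c * (d2 + d3))
    = s1 * p' + s2 * p + K * (w' * q + c * d2) + (g * dp' + sb * dp + K * c * d3).
  by ring.
exact: alg.
Qed.

(** The three contributions come from varying the first functional, the second and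
    the operator; the first two are put in the form of an integral against [w] by
    skew-symmetry and the symmetry of the second variation. *)
Lemma bracket_vderiv : is_vderiv (bracket P I J) u bracket_vd.
Proof.
have tPpsi := test_curve_apply fu tpsi; have tPxi := test_curve_apply fu txi.
have dI := test_curve_delta sI fu tPpsi; have dJ := test_curve_delta sJ fu tPxi.
have tth k := tf_op_theta fu k txi tpsi.
split.
  apply: test_curve_row => k; apply: tfD (tth k).
  by apply: tfB; exact: test_curve_tf.
move=> w tw; apply: (is_derive1_congr (bracket_linearisation tw)) => //.
have [sw _] := tw; have dJw := test_curve_delta sJ fu tw.
rewrite (pairing_skew fu txi dJw) (delta_sym Uo sI fu tPpsi tw).
rewrite (delta_sym Uo sJ fu tPxi tw).
have -> : Int (fun x => \sum_i coord xi i x * op_dop u w psi i x)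
    = Int (fun x => \sum_k op_theta u xi psi k x * coord w k x).
  apply: adjoint; [exact: op_sb|exact: op_tc|exact: op_sG|exact: op_sB|exact: op_db|
    by move=> j; exact: test_curve_tf|by move=> j; exact: test_curve_tf|
    by move=> j; exact: test_curve_tf].
have T1 := tf_ipair dI sw; have T3 := tf_ipair dJ sw.
have T2 : tf (fun x => \sum_k op_theta u xi psi k x * coord w k x).
  by apply: tf_sum => k; apply: tfMl (tth k) (sw k).
rewrite /ipair -(IntD T1 T2) -(IntB (tfD T1 T2) T3).
rewrite -/(Int _); congr Int; apply/funext => x.
rewrite -big_split -sumrB; apply: eq_bigr => k _ /=.
have alg (a b c d : R) : a * d + b * d - c * d = (a - c + b) * d by ring.
by rewrite alg /bracket_vd mxE.
Qed.

End derivative.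
End bracket_derivative.

(** * The Jacobi identity and the pencil *)

Section smooth_on_tools.
Context {R : realType} {n : nat}.
Implicit Types (V : set 'rV[R]_n) (f g : 'rV[R]_n -> R).

(** In finite dimension a continuous linear form is a family of coefficients. *)
Lemma differentiable_epsP f x : differentiable f x <->
  exists a : 'I_n -> R, forall e : R, 0 < e -> \forall h \near (0 : 'rV[R]_n),
    `|f (x + h) - f x - \sum_k a k * h 0 k| <= e * `|h|.
Proof.
split=> [df|[a Ha]].
  exists (fun k => partial k f x) => e e0.
  have [_ /eqaddoP/(_ e e0)] := (diff_locallyP _ _).1 df.
  apply: filterS => h; rewrite -(is_derive_partial h df) [x + h]addrC.
  by rewrite -[(f \o shift x - (cst (f x) + 'd f x)) h]/(f (h + x) - (f x + 'd f x h))
    opprD addrA.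
pose d (h : 'rV[R]_n) : R := \sum_k a k * h 0 k.
have lin_d : linear d.
  move=> c h h'; rewrite /d scaler_sumr -big_split; apply: eq_bigr => k _ /=.
  by rewrite !mxE mulrDr /GRing.scale /= mulrCA.
pose dM := GRing.isLinear.Build _ _ _ _ _ lin_d.
pose dL : {linear _ -> _} := HB.pack d dM.
have cd : continuous dL.
  move=> h; apply/differentiable_continuous; rewrite -[dL : _ -> _]/d.
  have -> : d = \sum_k (fun h : 'rV[R]_n => a k * h 0 k) by rewrite fct_sumE.
  apply: differentiable_sum => k; apply: differentiableM => //.
  exact: differentiable_coord.
have H : f \o shift x = cst (f x) + dL +o_ 0 id.
  apply/eqaddoP => e e0; apply: filterS (Ha e e0) => h.
  rewrite -[(f \o shift x - (cst (f x) + dL)) h]/(f (h + x) - (f x + d h)).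
  by rewrite [h + x]addrC opprD addrA.
by apply/diff_locallyP; rewrite (diff_unique cd H).
Qed.

Lemma differentiable_eq_on V f g q : open V -> (forall x, V x -> f x = g x) ->
  V q -> differentiable f q -> differentiable g q.
Proof.
move=> Vo fg Vq /differentiable_epsP[a Ha]; apply/differentiable_epsP; exists a.
move=> e e0.
have N : \forall h \near (0 : 'rV[R]_n), V (q + h).
  have := @compact_nbhs_sub R n V [set q] Vo (@compact_set1 _ q) ltac:(by move=> _ ->).
  by apply: filterS => h; apply.
by apply: filterS2 N (Ha e e0) => h Vh; rewrite !fg.
Qed.

Lemma partial_derive1 f q k : differentiable f q ->
  is_derive (0 : R) (1 : R) (fun s => f (q + s *: delta_mx 0 k)) (partial k f q).
Proof.
move=> df; have := @is_derive_line _ _ f q (delta_mx 0 k) 0.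
rewrite scale0r addr0 => /(_ df); rewrite (bigD1 k)//= mxE !eqxx mulr1.
by rewrite big1 ?addr0// => j jk; rewrite mxE eqxx (negPf jk) mulr0.
Qed.

Lemma partial_eq_on V f g k q : open V -> (forall x, V x -> f x = g x) -> V q ->
  partial k f q = partial k g q.
Proof.
move=> Vo fg Vq; apply: near_eq_derive.
by apply: filterS fg _; exact: open_nbhs_nbhs.
Qed.

(** The analogue of [smooth1_class]; equality on [V] is enough because partial
    derivatives at points of an open set only see the values there. *)
Lemma smooth_on_class V (S : ('rV[R]_n -> R) -> Prop) : open V ->
  (forall f, S f -> (forall x, V x -> differentiable f x) /\
     forall i, exists2 g, S g & forall x, V x -> partial i f x = g x) ->
  forall f, S f -> smooth_on V f.
Proof.
move=> Vo HS f Sf s.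
suff H : forall s f g, S g -> (forall x, V x -> f x = g x) ->
    forall x, V x -> differentiable (foldr (@partial R n) f s) x.
  by move=> x Vx; apply: (H s f f Sf).
move=> {s f Sf} s; elim/last_ind: s => [|s i IH] f g Sg fg x Vx.
  have [dg _] := HS g Sg; apply: differentiable_eq_on Vo _ Vx (dg x Vx) => y Vy.
  by rewrite /= fg.
rewrite foldr_rcons; have [_ /(_ i)[h Sh gh]] := HS g Sg.
apply: (IH _ h Sh) => // y Vy.
by rewrite -gh// (partial_eq_on i Vo fg Vy).
Qed.

Lemma smooth_on_eq V f g : open V -> (forall x, V x -> f x = g x) ->
  smooth_on V f -> smooth_on V g.
Proof.
move=> Vo fg sf; apply: (@smooth_on_class V
  (fun h => exists2 k, smooth_on V k & forall x, V x -> k x = h x)) => //; last first.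
  by exists f.
move=> h [k sk kh]; split=> [x Vx|i].
  exact: differentiable_eq_on Vo kh Vx (smooth_on_differentiable sk Vx).
exists (partial i k); last by move=> x Vx; rewrite (partial_eq_on i Vo kh Vx).
by exists (partial i k) => //; exact: smooth_on_partial.
Qed.

Lemma partialZD f a b k q : differentiable f q ->
  partial k (fun x => a * f x + b) q = a * partial k f q.
Proof.
move=> df; have d1 := partial_derive1 k df.
have d2 : differentiable (fun x => a * f x + b) q.
  apply: (@differentiableD _ _ _ (fun x => a * f x) (cst b)) => //.
  exact: (@differentiableM _ _ (cst a) f).
have := partial_derive1 k d2 => /derive1_is <-; apply: derive1_is.
apply: (is_derive1_eq (is_derive1D
  (is_derive1M (is_derive_cst a (0 : R) 1) d1) (is_derive_cst b (0 : R) 1))).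
by rewrite mul0r add0r addr0.
Qed.

Lemma smooth_onZD V f a b : open V -> smooth_on V f ->
  smooth_on V (fun x => a * f x + b).
Proof.
move=> Vo sf; apply: (@smooth_on_class V
  (fun h => exists a b f, smooth_on V f /\ h = fun x => a * f x + b)) => //; last first.
  by exists a, b, f.
move=> _ {a b f sf} [a [b [f [sf ->]]]]; split=> [x Vx|i].
  apply: (@differentiableD _ _ _ (fun x => a * f x) (cst b)) => //.
  by apply: (@differentiableM _ _ (cst a) f) => //; exact: smooth_on_differentiable sf Vx.
exists (fun x => a * partial i f x + 0).
  by exists a, 0, (partial i f); split => //; exact: smooth_on_partial.
by move=> x Vx; rewrite addr0 partialZD//; exact: smooth_on_differentiable sf Vx.
Qed.

End smooth_on_tools.

Section jacobi.
Context {R : realType} {N : nat}.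
Variable U : set 'rV[R]_N.
Hypothesis Uo : open U.
Implicit Types (P Q : hydro_op R N) (u xi psi zeta : R -> 'rV[R]_N).

(** What remains of the Jacobi identity: the operator [P] is linearised in the
    direction [Q zeta]. *)
Definition tau P Q u xi psi zeta : R :=
  Int (fun x => \sum_k op_theta P u xi psi k x * coord (apply_op Q u zeta) k x).

Definition cyc P Q u xi psi zeta : R :=
  tau P Q u xi psi zeta + tau P Q u psi zeta xi + tau P Q u zeta xi psi.

Lemma tf_tau P Q u xi psi zeta : smooth_op U P -> smooth_op U Q -> field_in U u ->
  test_curve xi -> test_curve psi -> test_curve zeta ->
  tf (fun x => \sum_k op_theta P u xi psi k x * coord (apply_op Q u zeta) k x).
Proof.
move=> sP sQ fu tx tp tz; apply: tf_sum => k.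
apply: tfMl (tf_op_theta sP fu k tx tp) _.
by have [+ _] := test_curve_apply sQ fu tz; apply.
Qed.

Lemma double_bracket P (I J L : functional R N) u : smooth_op U P -> skew_rel U P ->
  smooth_functional U I -> smooth_functional U J -> smooth_functional U L ->
  field_in U u ->
  bracket P (bracket P I J) L u
  = ipair (delta I u (apply_op P u (vderiv J u))) (apply_op P u (vderiv L u))
    - ipair (delta J u (apply_op P u (vderiv I u))) (apply_op P u (vderiv L u))
    + tau P P u (vderiv I u) (vderiv J u) (vderiv L u).
Proof.
move=> sP rel sI sJ sL fu.
have [tx _] := vderivP sI fu; have [tp _] := vderivP sJ fu.
have [tz _] := vderivP sL fu.
have aJ := test_curve_apply sP fu tp; have aI := test_curve_apply sP fu tx.
have [sz _] := test_curve_apply sP fu tz.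
have T1 := tf_ipair (test_curve_delta sI fu aJ) sz.
have T2 := tf_ipair (test_curve_delta sJ fu aI) sz.
have T3 := tf_tau sP sP fu tx tp tz.
have E : vderiv (bracket P I J) u = bracket_vd P I J u.
  exact: vderivE (bracket_vderiv Uo sP rel sI sJ fu).
rewrite /tau /ipair -(IntB T1 T2) -(IntD (tfB T1 T2) T3) /bracket E.
congr Int; apply/funext => x; rewrite -sumrB -big_split; apply: eq_bigr => k _ /=.
rewrite /bracket_vd mxE.
have alg (a b c d : R) : (a - b + c) * d = a * d - b * d + c * d by ring.
exact: alg.
Qed.

(** The second variations of the three functionals cancel in pairs by their
    symmetry, so the Jacobi identity is a condition on the operator alone. *)
Lemma jacobi_cyc P (I J L : functional R N) u : smooth_op U P -> skew_rel U P ->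
  smooth_functional U I -> smooth_functional U J -> smooth_functional U L ->
  field_in U u ->
  bracket P (bracket P I J) L u + bracket P (bracket P J L) I u
  + bracket P (bracket P L I) J u
  = cyc P P u (vderiv I u) (vderiv J u) (vderiv L u).
Proof.
move=> sP rel sI sJ sL fu.
have [tx _] := vderivP sI fu; have [tp _] := vderivP sJ fu.
have [tz _] := vderivP sL fu.
have aI := test_curve_apply sP fu tx; have aJ := test_curve_apply sP fu tp.
have aL := test_curve_apply sP fu tz.
apply: (etrans (congr2 +%R (congr2 +%R (double_bracket sP rel sI sJ sL fu)
  (double_bracket sP rel sJ sL sI fu)) (double_bracket sP rel sL sI sJ fu))).
have alg (a b c a' b' c' d e f : R) : a = a' -> b = b' -> c = c' ->
    a - b + d + (b' - c + e) + (c' - a' + f) = d + e + f by move=> -> -> ->; ring.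
exact: (alg _ _ _ _ _ _ _ _ _ (delta_sym Uo sI fu aL aJ) (delta_sym Uo sJ fu aL aI)
  (delta_sym Uo sL fu aI aJ)).
Qed.

Lemma poissonP P : smooth_op U P -> skew_rel U P ->
  is_poisson U P <-> forall u xi psi zeta, field_in U u ->
    test_curve xi -> test_curve psi -> test_curve zeta ->
    cyc P P u xi psi zeta = 0.
Proof.
move=> sP rel; split=> [[_ jac] u xi psi zeta fu tx tp tz|H].
  have := jac (ipair xi) (ipair psi) (ipair zeta) u
    (lin_smooth U tx) (lin_smooth U tp) (lin_smooth U tz) fu.
  rewrite (jacobi_cyc sP rel (lin_smooth U tx) (lin_smooth U tp) (lin_smooth U tz) fu).
  by rewrite (lin_vderivE tx fu) (lin_vderivE tp fu) (lin_vderivE tz fu).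
split=> [I J u sI sJ fu|I J L u sI sJ sL fu].
  apply: (pairing_skew sP rel fu); first by case: (vderivP sI fu).
  by case: (vderivP sJ fu).
rewrite (jacobi_cyc sP rel sI sJ sL fu); apply: H; first exact: fu.
- by case: (vderivP sI fu).
- by case: (vderivP sJ fu).
- by case: (vderivP sL fu).
Qed.

End jacobi.

Section pencil.
Context {R : realType} {N : nat}.
Variables (U : set 'rV[R]_N) (P : hydro_op R N) (eta : 'M[R]_N).
Hypotheses (Uo : open U) (sP : smooth_op U P) (rel : skew_rel U P).
Hypothesis eta_sym : eta^T = eta.
Implicit Types u xi psi zeta : R -> 'rV[R]_N.

Notation Q := (const_op eta).

Let etaC i j : eta i j = eta j i. Proof. by rewrite -{1}eta_sym mxE. Qed.

Lemma smooth_on_cst n (V : set 'rV[R]_n) (c : R) : open V -> smooth_on V (fun=> c).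
Proof.
move=> Vo; apply: (@smooth_on_class _ _ V (fun f => exists c, f = fun=> c)) => //.
  move=> _ [d ->]; split=> [x _|i]; first exact: differentiable_cst.
  by exists (fun=> 0); [exists 0|move=> x _; exact: derive_cst].
by exists c.
Qed.

Lemma smooth_const_op : smooth_op U Q.
Proof. by split=> *; exact: smooth_on_cst. Qed.

Lemma smooth_lincomb a c : smooth_op U (lincomb_op a c P Q).
Proof.
split=> [i j|i j k].
  exact: (@smooth_onZD _ _ _ _ a (c * eta i j) Uo (sP.1 i j)).
exact: (@smooth_onZD _ _ _ _ a (c * 0) Uo (sP.2 i j k)).
Qed.

Lemma lincomb_G a c i j k q : U q ->
  partial k (gcoef (lincomb_op a c P Q) i j) q = a * partial k (gcoef P i j) q.
Proof.
move=> Uq; exact: (@partialZD _ _ _ a (c * eta i j) k q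
  (smooth_on_differentiable (sP.1 i j) Uq)).
Qed.

Lemma lincomb_B a c i j k l q : U q ->
  partial l (bcoef (lincomb_op a c P Q) i j k) q = a * partial l (bcoef P i j k) q.
Proof.
move=> Uq; exact: (@partialZD _ _ _ a (c * 0) l q
  (smooth_on_differentiable (sP.2 i j k) Uq)).
Qed.

Lemma skew_rel_lincomb a c : skew_rel U (lincomb_op a c P Q).
Proof.
move=> q Uq i j; have [r1 r2] := rel Uq i j; split=> [|k].
  by rewrite /= r1 etaC.
by rewrite lincomb_G// r2 /= !mulr0 !addr0 mulrDr.
Qed.

Lemma theta_lincomb a c u xi psi k x : field_in U u ->
  op_theta (lincomb_op a c P Q) u xi psi k x = a * op_theta P u xi psi k x.
Proof.
move=> [_ Uu _]; have EG i j l : op_G (lincomb_op a c P Q) u i j l x = a * op_G P u i j l x.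
  exact: lincomb_G (Uu x).
have EB i j l m : op_B (lincomb_op a c P Q) u i j l m x = a * op_B P u i j l m x.
  exact: lincomb_B (Uu x).
have Eb i j l : op_b (lincomb_op a c P Q) u i j l x = a * op_b P u i j l x.
  by rewrite /op_b /= mulr0 addr0.
rewrite /op_theta /fam_theta [in RHS]mulrDr; congr (_ + _); last first.
  by rewrite /= mulr0 addr0 mulrA.
rewrite mulr_sumr; apply: eq_bigr => i _; rewrite mulr_sumr; apply: eq_bigr => j _.
rewrite EG Eb (eq_bigr (fun l => a * ((op_B P u i j l k x - op_B P u i j k l x) * op_c u l x)));
  last by move=> l _; rewrite !EB -mulrBr mulrA.
rewrite -mulr_sumr.
have alg (g s b p q r t w : R) : a * g * p * q + a * s * p * r - a * b * (t * r + p * q)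
   = a * (g * p * q + s * p * r - b * (t * r + p * q)) by ring.
exact: (alg _ _ _ _ _ _ _ 0).
Qed.

Lemma apply_lincomb a c u psi k x :
  coord (apply_op (lincomb_op a c P Q) u psi) k x
  = a * coord (apply_op P u psi) k x + c * coord (apply_op Q u psi) k x.
Proof.
rewrite /coord !mxE !mulr_sumr -big_split; apply: eq_bigr => j _ /=.
have -> : \sum_l (a * bcoef P k j l (u x) + c * 0) * derive1 (coord u l) x
   = a * \sum_l bcoef P k j l (u x) * derive1 (coord u l) x.
  by rewrite mulr_sumr; apply: eq_bigr => l _; rewrite mulr0 addr0 mulrA.
have -> : \sum_(l < N) 0 * derive1 (coord u l) x = 0 by rewrite big1// => l _; rewrite mul0r.
have alg (g e p s q K w d : R) : (a * g + c * e) * p + a * s * q + (a * K + c * 0) * w * d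
  = a * (g * p + s * q + K * w * d) + c * (e * p + 0 * q + 0 * w * d) by ring.
exact: alg.
Qed.

Lemma tau_lincomb a c u xi psi zeta : field_in U u ->
  test_curve xi -> test_curve psi -> test_curve zeta ->
  tau (lincomb_op a c P Q) (lincomb_op a c P Q) u xi psi zeta
  = a * (a * tau P P u xi psi zeta + c * tau P Q u xi psi zeta).
Proof.
move=> fu tx tp tz.
have T1 := tf_tau sP sP fu tx tp tz.
have T2 := tf_tau sP smooth_const_op fu tx tp tz.
apply: (@etrans _ _ (a * (Int (fun x => a * (\sum_k op_theta P u xi psi k x
       * coord (apply_op P u zeta) k x)
     + c * (\sum_k op_theta P u xi psi k x * coord (apply_op Q u zeta) k x))))); last first.
  by congr (_ * _); apply: etrans (IntD (tfZ a T1) (tfZ c T2)) _; congr (_ + _); exact: IntZ.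
apply: etrans _ (IntZ a (tfD (tfZ a T1) (tfZ c T2))).
congr Int; apply/funext => x; rewrite !mulr_sumr -big_split mulr_sumr /=.
apply: eq_bigr => k _; rewrite (theta_lincomb a c xi psi k x fu) apply_lincomb.
have alg (t p q : R) : a * t * (a * p + c * q) = a * (a * (t * p) + c * (t * q)) by ring.
exact: alg.
Qed.

Lemma cyc_lincomb a c u xi psi zeta : field_in U u ->
  test_curve xi -> test_curve psi -> test_curve zeta ->
  cyc (lincomb_op a c P Q) (lincomb_op a c P Q) u xi psi zeta
  = a * (a * cyc P P u xi psi zeta + c * cyc P Q u xi psi zeta).
Proof.
move=> fu tx tp tz.
apply: (etrans (congr2 +%R (congr2 +%R (tau_lincomb a c fu tx tp tz)
  (tau_lincomb a c fu tp tz tx)) (tau_lincomb a c fu tz tx tp))).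
have alg (p q r p' q' r' : R) : a * (a * p + c * p') + a * (a * q + c * q')
  + a * (a * r + c * r') = a * (a * (p + q + r) + c * (p' + q' + r')) by ring.
exact: alg.
Qed.

(** Since the constant operator has vanishing [op_theta], the Jacobi expression of
    the pencil is that of [P] plus a multiple of one mixed expression. *)
Lemma compatible_cyc : is_poisson U P ->
  compatible U P Q <-> forall u xi psi zeta, field_in U u ->
    test_curve xi -> test_curve psi -> test_curve zeta ->
    cyc P Q u xi psi zeta = 0.
Proof.
move=> poP; have cP := (poissonP Uo sP rel).1 poP; split=> [[_ _ H]|H].
  move=> u xi psi zeta fu tx tp tz.
  have := (poissonP Uo (smooth_lincomb 1 1) (skew_rel_lincomb 1 1)).1 (H 1 1)
    u xi psi zeta fu tx tp tz.
  by rewrite cyc_lincomb// cP// mulr0 add0r !mul1r.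
have L a c : is_poisson U (lincomb_op a c P Q).
  apply/(poissonP Uo (smooth_lincomb a c) (skew_rel_lincomb a c)).
  move=> u xi psi zeta fu tx tp tz.
  by rewrite cyc_lincomb// cP// H// !mulr0 addr0 mulr0.
split=> //; have E : lincomb_op 0 1 P Q = Q.
  rewrite /lincomb_op /const_op /=; congr HydroOp.
  - by apply/funext => i; apply/funext => j; apply/funext => q; rewrite mul0r add0r mul1r.
  - apply/funext => i; apply/funext => j; apply/funext => k; apply/funext => q.
    by rewrite mul0r add0r mulr0.
  - by rewrite mul0r mulr0 addr0.
by rewrite -E.
Qed.

Definition dat (v : R -> 'rV[R]_N) (x : R) (i : 'I_N) : R := v x 0 i.
Definition ddat (v : R -> 'rV[R]_N) (x : R) (i : 'I_N) : R := derive1 (coord v i) x.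

Definition bq q i j k := bcoef P i j k q.
Definition Bq q i j k l := partial l (bcoef P i j k) q.

Notation sy u x := (symdef (bq (u x)) eta).
Notation cu u x := (curv (Kcoef P) (ddat u x) (Bq (u x))).

(** The integrand left after the cyclic cancellation: its coefficients are the
    quantities whose vanishing is [mixed_rel]. *)
Definition mixed u xi psi zeta (x : R) : R :=
  sy u x (dat xi x) (ddat psi x) (ddat zeta x)
  + sy u x (dat psi x) (ddat zeta x) (ddat xi x)
  + sy u x (dat zeta x) (ddat xi x) (ddat psi x)
  + (cu u x (dat xi x) (dat psi x) (lower eta (ddat zeta x))
     + cu u x (dat psi x) (dat zeta x) (lower eta (ddat xi x))
     + cu u x (dat zeta x) (dat xi x) (lower eta (ddat psi x))).

Lemma cyc_mixed u xi psi zeta : field_in U u ->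
  test_curve xi -> test_curve psi -> test_curve zeta ->
  cyc P Q u xi psi zeta = Int (mixed u xi psi zeta).
Proof.
move=> fu tx tp tz.
have T1 := tf_tau sP smooth_const_op fu tx tp tz.
have T2 := tf_tau sP smooth_const_op fu tp tz tx.
have T3 := tf_tau sP smooth_const_op fu tz tx tp.
apply: (etrans (congr1 (+%R^~ _) (esym (IntD T1 T2)))).
apply: (etrans (esym (IntD (tfD T1 T2) T3))).
congr Int; apply/funext => x.
have [_ Uu _] := fu.
pose q (v : R -> 'rV[R]_N) := \sum_j dinv (fun y => op_c u j y * coord v j y) x.
have E (a p z : R -> 'rV[R]_N) :
  \sum_k op_theta P u a p k x * coord (apply_op Q u z) k x
  = trib (bq (u x)) (dat a x) (ddat p x) (lower eta (ddat z x))
    - trib (bq (u x)) (dat p x) (ddat a x) (lower eta (ddat z x))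
    + Kcoef P * (dotf (ddat p x) (lower eta (ddat z x)) * q a
        - dotf (ddat a x) (lower eta (ddat z x)) * q p)
    + cu u x (dat a x) (dat p x) (lower eta (ddat z x)).
  have HG i j k : op_G P u i j k x = bq (u x) i j k + bq (u x) j i k.
    exact: (rel (Uu x) i j).2.
  apply: etrans (theta_contract (Kcoef P) (ddat u x) (Bq (u x)) (dat a x) (ddat a x)
    (dat p x) (ddat p x) (q a) (q p) (lower eta (ddat z x)) HG).
  apply: eq_bigr => k _; congr (_ * _).
  rewrite /coord mxE /lower; apply: eq_bigr => j _ /=.
  rewrite big1 ?mul0r ?addr0// => l _; exact: mul0r.
apply: (etrans (congr2 +%R (congr2 +%R (E xi psi zeta) (E psi zeta xi)) (E zeta xi psi))).
apply: cyclic_sum; exact: etaC.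
Qed.

(** Compatibility in terms of the coefficients of [P]: the part of the relations for
    the pencil that is linear in its parameter. *)
Definition mixed_rel : Prop := forall q, U q ->
  (forall i j r, \sum_k eta i k * bcoef P j r k q = \sum_k eta j k * bcoef P i r k q)
  /\ (forall i j k l, omega (Kcoef P) (Bq q) i j k l = 0).

Lemma symdef0 q a p z :
  (forall i j r, \sum_k eta i k * bcoef P j r k q = \sum_k eta j k * bcoef P i r k q) ->
  symdef (bq q) eta a p z = 0.
Proof.
move=> H; rewrite symdefE big1// => i _; rewrite big1// => j _; rewrite big1// => l _.
rewrite [X in X * _](_ : _ = 0) ?mul0r//; apply/eqP; rewrite subr_eq0; apply/eqP.
transitivity (\sum_k eta l k * bcoef P j i k q).
  by apply: eq_bigr => k _; rewrite mulrC etaC.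
by rewrite H; apply: eq_bigr => k _; rewrite mulrC etaC.
Qed.

Lemma mixed_rel_cyc : mixed_rel -> forall u xi psi zeta, field_in U u ->
  test_curve xi -> test_curve psi -> test_curve zeta -> cyc P Q u xi psi zeta = 0.
Proof.
move=> H u xi psi zeta fu tx tp tz; apply: (etrans (cyc_mixed fu tx tp tz)).
rewrite -[RHS](@Int0 R); congr Int; apply/funext => x.
have [_ /(_ x) Ux _] := fu; have [H1 H2] := H _ Ux.
have C a p z : cu u x a p z = 0.
  rewrite /curv big1// => i _; rewrite big1// => j _; rewrite big1// => k _.
  by rewrite big1 ?mul0r// => l _; rewrite H2 mul0r.
by rewrite /mixed !symdef0// !C !addr0.
Qed.

End pencil.

(** * Test fields and extraction of the pointwise relations *)

Section extraction.
Context {R : realType} {N : nat}.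
Implicit Types (U : set 'rV[R]_N) (u v : R -> 'rV[R]_N) (f g : R -> R).

Definition ecurve (f : R -> R) (i : 'I_N) (x : R) : 'rV[R]_N :=
  \row_j (f x * (j == i)%:R).

Lemma coord_ecurve f i j : coord (ecurve f i) j = fun x => f x * (j == i)%:R.
Proof. by apply/funext => x; rewrite /coord mxE. Qed.

Lemma derive1_ecurve f i j x : smooth1 f ->
  derive1 (coord (ecurve f i) j) x = derive1 f x * (j == i)%:R.
Proof.
move=> sf; rewrite coord_ecurve; apply: derive1_is.
apply: (is_derive1_eq (is_derive1M (smooth1_derive sf x) (is_derive_cst ((j == i)%:R : R) x 1))).
by rewrite mulr0 addr0.
Qed.

Lemma test_ecurve f i : tf f -> test_curve (ecurve f i).
Proof. by move=> Tf; apply: test_curve_row => j; apply: tfMl => //; exact: smooth1_cst. Qed.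

Lemma sum_delta3 (F : 'I_N -> 'I_N -> 'I_N -> R) i j l (a p q : R) :
  \sum_i' \sum_j' \sum_l' F i' j' l' * (a * (i' == i)%:R * (p * (j' == j)%:R)
     * (q * (l' == l)%:R)) = F i j l * (a * p * q).
Proof.
rewrite (bigD1 i)//= [X in _ + X]big1 ?addr0; last first.
  move=> i' /negPf ->; rewrite big1// => j' _; rewrite big1// => l' _.
  by rewrite mulr0 !mul0r mulr0.
rewrite (bigD1 j)//= [X in _ + X]big1 ?addr0; last first.
  move=> j' /negPf ->; rewrite big1// => l' _.
  by rewrite !mulr0 !mul0r mulr0.
rewrite (bigD1 l)//= [X in _ + X]big1 ?addr0; last first.
  by move=> l' /negPf ->; rewrite !mulr0.
by rewrite !eqxx !mulr1.
Qed.

Lemma sum_delta2 (F : 'I_N -> 'I_N -> R) i j (a p : R) :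
  \sum_i' \sum_j' F i' j' * (a * (i' == i)%:R * (p * (j' == j)%:R)) = F i j * (a * p).
Proof.
rewrite (bigD1 i)//= [X in _ + X]big1 ?addr0; last first.
  move=> i' /negPf ->; rewrite big1// => j' _.
  by rewrite mulr0 !mul0r mulr0.
rewrite (bigD1 j)//= [X in _ + X]big1 ?addr0; last first.
  by move=> j' /negPf ->; rewrite !mulr0.
by rewrite !eqxx !mulr1.
Qed.

Lemma field_cst U p : U p -> field_in U (fun _ : R => p).
Proof.
move=> Up; split=> [i|//|].
  by rewrite (_ : coord _ _ = fun=> p 0 i)//; exact: smooth1_cst.
exists 0 => x _ i.
by rewrite (_ : coord _ _ = cst (p 0 i))//; exact: derive1_cst.
Qed.

Lemma Int_derive1_bump_neq0 :
  Int (fun x : R => derive1 bump x * derive1 bump x) != 0.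
Proof.
apply/eqP => I0; have T := tf_derive1 (@tf_bump R).
have d0 x : is_derive x (1 : R) (@bump R) 0.
  by rewrite -(Int_sqr_eq0 T I0 x); exact: smooth1_derive smooth1_bump x.
have := is_derive_0_is_cst 0 2 d0.
rewrite (@csupp_bump R 2) ?normr_nat ?ltr1n// => b0.
by have := @bump0 R; rewrite b0 ltxx.
Qed.

(** Added to a constant, it gives a field passing at [x = 0] through that constant
    with nonzero velocity, and at rest for [|x| > 1]. *)
Definition wiggle (x : R) : R := x * bump x.

Lemma tf_wiggle : tf wiggle.
Proof. exact: tfMr (@smooth1_id R) (@tf_bump R). Qed.

Lemma csupp_wiggle : csupp 1 wiggle.
Proof. by move=> x x1; rewrite /wiggle csupp_bump// mulr0. Qed.

Lemma derive1_wiggle0 : derive1 wiggle 0 = bump 0.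
Proof.
apply: derive1_is.
apply: (is_derive1_eq (is_derive1M (@is_derive_id _ _ (0 : R) (1 : R))
  (smooth1_derive smooth1_bump 0))).
by rewrite mul0r addr0 mul1r.
Qed.

Lemma probe_field U p k : open U -> U p ->
  exists2 t : R, t != 0 & field_in U (fun x => p + t *: ecurve wiggle k x).
Proof.
move=> Uo Up; have := field_near Uo (field_cst Up) (test_ecurve k tf_wiggle).
case/nbhs_ballP => r /= r0 H; exists (r / 2).
  by rewrite gt_eqF// divr_gt0.
apply: H; rewrite -ball_normE/= sub0r normrN gtr0_norm ?divr_gt0//.
by rewrite ltr_pdivrMr// ltr_pMr// ltr1n.
Qed.

Lemma derive1_probe p (t : R) k j x :
  derive1 (coord (fun x => p + t *: ecurve wiggle k x) j) x
  = t * (derive1 wiggle x * (j == k)%:R).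
Proof.
have sw : smooth_curve (ecurve wiggle k) by have [] := test_ecurve k tf_wiggle.
have sp : smooth_curve (fun _ : R => p) by have [] := @field_cst setT p I.
rewrite (derive1_is (@derive1_affine_curve _ _ (fun=> p) _ t j x sp sw)).
rewrite (derive1_ecurve _ _ _ (tf_smooth tf_wiggle)).
rewrite (_ : coord _ _ = cst (p 0 j))//.
by rewrite derive1_cst add0r.
Qed.

Lemma probe0 p (t : R) k : p + t *: ecurve wiggle k 0 = p.
Proof. by apply/rowP => j; rewrite !mxE /wiggle mul0r mul0r mulr0 addr0. Qed.

Lemma derive1_plateau x : `|x| < 4 -> derive1 (@plateau R) x = 0.
Proof.
move=> x4; rewrite derive1E (@near_eq_derive R R R _ (cst 1)) ?derive_cst//.
have : open [set y : R | `|y| < 4].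
  apply: (@open_comp _ _ (fun y : R => `|y|) [set y | y < 4]); last exact: open_lt.
  by move=> y _; exact: norm_continuous.
move=> o; have : \forall y \near x, `|y| < 4 by apply: open_nbhs_nbhs.
by apply: filterS => y; exact: plateau1.
Qed.

Section skew.
Variables (U : set 'rV[R]_N) (P : hydro_op R N).
Hypotheses (Uo : open U) (sP : smooth_op U P) (poP : is_poisson U P).

Lemma poisson_defect u xi psi : field_in U u -> test_curve xi -> test_curve psi ->
  Int (defect P u xi psi) = 0.
Proof.
move=> fu tx tp; apply: (etrans (esym (pairing_defect sP fu tx tp))).
have := poP.1 (ipair xi) (ipair psi) u (lin_smooth U tx) (lin_smooth U tp) fu.
rewrite /bracket (lin_vderivE tx fu) (lin_vderivE tp fu) => H.
by apply/eqP; rewrite addr_eq0; apply/eqP; exact: H.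
Qed.

(** At a constant field, testing with a bump and its derivative leaves the
    antisymmetric part of [g] times a positive integral. *)
Lemma poisson_g_sym q i j : U q -> gcoef P i j q = gcoef P j i q.
Proof.
move=> Uq; pose b' := derive1 (@bump R).
have tb' : tf b' := tf_derive1 (@tf_bump R).
have := poisson_defect (field_cst Uq) (test_ecurve j (@tf_bump R)) (test_ecurve i tb').
have -> : defect P (fun=> q) (ecurve bump j) (ecurve b' i)
    = fun x => (gcoef P i j q - gcoef P j i q) * (b' x * b' x).
  apply/funext => x; rewrite /defect.
  rewrite (eq_bigr (fun k => \sum_l (gcoef P l k q - gcoef P k l q)
     * (b' x * (k == j)%:R * (b' x * (l == i)%:R)))).
    exact: (@sum_delta2 (fun k l => gcoef P l k q - gcoef P k l q)).
  move=> k _; apply: eq_bigr => l _.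
  rewrite (derive1_ecurve _ _ _ (@smooth1_bump R)) !coord_ecurve /op_g.
  rewrite big1 => [|m _]; last first.
    rewrite /op_c (_ : coord _ _ = cst (q 0 m))//.
    by rewrite derive1_cst mulr0.
  by rewrite mul0r addr0 [_ * _ * (b' x * _)]mulrC.
rewrite IntZ; last exact: tfMl tb' (tf_smooth tb').
move/eqP; rewrite mulf_eq0 (negPf Int_derive1_bump_neq0) orbF subr_eq0.
by move/eqP.
Qed.

(** On a moving field the remaining relation is tested with [psi] constant and [xi]
    equal to the coefficient itself, so that the integral of a square vanishes. *)
Lemma poisson_skew_rel : skew_rel U P.
Proof.
move=> q Uq i j; split=> [|k]; first exact: poisson_g_sym.
have [t t0 fu] := probe_field k Uo Uq; set u := (fun x => _) in fu.
pose F x := \sum_l (op_b P u i j l x + op_b P u j i l x - op_G P u i j l x) * op_c u l x.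
have sb := op_sb sP fu; have sG := op_sG sP fu; have tc := op_tc fu.
have tF : tf F by rewrite /F; tft.
have cE l x : op_c u l x = t * (derive1 wiggle x * (l == k)%:R).
  exact: derive1_probe.
have Fc x : 1 < `|x| -> F x = 0.
  move=> x1; rewrite /F big1// => l _; rewrite cE.
  by rewrite (csupp_derive1 csupp_wiggle x1) mul0r !mulr0.
have := poisson_defect fu (test_ecurve i tF) (test_ecurve j (@tf_plateau R)).
have -> : defect P u (ecurve F i) (ecurve plateau j) = fun x => F x * F x.
  apply/funext => x; rewrite /defect.
  rewrite (eq_bigr (fun i' => \sum_j'
     (\sum_l (op_b P u i' j' l x + op_b P u j' i' l x - op_G P u i' j' l x) * op_c u l x)
     * (F x * (i' == i)%:R * (plateau x * (j' == j)%:R)))).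
    rewrite (@sum_delta2 (fun i' j' =>
     \sum_l (op_b P u i' j' l x + op_b P u j' i' l x - op_G P u i' j' l x) * op_c u l x)).
    rewrite -/(F x); case: (ltrP 1 `|x|) => x1; first by rewrite Fc// mul0r mul0r.
    by rewrite plateau1 ?mulr1//; apply: le_lt_trans x1 _; rewrite ltr1n.
  move=> i' _; apply: eq_bigr => j' _; have [_ Uu _] := fu.
  rewrite /op_g (poisson_g_sym i' j' (Uu x)) subrr mul0r add0r.
  by rewrite !coord_ecurve.
move=> I0; have := Int_sqr_eq0 tF I0 0.
have u0 : u 0 = q by exact: probe0.
rewrite /F (bigD1 k)//= big1 => [|l lk]; last by rewrite cE (negPf lk) !mulr0.
rewrite cE eqxx mulr1 addr0 derive1_wiggle0 /op_b /op_G u0 => /eqP.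
rewrite mulf_eq0 [t * _ == 0]mulf_eq0 (negPf t0) (gt_eqF (@bump0 R)) !orbF subr_eq0.
by move=> /eqP.
Qed.

End skew.

Section mixed_relations.
Variables (U : set 'rV[R]_N) (P : hydro_op R N) (eta : 'M[R]_N).
Hypotheses (Uo : open U) (sP : smooth_op U P) (rel : skew_rel U P).
Hypotheses (eta_sym : eta^T = eta) (eta_nondeg : eta \in unitmx).
Hypothesis cyc0 : forall u xi psi zeta, field_in U u ->
  test_curve xi -> test_curve psi -> test_curve zeta ->
  cyc P (const_op eta) u xi psi zeta = 0.

Let etaC i j : eta i j = eta j i. Proof. by rewrite -{1}eta_sym mxE. Qed.

Lemma Int_mixed0 u xi psi zeta : field_in U u ->
  test_curve xi -> test_curve psi -> test_curve zeta ->
  Int (mixed P eta u xi psi zeta) = 0.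
Proof.
move=> fu tx tp tz; rewrite -(cyc0 fu tx tp tz).
exact: esym (cyc_mixed Uo sP rel eta_sym fu tx tp tz).
Qed.

Lemma curv_c0 (c a p z : 'I_N -> R) q : (forall l, c l = 0) ->
  curv (Kcoef P) c (Bq P q) a p z = 0.
Proof.
move=> c0; rewrite /curv big1// => i _; rewrite big1// => j _; rewrite big1// => k _.
by rewrite big1 ?mul0r// => l _; rewrite c0 mulr0.
Qed.

Lemma symdef_0 q (a p z : 'I_N -> R) : (forall i j l, a i * p j * z l = 0) ->
  symdef (bq P q) eta a p z = 0.
Proof.
move=> H; rewrite symdefE big1// => i _; rewrite big1// => j _; rewrite big1// => l _.
by rewrite H mulr0.
Qed.

(** With a constant field, [xi] constant and [psi], [zeta] bumps on the plateau of
    [xi], only the first term of the mixed expression survives. *)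
Lemma mixed_first q i j r : U q ->
  \sum_k eta i k * bcoef P j r k q = \sum_k eta j k * bcoef P i r k q.
Proof.
move=> Uq; have tb := @tf_bump R; have tb' := tf_derive1 tb.
have := Int_mixed0 (field_cst Uq) (test_ecurve r (@tf_plateau R))
  (test_ecurve j tb) (test_ecurve i tb).
pose D := \sum_k bq P q j r k * eta k i - \sum_k bq P q i r k * eta k j.
pose b' := derive1 (@bump R).
have -> : mixed P eta (fun=> q) (ecurve plateau r) (ecurve bump j) (ecurve bump i)
   = fun x => D * (b' x * b' x).
  apply/funext => x; rewrite /mixed.
  have c0 l : ddat (fun=> q) x l = 0.
    rewrite /ddat (_ : coord _ _ = cst (q 0 l))//.
    by rewrite derive1_cst.
  rewrite !curv_c0// !addr0.
  have de f i' l : smooth1 f -> ddat (ecurve f i') x l = derive1 f x * (l == i')%:R.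
    by move=> sf; exact: derive1_ecurve.
  have da f i' l : dat (ecurve f i') x l = f x * (l == i')%:R.
    by rewrite /dat mxE.
  have pb : bump x * derive1 plateau x = 0 :> R.
    case: (ltrP 1 `|x|) => x1; first by rewrite csupp_bump// mul0r.
    by rewrite derive1_plateau ?mulr0//; apply: le_lt_trans x1 _; rewrite ltr1n.
  rewrite (@symdef_0 q (dat (ecurve bump j) x)); last first.
    move=> i1 j1 l1; rewrite da !de; [|exact: smooth1_plateau|exact: smooth1_bump].
    rewrite [LHS](_ : _ = bump x * derive1 plateau x * ((i1 == j)%:R
      * (derive1 bump x * (j1 == i)%:R) * (l1 == r)%:R)); last by ring.
    by rewrite pb mul0r.
  rewrite (@symdef_0 q (dat (ecurve bump i) x)); last first.
    move=> i1 j1 l1; rewrite da !de; [|exact: smooth1_bump|exact: smooth1_plateau].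
    rewrite [LHS](_ : _ = bump x * derive1 plateau x * ((i1 == i)%:R
      * (derive1 bump x * (l1 == j)%:R) * (j1 == r)%:R)); last by ring.
    by rewrite pb mul0r.
  rewrite !addr0 symdefE.
  rewrite (eq_bigr (fun i1 => \sum_j1 \sum_l1
    (\sum_k bq P q j1 i1 k * eta k l1 - \sum_k bq P q l1 i1 k * eta k j1)
    * (plateau x * (i1 == r)%:R * (b' x * (j1 == j)%:R) * (b' x * (l1 == i)%:R)))).
    rewrite (@sum_delta3 (fun i1 j1 l1 =>
      \sum_k bq P q j1 i1 k * eta k l1 - \sum_k bq P q l1 i1 k * eta k j1)).
    rewrite -/D; case: (ltrP 1 `|x|) => x1.
      by rewrite /b' (csupp_derive1 (@csupp_bump R) x1) !mulr0.
    by rewrite plateau1 ?mul1r//; apply: le_lt_trans x1 _; rewrite ltr1n.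
  move=> i1 _; apply: eq_bigr => j1 _; apply: eq_bigr => l1 _.
  by rewrite da !de//; exact: smooth1_bump.
rewrite IntZ; last exact: tfMl tb' (tf_smooth tb').
move/eqP; rewrite mulf_eq0 (negPf Int_derive1_bump_neq0) orbF subr_eq0 => /eqP E.
transitivity (\sum_k bq P q j r k * eta k i).
  by apply: eq_bigr => k _; rewrite mulrC etaC.
by rewrite E; apply: eq_bigr => k _; rewrite mulrC etaC.
Qed.

Lemma curv_z0 (c a p z : 'I_N -> R) q : (forall l, z l = 0) ->
  curv (Kcoef P) c (Bq P q) a p (lower eta z) = 0.
Proof.
move=> z0; rewrite /curv big1// => i _; rewrite big1// => j _; rewrite big1// => k _.
by rewrite /lower [X in _ * X]big1 ?mulr0// => l _; rewrite z0 mulr0.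
Qed.

(** With [xi], [psi] constant where the field moves, the mixed expression reduces
    to the integral of [F * zeta'], and [zeta] is chosen with [zeta' = F] there. *)
Lemma mixed_second q i j k l : U q -> omega (Kcoef P) (Bq P q) i j k l = 0.
Proof.
move=> Uq; have [t t0 fu] := probe_field l Uo Uq; set u := (fun x => _) in fu.
have sB := op_sB sP fu; have tc := op_tc fu.
have cE l' x : op_c u l' x = t * (derive1 wiggle x * (l' == l)%:R).
  exact: derive1_probe.
have c0 x : 1 < `|x| -> forall l', op_c u l' x = 0.
  by move=> x1 l'; rewrite cE (csupp_derive1 csupp_wiggle x1) mul0r !mulr0.
pose Om x k' := \sum_l' omega (Kcoef P) (Bq P (u x)) i j k' l' * op_c u l' x.
have tOm k' : tf (fun x => Om x k').
  have : tf (fun x => \sum_l' (op_B P u i j l' k' x - op_B P u i j k' l' x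
    + Kcoef P * ((i == l')%:R * (j == k')%:R - (j == l')%:R * (i == k')%:R))
     * op_c u l' x) by tft.
  exact.
have u0 : u 0 = q by exact: probe0.
suff H m : \sum_k' omega (Kcoef P) (Bq P q) i j k' l * eta k' m = 0.
(* [eta] is invertible, so it may be cancelled. *)
  pose v : 'rV[R]_N := \row_k' omega (Kcoef P) (Bq P q) i j k' l.
  have v0 : v *m eta = 0.
    apply/rowP => m; rewrite !mxE -[RHS](H m).
    by apply: eq_bigr => k' _; rewrite mxE.
  have := congr1 (mulmx^~ (invmx eta)) v0; rewrite mulmxK// mul0mx => /rowP/(_ k).
  by rewrite !mxE.
pose F x := \sum_k' Om x k' * eta k' m.
have tF : tf F by apply: tf_sum => k'; apply: tfMl (tOm k') (smooth1_cst _).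
pose Z x := plateau x * dinv F x.
have tZ : tf Z := tfMl (@tf_plateau R) (smooth1_dinv tF).
have F0 x : 1 < `|x| -> F x = 0.
  move=> x1; rewrite /F big1// => k' _; rewrite /Om big1 ?mul0r// => l' _.
  by rewrite c0// mulr0.
have dZ x : `|x| < 4 -> derive1 Z x = F x.
  move=> x4; apply: derive1_is.
  apply: (is_derive1_eq (is_derive1M (smooth1_derive (@smooth1_plateau R) x)
    (is_derive_dinv x tF))).
  by rewrite derive1_plateau// plateau1// mul0r add0r mul1r.
have := Int_mixed0 fu (test_ecurve i (@tf_plateau R)) (test_ecurve j (@tf_plateau R))
  (test_ecurve m tZ).
have -> : mixed P eta u (ecurve plateau i) (ecurve plateau j) (ecurve Z m)
   = fun x => F x * F x.
  apply/funext => x; rewrite /mixed.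
  have [_ /(_ x) Ux _] := fu.
  have H1 := fun i j r => mixed_first i j r Ux.
  rewrite !(symdef0 eta_sym _ _ _ H1) !add0r.
  have de f i' l' : smooth1 f -> ddat (ecurve f i') x l' = derive1 f x * (l' == i')%:R.
    by move=> sf; exact: derive1_ecurve.
  have da f i' l' : dat (ecurve f i') x l' = f x * (l' == i')%:R.
    by rewrite /dat mxE.
  case: (ltrP 1 `|x|) => x1.
    by rewrite !(curv_c0 _ _ _ _ (c0 x x1)) F0// !addr0 mul0r.
  have x4 : `|x| < 4 by apply: le_lt_trans x1 _; rewrite ltr1n.
  have p0 i' l' : ddat (ecurve plateau i') x l' = 0.
    by rewrite de ?derive1_plateau ?mul0r//; exact: smooth1_plateau.
  rewrite (curv_z0 _ _ _ _ (p0 i)) (curv_z0 _ _ _ _ (p0 j)) !addr0.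
  have lE k' : lower eta (ddat (ecurve Z m) x) k' = eta k' m * F x.
    rewrite /lower (bigD1 m)//= big1 ?addr0 => [|l' /negPf lm].
      by rewrite de ?eqxx ?mulr1 ?dZ//; exact: tf_smooth tZ.
    by rewrite de ?lm ?mulr0//; exact: tf_smooth tZ.
  rewrite /curv (eq_bigr (fun i' => \sum_j' (\sum_k'
     (\sum_l' omega (Kcoef P) (Bq P (u x)) i' j' k' l' * ddat u x l') * (eta k' m * F x))
     * (plateau x * (i' == i)%:R * (plateau x * (j' == j)%:R)))).
    rewrite (@sum_delta2 (fun i' j' => \sum_k'
     (\sum_l' omega (Kcoef P) (Bq P (u x)) i' j' k' l' * ddat u x l') * (eta k' m * F x))).
    rewrite plateau1// !mulr1 {2}/F mulr_suml.
    by apply: eq_bigr => k' _; rewrite mulrA.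
  move=> i' _; apply: eq_bigr => j' _; rewrite mulr_suml; apply: eq_bigr => k' _.
  by rewrite lE !da; ring.
move=> I0; have := Int_sqr_eq0 tF I0 0.
have OmE k' : Om 0 k' = t * bump 0 * omega (Kcoef P) (Bq P q) i j k' l.
  rewrite /Om (bigD1 l)//= big1 => [|l' lk]; last by rewrite cE (negPf lk) !mulr0.
  by rewrite cE eqxx mulr1 addr0 derive1_wiggle0 u0 mulrC.
have -> : F 0 = t * bump 0 * \sum_k' omega (Kcoef P) (Bq P q) i j k' l * eta k' m.
  by rewrite /F mulr_sumr; apply: eq_bigr => k' _; rewrite OmE -[LHS]mulrA.
move=> /eqP; rewrite mulf_eq0 mulf_eq0 (negPf t0) (gt_eqF (@bump0 R)) /=.
by move/eqP.
Qed.

Lemma cyc_mixed_rel : mixed_rel U P eta.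
Proof.
move=> q Uq; split=> [i j r|i j k l]; first exact: mixed_first.
exact: mixed_second.
Qed.

End mixed_relations.
End extraction.

(** * The Poincare lemma on a ball *)

Section poincare.
Context {R : realType} {n : nat}.
Implicit Types (V : set 'rV[R]_n) (f g : 'rV[R]_n -> R) (p q h : 'rV[R]_n).

Lemma partialD f g k q : differentiable f q -> differentiable g q ->
  partial k (fun x => f x + g x) q = partial k f q + partial k g q.
Proof.
move=> df dg; have d2 : differentiable (fun x => f x + g x) q.
  exact: (@differentiableD _ _ _ f g).
have := partial_derive1 k d2 => /derive1_is <-; apply: derive1_is.
exact: (is_derive1D (partial_derive1 k df) (partial_derive1 k dg)).
Qed.

Lemma smooth_onD V f g : open V -> smooth_on V f -> smooth_on V g ->
  smooth_on V (fun x => f x + g x).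
Proof.
move=> Vo sf sg; apply: (@smooth_on_class _ _ V
  (fun F => exists f g, [/\ smooth_on V f, smooth_on V g & F = fun x => f x + g x]) Vo);
  last by exists f, g.
move=> _ {f g sf sg} [f [g [sf sg ->]]]; split=> [x Vx|i].
  apply: (@differentiableD _ _ _ f g); first exact: smooth_on_differentiable sf Vx.
  exact: smooth_on_differentiable sg Vx.
exists (fun x => partial i f x + partial i g x).
  by exists (partial i f), (partial i g); split => //; exact: smooth_on_partial.
move=> x Vx; rewrite partialD//; first exact: smooth_on_differentiable sf Vx.
exact: smooth_on_differentiable sg Vx.
Qed.

Lemma smooth_onZ V f a : open V -> smooth_on V f -> smooth_on V (fun x => a * f x).
Proof.
move=> Vo sf; apply: smooth_on_eq Vo _ (@smooth_onZD _ _ _ _ a 0 Vo sf) => x _.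
by rewrite addr0.
Qed.

Lemma partialZ f a k q : differentiable f q ->
  partial k (fun x => a * f x) q = a * partial k f q.
Proof.
move=> df; rewrite -(partialZD a 0 k df); congr (partial k _ q).
by apply/funext => x; rewrite addr0.
Qed.

Lemma smooth_on_sum V m (F : 'I_m -> 'rV[R]_n -> R) : open V ->
  (forall i, smooth_on V (F i)) -> smooth_on V (fun x => \sum_i F i x).
Proof.
move=> Vo; elim: m F => [|m IH] F HF.
  apply: smooth_on_eq Vo _ (@smooth_on_cst _ _ V 0 Vo) => x _; by rewrite big_ord0.
apply: smooth_on_eq Vo _ (smooth_onD Vo (HF ord0) (IH _ (fun i => HF (lift ord0 i)))) => x _.
by rewrite big_ord_recl.
Qed.

Lemma partial_sum m (F : 'I_m -> 'rV[R]_n -> R) k q :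
  (forall i, differentiable (F i) q) ->
  partial k (fun x => \sum_i F i x) q = \sum_i partial k (F i) q.
Proof.
elim: m F => [|m IH] F HF.
  rewrite big_ord0 (_ : (fun x => _) = cst 0); first exact: derive_cst.
  by apply/funext => x; rewrite big_ord0.
have dS : differentiable (fun x => \sum_i F (lift ord0 i) x) q.
  have -> : (fun x => \sum_i F (lift ord0 i) x) = \sum_i F (lift ord0 i) by rewrite fct_sumE.
  by apply: differentiable_sum => i; exact: HF.
rewrite big_ord_recl -IH; last by move=> i; exact: HF.
rewrite -partialD//; congr (partial k _ q); apply/funext => x.
by rewrite big_ord_recl.
Qed.

Lemma smooth_on_coord V (k : 'I_n) : smooth_on V (fun q : 'rV[R]_n => q 0 k).
Proof. exact: smooth_on_proj (@smooth1_id R). Qed.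

Lemma partial_coord (k l : 'I_n) q : partial l (fun q : 'rV[R]_n => q 0 k) q = (l == k)%:R.
Proof.
have H : differentiable (fun q : 'rV[R]_n => q 0 k) q by exact: differentiable_coord.
have := partial_derive1 l H => /derive1_is <-.
rewrite (_ : (fun s => _) = fun s => q 0 k + s * (l == k)%:R).
  exact: (derive1_is (derivable_affine _ _ _)).
by apply/funext => s; rewrite !mxE eqxx eq_sym.
Qed.

Lemma ball_segment p (r : R) q (t : R) : 0 <= t -> t <= 1 -> ball p r q ->
  ball p r (p + t *: (q - p)).
Proof.
move=> t0 t1; rewrite -!ball_normE/= opprD addrA subrr sub0r normrN normrZ ger0_norm//.
rewrite [`|p - q|]distrC; apply: le_lt_trans; exact: ler_piMl.
Qed.

Lemma const_on_ball p (r : R) f q : (forall x, ball p r x -> differentiable f x) ->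
  (forall x k, ball p r x -> partial k f x = 0) -> ball p r q -> f q = f p.
Proof.
move=> df pf pq.
have dd (t : R) : 0 <= t -> t <= 1 ->
    is_derive t (1 : R) (fun s => f (p + s *: (q - p))) 0.
  move=> t0 t1; have bt := ball_segment t0 t1 pq.
  apply: (is_derive1_eq (is_derive_line (df _ bt))).
  by rewrite big1// => k _; rewrite pf// mul0r.
have [||c _] := @MVT_segment R (fun s => f (p + s *: (q - p))) (fun=> 0) 0 1 ler01.
- by move=> x; rewrite in_itv/= => /andP[x0 x1]; apply: dd; exact: ltW.
- apply: derivable_within_continuous => x; rewrite in_itv/= => /andP[x0 x1].
  by have [] := dd _ x0 x1.
rewrite scale1r scale0r addr0 mul0r [p + _]addrC subrK => /eqP.
by rewrite subr_eq0 => /eqP.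
Qed.

(** The mean value theorem along a segment and the continuity of the coefficients
    give the first-order expansion. *)
Lemma differentiable_lines V f (B : 'I_n -> 'rV[R]_n -> R) q : open V ->
  (forall k, smooth_on V (B k)) ->
  (forall x h, V x -> is_derive (0 : R) (1 : R) (fun t => f (x + t *: h))
     (\sum_k B k x * h 0 k)) ->
  V q -> differentiable f q /\ forall k, partial k f q = B k q.
Proof.
move=> Vo sB df Vq.
have D : differentiable f q.
  apply/differentiable_epsP; exists (fun k => B k q) => e e0.
  pose e' := e / n.+1%:R; have e'0 : 0 < e' by rewrite divr_gt0.
  have : \forall x \near q, V x /\ forall k, `|B k q - B k x| <= e'.
    near=> x; split; first by near: x; exact: open_nbhs_nbhs.
    near: x; apply: filter_forall => k.
    have : {for q, continuous (B k)}.
      apply: differentiable_continuous; exact: smooth_on_differentiable (sB k) Vq.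
    by move/cvgrPdist_le; apply.
  case/nbhs_ballP => r /= r0 Hr.
  have N1 : \forall h \near (0 : 'rV[R]_n), `|h| < r by exact: nbhs0_lt.
  apply: filterS N1 => h hr.
  have seg (t : R) : 0 <= t -> t <= 1 -> ball q r (q + t *: h).
    move=> t0 t1; rewrite -ball_normE/= opprD addrA subrr sub0r normrN normrZ ger0_norm//.
    by apply: le_lt_trans hr; exact: ler_piMl.
  have dd (t : R) : 0 <= t -> t <= 1 -> is_derive t (1 : R) (fun s => f (q + s *: h))
      (\sum_k B k (q + t *: h) * h 0 k).
    move=> t0 t1; have [Vt _] := Hr _ (seg t t0 t1); have := df _ h Vt.
    have -> : (fun s : R => f (q + t *: h + s *: h)) = fun s => f (q + (t + s) *: h).
      by apply/funext => s; rewrite scalerDl addrA.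
    exact: is_derive_shift0.
  have [||c] := @MVT_segment R (fun s => f (q + s *: h))
    (fun t => \sum_k B k (q + t *: h) * h 0 k) 0 1 ler01.
  - by move=> x; rewrite in_itv/= => /andP[x0 x1]; apply: dd; exact: ltW.
  - apply: derivable_within_continuous => x; rewrite in_itv/= => /andP[x0 x1].
    by have [] := dd _ x0 x1.
  rewrite in_itv/= => /andP[c0 c1]; rewrite scale1r scale0r addr0 subr0 mulr1 => ->.
  rewrite -sumrB; under eq_bigr do rewrite -mulrBl.
  have H k : `|B k (q + c *: h) - B k q| <= e'.
    by have [_ /(_ k)] := Hr _ (seg _ c0 c1); rewrite distrC.
  apply: (le_trans (sum_mul_le h H)); apply: ler_wpM2r => //.
  rewrite /e' mulrCA ler_piMr ?ltW// ltr_pdivrMr// mul1r ltr_nat.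
  exact: ltnSn.
split=> // k; have := partial_derive1 k D => /derive1_is <-.
rewrite (derive1_is (df q (delta_mx 0 k) Vq)) (bigD1 k)//= mxE !eqxx mulr1.
by rewrite big1 ?addr0// => j jk; rewrite mxE eqxx (negPf jk) mulr0.
Unshelve. all: by end_near. Qed.

Definition dstep (x : R) : R := (Int (@bump R))^-1 * bump x.

Lemma Int_bump_gt0 : 0 < Int (@bump R).
Proof.
rewrite lt_neqAle eq_sym Int_bump_neq0 /=.
by apply: Rintegral_ge0 => x _; exact: bump_ge0.
Qed.

Lemma tf_dstep : tf dstep.
Proof. exact: tfZ _ (@tf_bump R). Qed.

Lemma csupp_dstep : csupp 1 dstep.
Proof. by move=> x x1; rewrite /dstep csupp_bump// mulr0. Qed.

Lemma is_derive_step x : is_derive x (1 : R) (@step R) (dstep x).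
Proof.
have d := is_derive_dinv x (@tf_bump R).
apply: (is_derive1_eq (is_derive1D (is_derive1M (is_derive_cst ((Int (@bump R))^-1) x 1) d)
  (is_derive_cst (2^-1 : R) x 1))).
by rewrite mul0r add0r addr0.
Qed.

Lemma step_bounds (x : R) : 0 <= step x /\ step x <= 1.
Proof.
have mono a b : a < b -> step a <= step b :> R.
  move=> ab; have [c _ E] := mvt is_derive_step ab.
  rewrite -subr_ge0 E mulr_ge0//; last by rewrite subr_ge0 ltW.
  by rewrite mulr_ge0 ?bump_ge0// invr_ge0 ltW// Int_bump_gt0.
have nx := normr_ge0 x; have [x1 x2] := csupp_norm (lexx `|x|).
have h1 : - (`|x| + 2) < -1 by lra.
have h2 : 1 < `|x| + 2 by lra.
split.
  by rewrite -(step_left h1); apply: mono; lra.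
by rewrite -(step_right h2); apply: mono; lra.
Qed.

Section primitive.
Variables (p : 'rV[R]_n) (r : R) (B : 'I_n -> 'rV[R]_n -> R).
Let V := ball p r.
Hypothesis r0 : 0 < r.
Hypothesis sB : forall k, smooth_on V (B k).
Hypothesis closedB : forall q k l, V q -> partial l (B k) q = partial k (B l) q.

Let Vo : open V. Proof. exact: ball_open. Qed.

(** The line integral along the radius, the unit interval being parametrised by
    [step], which turns the integrand into a test function. *)
Definition line_integral (q : 'rV[R]_n) : R :=
  Int (fun x => (\sum_k (q - p) 0 k * B k (p + step x *: (q - p))) * dstep x).

Definition radius (q : 'rV[R]_n) (x : R) : 'rV[R]_n := p + step x *: (q - p).

Lemma is_derive_radius q i x :
  is_derive x (1 : R) (coord (radius q) i) (dstep x * (q - p) 0 i).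
Proof.
have -> : coord (radius q) i = fun x => p 0 i + step x * (q - p) 0 i.
  by apply/funext => y; rewrite /coord /radius !mxE.
apply: (is_derive1_eq (is_derive1D (is_derive_cst (p 0 i) x 1)
  (is_derive1M (is_derive_step x) (is_derive_cst ((q - p) 0 i) x 1)))).
by rewrite mulr0 addr0 add0r.
Qed.

Lemma field_radius q : V q -> field_in V (radius q).
Proof.
move=> Vq; split=> [i|x|].
- apply: (smooth1_intro (is_derive_radius q i)).
  exact: smooth1M (tf_smooth tf_dstep) (smooth1_cst _).
- by have [s0 s1] := step_bounds x; exact: ball_segment.
- exists 1 => x x1 i; rewrite (derive1_is (is_derive_radius q i x)).
  by rewrite csupp_dstep// mul0r.
Qed.

Lemma ud_affine (a b : R) : ud (fun t _ => a + t * b) (fun=> a) (fun=> b).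
Proof.
split; [|exact: bnd_cst|exact: bnd_cst| |exact: smooth1_cst|exact: smooth1_cst].
- move=> e e0; near=> t => x; rewrite [X in `|X|](_ : _ = 0); last by ring.
  by rewrite normr0 mulr_ge0// ltW.
- by near=> t; exact: smooth1_cst.
Unshelve. all: by end_near. Qed.

Lemma udc_cst (f : R -> R) : tf f -> udc (fun=> f) f (fun=> 0).
Proof.
move=> Tf; split; first exact: ud_cst (bnd_tf Tf) (tf_smooth Tf).
have [_ [M fM]] := Tf; exists M; split; [by near=> t; exact: fM|exact: fM|by []].
Unshelve. all: by end_near. Qed.

(** By closedness the derivative of the integrand in the direction [h] is the total
    derivative of [step x * sum_l h_l B_l (radius q x)], which runs from 0 to its
    value at [q]. *)
Lemma line_integral_derive q h : V q ->
  is_derive (0 : R) (1 : R) (fun t => line_integral (q + t *: h))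
    (\sum_k B k q * h 0 k).
Proof.
move=> Vq; have fX := field_radius Vq.
pose ps x := @plateau R x * step x.
have tps : tf ps := tfMl (@tf_plateau R) (@smooth1_step R).
pose w x := ps x *: h.
have wE i : coord w i = fun x => ps x * h 0 i by apply/funext => x; rewrite /coord mxE.
have tw : test_curve w.
  by apply/test_curveP => i; rewrite wE; apply: tfMl tps (smooth1_cst _).
have ps1 x : `|x| <= 1 -> ps x = step x.
  by move=> x1; rewrite /ps plateau1 ?mul1r//; apply: le_lt_trans x1 _; rewrite ltr1n.
have uA := udcMr (ud_sum (fun k => udM (ud_affine ((q - p) 0 k) (h 0 k))
  (ud_field_comp Vo (sB k) fX tw))) (udc_cst tf_dstep).
apply: (is_derive1_congr (udc_Int uA)) => [t|].
  congr Int; apply/funext => x; case: (ltrP 1 `|x|) => x1.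
    by rewrite csupp_dstep// !mulr0.
  congr (_ * _); apply: eq_bigr => k _; congr (_ * B k _); first by rewrite !mxE; ring.
  rewrite /radius /w ps1// -[RHS]addrA; congr (_ + _).
  by rewrite addrAC scalerDr !scalerA [t * _]mulrC.
pose F x := \sum_l h 0 l * (step x * B l (radius q x)).
have dB l x : is_derive x (1 : R) (fun y => B l (radius q y))
    (\sum_k partial k (B l) (radius q x) * (dstep x * (q - p) 0 k)).
  have [su Ux _] := fX.
  apply: (is_derive1_eq (is_derive_comp_curve
    (smooth_on_differentiable (sB l) (Ux x)) (fun i => @smooth1_derivable _ _ x (su i)))).
  by apply: eq_bigr => k _; rewrite (derive1_is (is_derive_radius q k x)).
set dF := (X in Int X).
have dFE x : dF x = \sum_l (h 0 l * (dstep x * B l (radius q x)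
    + step x * \sum_k partial k (B l) (radius q x) * (dstep x * (q - p) 0 k))).
  rewrite /dF; case: (ltrP 1 `|x|) => x1.
    rewrite csupp_dstep// !mulr0 addr0 big1// => l _.
    rewrite mul0r big1 => [|k _]; last by rewrite mul0r mulr0.
    by rewrite !mulr0 addr0 mulr0.
  rewrite mulr0 addr0 big_split mulrDl.
  rewrite [RHS](eq_bigr (fun l => h 0 l * B l (radius q x) * dstep x
    + \sum_k h 0 l * step x * partial k (B l) (radius q x) * (q - p) 0 k * dstep x)).
    rewrite [RHS]big_split /= mulr_suml; congr (_ + _).
    rewrite mulr_suml exchange_big /=; apply: eq_bigr => k _.
    rewrite mulr_sumr mulr_suml; apply: eq_bigr => l _.
    have [_ Ux _] := fX; rewrite (closedB k l (Ux x)) wE ps1//; ring.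
  move=> l _; rewrite mulrDr; congr (_ + _); first ring.
  by rewrite !mulr_sumr; apply: eq_bigr => k _; ring.
have ddF x : is_derive x (1 : R) F (dF x).
  rewrite dFE; apply: is_derive1_sum => l.
  apply: (is_derive1_eq (is_derive1M (is_derive_cst (h 0 l) x 1)
    (is_derive1M (is_derive_step x) (dB l x)))).
  by rewrite mul0r add0r.
have tdF : tf dF by have [_ _] := udc_tf uA; exact.
have cdF : csupp 1 dF by move=> x x1; rewrite /dF csupp_dstep// !mulr0 addr0.
have h1 : -2 < -1 :> R by lra.
have h2 : 1 < 2 :> R by lra.
rewrite (Int_primitive (tf_continuous tdF) cdF ddF h1 h2) /F.
rewrite -sumrB; apply: eq_bigr => l _.
by rewrite /radius (step_left h1) (step_right h2) mul0r mulr0 subr0 mul1r scale1r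
  [p + _]addrC subrK mulrC.
Qed.

Lemma poincare : exists A : 'rV[R]_n -> R, smooth_on V A /\
  forall q, V q -> forall k, partial k A q = B k q.
Proof.
have H q : V q -> differentiable line_integral q
    /\ forall k, partial k line_integral q = B k q.
  move=> Vq; apply: (differentiable_lines Vo sB) => // x h Vx.
  exact: line_integral_derive.
exists line_integral; split; last by move=> q /H[].
apply: (@smooth_on_class _ _ V (fun f => f = line_integral \/ smooth_on V f)) => //;
  last by left.
move=> f [->|sf]; split.
- by move=> x /H[].
- by move=> k; exists (B k); [right|move=> x /H[]].
- by move=> x Vx; exact: smooth_on_differentiable sf Vx.
- by move=> k; exists (partial k f) => //; right; exact: smooth_on_partial.
Qed.

End primitive.
End poincare.

(** * Local potentials *)

Section potentials.
Context {R : realType} {N : nat}.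
Variables (U : set 'rV[R]_N) (P : hydro_op R N) (eta : 'M[R]_N).
Hypotheses (Uo : open U) (sP : smooth_op U P).
Hypotheses (eta_sym : eta^T = eta) (eta_nondeg : eta \in unitmx).

Let etaC i j : eta i j = eta j i. Proof. by rewrite -{1}eta_sym mxE. Qed.
Let theta := invmx eta.
Let thetaC i j : theta i j = theta j i.
Proof. by rewrite -{1}[theta]trmxK mxE /theta trmx_inv eta_sym. Qed.

Definition local_potential (V : set 'rV[R]_N) (H : 'I_N -> 'rV[R]_N -> R) : Prop :=
  (forall i, smooth_on V (H i)) /\ eq_op_on V P (potential_op eta (Kcoef P) H).

(** Both relations reduce to the symmetry of the partial derivatives of [H]. *)
Lemma potential_mixed_rel :
  (forall p, U p -> exists V H, [/\ open V, V p & local_potential V H]) ->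
  mixed_rel U P eta.
Proof.
move=> HU q Uq; have [V [H [Vo Vq [sH [_ Eb _]]]]] := HU q Uq.
have sw k l j x : V x -> partial k (partial l (H j)) x = partial l (partial k (H j)) x.
  by move=> Vx; exact: schwarz Vo (sH j) Vx.
split=> [i j r|i j k l].
  have E i' j' : \sum_k eta i' k * bcoef P j' r k q
     = \sum_k \sum_s eta i' k * eta j' s * partial k (partial s (H r)) q
       - Kcoef P * eta i' j' * q 0 r.
    rewrite (eq_bigr (fun k => \sum_s eta i' k * eta j' s * partial k (partial s (H r)) q
       - (j' == k)%:R * (eta i' k * Kcoef P * q 0 r))).
      by rewrite sumrB delta_sum; congr (_ - _); rewrite [eta _ _ * _]mulrC.
    move=> k _; rewrite (Eb _ _ _ _ Vq) /= mulrBr mulr_sumr; congr (_ - _); last by ring.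
    by apply: eq_bigr => s _; rewrite mulrA.
  rewrite !E etaC; congr (_ - _); rewrite exchange_big; apply: eq_bigr => k _ /=.
  by apply: eq_bigr => s _; rewrite sw// [eta i s * _]mulrC.
have dB i' k' l' : partial l' (bcoef P i' j k') q
    = \sum_s eta i' s * partial l' (partial k' (partial s (H j))) q
      - Kcoef P * (i' == k')%:R * (l' == j)%:R.
  rewrite (partial_eq_on l' Vo (fun x Vx => Eb i' j k' x Vx) Vq) /=.
  have d1 s : differentiable (partial k' (partial s (H j))) q.
    exact: smooth_on_differentiable (smooth_on_partial (smooth_on_partial (sH j))) Vq.
  have d2 s : differentiable (fun x => eta i' s * partial k' (partial s (H j)) x) q.
    by apply: (@differentiableM _ _ (cst (eta i' s)) (partial k' (partial s (H j)))).
  have dc : differentiable (fun x : 'rV[R]_N => x 0 j) q by exact: differentiable_coord.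
  have dS : differentiable (fun x => \sum_s eta i' s * partial k' (partial s (H j)) x) q.
    have -> : (fun x => \sum_s eta i' s * partial k' (partial s (H j)) x)
      = \sum_s (fun x => eta i' s * partial k' (partial s (H j)) x) by rewrite fct_sumE.
    exact: differentiable_sum.
  have dK : differentiable (fun x : 'rV[R]_N => - (Kcoef P * (i' == k')%:R) * x 0 j) q.
    by apply: (@differentiableM _ _ (cst _) (fun x : 'rV[R]_N => x 0 j)).
  transitivity (partial l' (fun x => \sum_s eta i' s * partial k' (partial s (H j)) x
      + - (Kcoef P * (i' == k')%:R) * x 0 j) q).
    by congr (partial l' _ q); apply/funext => x; rewrite mulNr.
  rewrite partialD// partial_sum// (partialZ _ _ dc) partial_coord mulNr; congr (_ - _).
  by apply: eq_bigr => s _; rewrite partialZ.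
rewrite /omega /Bq !dB.
have sw3 s : partial k (partial l (partial s (H j))) q
    = partial l (partial k (partial s (H j))) q.
  exact: (@schwarz _ _ V (partial s (H j)) k l q Vo (smooth_on_partial (sH j)) Vq).
have EQ : \sum_s eta i s * partial k (partial l (partial s (H j))) q
   = \sum_s eta i s * partial l (partial k (partial s (H j))) q.
  by apply: eq_bigr => s _; rewrite sw3.
rewrite [k == j]eq_sym [l == j]eq_sym.
have alg (s1 s2 K a b c d : R) : s1 = s2 ->
    s1 - K * a * b - (s2 - K * c * d) + K * (a * b - d * c) = 0 by move=> ->; ring.
exact: alg EQ.
Qed.

Section at_point.
Hypotheses (rel : skew_rel U P) (mrel : mixed_rel U P eta).
Variables (p : 'rV[R]_N) (r : R).
Let V := ball p r.
Hypotheses (r0 : 0 < r) (VU : V `<=` U).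

Let Vo : open V. Proof. exact: ball_open. Qed.
Let Vp : V p. Proof. exact: ballxx. Qed.

Let sg i j : smooth_on V (gcoef P i j).
Proof. by move=> s x Vx; apply: (sP.1 i j); exact: VU. Qed.

Let sb i j k : smooth_on V (bcoef P i j k).
Proof. by move=> s x Vx; apply: (sP.2 i j k); exact: VU. Qed.

(** By [omega = 0] these are closed one-forms in the index [k]. *)
Definition closed_b i j k (q : 'rV[R]_N) : R :=
  bcoef P i j k q + Kcoef P * (i == k)%:R * q 0 j.

Lemma smooth_closed_b i j k : smooth_on V (closed_b i j k).
Proof.
exact (@smooth_onD _ _ V _ _ Vo (sb i j k) (@smooth_onZ _ _ V _ (Kcoef P * (i == k)%:R)
  Vo (@smooth_on_coord _ _ V j))).
Qed.

Lemma closed_b_closed i j q k l : V q ->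
  partial l (closed_b i j k) q = partial k (closed_b i j l) q.
Proof.
move=> Vq; have dc : differentiable (fun x : 'rV[R]_N => x 0 j) q.
  exact: differentiable_coord.
have E k' l' : partial l' (closed_b i j k') q
    = partial l' (bcoef P i j k') q + Kcoef P * (i == k')%:R * (l' == j)%:R.
  rewrite partialD; last 2 first.
  - exact: smooth_on_differentiable (sb i j k') Vq.
  - by apply: (@differentiableM _ _ (cst _) (fun x : 'rV[R]_N => x 0 j)).
  by rewrite (partialZ _ _ dc) partial_coord.
rewrite !E; have [_ /(_ i j k l)] := mrel (VU Vq).
rewrite /omega /Bq [k == j]eq_sym [l == j]eq_sym => H.
apply/eqP; rewrite -subr_eq0; apply/eqP; rewrite -[RHS]oppr0 -[in RHS]H; ring.
Qed.

(** The first integration: [A i j] is to become [sum_s eta^{is} d_s H^j]. *)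
Lemma exists_g_potential : exists A : 'I_N -> 'I_N -> 'rV[R]_N -> R,
  [/\ forall i j, smooth_on V (A i j),
      forall i j q k, V q -> partial k (A i j) q = closed_b i j k q &
      forall i j q, V q -> gcoef P i j q = A i j q + A j i q - Kcoef P * q 0 i * q 0 j].
Proof.
have HA i j := poincare (fun k => smooth_closed_b i j k) (@closed_b_closed i j).
pose A i j := sval (cid (HA i j)).
have sA i j : smooth_on V (A i j) by have [] := svalP (cid (HA i j)).
have dA i j (q : 'rV[R]_N) k : V q -> partial k (A i j) q = closed_b i j k q.
  by move=> Vq; have [_ /(_ q Vq k)] := svalP (cid (HA i j)).
pose D i j q := A i j q + A j i q - Kcoef P * q 0 i * q 0 j - gcoef P i j q.
have df (f : 'rV[R]_N -> R) (q : 'rV[R]_N) : smooth_on V f -> V q -> differentiable f q.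
  by move=> sf Vq; exact: smooth_on_differentiable sf Vq.
have dc (i : 'I_N) (q : 'rV[R]_N) : differentiable (fun x : 'rV[R]_N => x 0 i) q.
  exact: differentiable_coord.
have dcc (i j : 'I_N) (q : 'rV[R]_N) : differentiable (fun x : 'rV[R]_N => x 0 i * x 0 j) q.
  by apply: (@differentiableM _ _ (fun x : 'rV[R]_N => x 0 i) (fun x : 'rV[R]_N => x 0 j)).
have pcc (i j k : 'I_N) (q : 'rV[R]_N) : partial k (fun x : 'rV[R]_N => x 0 i * x 0 j) q
    = (k == i)%:R * q 0 j + q 0 i * (k == j)%:R.
  rewrite -(derive1_is (partial_derive1 k (dcc i j q))); apply: derive1_is.
  have := is_derive1M (partial_derive1 k (dc i q)) (partial_derive1 k (dc j q)).
  by rewrite !partial_coord !mxE !mul0r !addr0.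
have DE i j : D i j = fun x => (A i j x + A j i x)
    + ((- Kcoef P) * (x 0 i * x 0 j) + (-1) * gcoef P i j x).
  by apply/funext => x; rewrite /D; ring.
have dZ (a : R) (f : 'rV[R]_N -> R) (q : 'rV[R]_N) : differentiable f q -> differentiable (fun x : 'rV[R]_N => a * f x) q.
  by move=> dff; apply: (@differentiableM _ _ (cst a) f).
have dP (f g : 'rV[R]_N -> R) (q : 'rV[R]_N) : differentiable f q -> differentiable g q ->
    differentiable (fun x : 'rV[R]_N => f x + g x) q.
  by move=> dff dgg; apply: (@differentiableD _ _ _ f g).
have constD i j q : V q -> D i j q = D i j p.
  move=> Vq; apply: (@const_on_ball _ _ p r (D i j) q) Vq => x.
    move=> Vx; rewrite DE; apply: (dP); first by apply: dP; apply: df.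
    by apply: (dP); apply: (dZ) => //; apply: df (sg i j) Vx.
  move=> k Vx; have dgx := df _ _ (sg i j) Vx.
  rewrite DE partialD; [|by apply: dP; apply: df|by apply: (dP); apply: (dZ)].
  rewrite partialD; [|exact: df|exact: df].
  rewrite partialD; [|exact: dZ|exact: dZ].
  rewrite (partialZ _ _ (dcc i j x)) pcc (partialZ _ _ dgx) !dA// ((rel (VU Vx) i j).2 k).
  by rewrite /closed_b [k == i]eq_sym [k == j]eq_sym; ring.
have DC i j : D i j p = D j i p by rewrite /D ((rel (VU Vp) i j).1); ring.
(* The primitives are determined up to constants: the constant defect [D], symmetric
   in [i], [j], is split evenly between [A i j] and [A j i]. *)
exists (fun i j q => 1 * A i j q + - (D i j p / 2)); split=> [i j|i j q k Vq|i j q Vq].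
- exact: smooth_onZD.
- by rewrite partialZD ?mul1r ?dA//; exact: df.
have := constD i j q Vq; rewrite (DC j i) {1}/D => E.
have -> : gcoef P i j q = A i j q + A j i q - Kcoef P * q 0 i * q 0 j - D i j p.
  by rewrite -E; ring.
by field.
Qed.

(** The second integration: lowering the first index of [A] by the inverse of [eta]
    gives one-forms, closed by the symmetry of [eta^{is} b^{jr}_s]. *)
Lemma exists_local_potential : exists H, local_potential V H.
Proof.
have [A [sA dA gA]] := exists_g_potential.
pose E j s q := \sum_i theta s i * A i j q.
have sE j s : smooth_on V (E j s).
  by apply: smooth_on_sum => // i; exact: smooth_onZ.
have dE j s q k : V q -> partial k (E j s) q = \sum_i theta s i * closed_b i j k q.
  move=> Vq; have dAq i : differentiable (A i j) q.
    exact: smooth_on_differentiable (sA i j) Vq.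
  rewrite partial_sum => [|i]; last first.
    by apply: (@differentiableM _ _ (cst _) (A i j)).
  by apply: eq_bigr => i _; rewrite partialZ// dA.
(* In matrix form: [M eta] symmetric implies [theta M] symmetric. *)
have closedE j q s k : V q -> partial k (E j s) q = partial s (E j k) q.
  move=> Vq; rewrite !dE//.
  pose M : 'M[R]_N := \matrix_(i, k) closed_b i j k q.
  have ME : M *m eta = eta *m M^T.
    apply/matrixP => a b; rewrite !mxE.
    have F a' b' : \sum_k M a' k * eta k b'
       = \sum_k eta b' k * bcoef P a' j k q + Kcoef P * eta a' b' * q 0 j.
      rewrite (eq_bigr (fun k => eta b' k * bcoef P a' j k q
         + (a' == k)%:R * (Kcoef P * eta k b' * q 0 j))).
        by rewrite big_split delta_sum.
      by move=> k' _; rewrite mxE /closed_b [eta b' k']etaC; ring.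
    rewrite F; have [H1 _] := mrel (VU Vq); rewrite (H1 b a j) [eta a b]etaC -F.
    by apply: eq_bigr => k' _; rewrite [RHS]mulrC [eta k' _]etaC !mxE.
  have TM : theta *m M = M^T *m theta.
    have -> : theta *m M = theta *m (M *m eta) *m theta.
      by rewrite -!mulmxA mulmxV// mulmx1.
    by rewrite ME !mulmxA mulVmx// mul1mx.
  have := congr1 (fun X : 'M[R]_N => X s k) TM; rewrite !mxE => TMsk.
  transitivity (\sum_i theta s i * M i k); first by apply: eq_bigr => i _; rewrite mxE.
  rewrite TMsk; apply: eq_bigr => i _; rewrite !mxE mulrC thetaC.
  by [].
have HH j := poincare (fun s => sE j s) (fun q s k => @closedE j q s k).
pose H j := sval (cid (HH j)).
have sH j : smooth_on V (H j) by have [] := svalP (cid (HH j)).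
have dH j q s : V q -> partial s (H j) q = E j s q.
  by move=> Vq; have [_ /(_ q Vq s)] := svalP (cid (HH j)).
have inv (f : 'I_N -> R) i : \sum_s eta i s * (\sum_m theta s m * f m) = f i.
  under eq_bigr do rewrite mulr_sumr; rewrite exchange_big /=.
  rewrite (eq_bigr (fun m => (i == m)%:R * f m)) ?delta_sum// => m _.
  under eq_bigr do rewrite mulrA; rewrite -mulr_suml; congr (_ * _).
  by have := congr1 (fun X : 'M[R]_N => X i m) (mulmxV eta_nondeg); rewrite !mxE.
have HA i j q : V q -> \sum_s eta i s * partial s (H j) q = A i j q.
  move=> Vq; rewrite -[RHS](inv (fun m => A m j q)).
  by apply: eq_bigr => s _; rewrite dH.
exists H; split=> //; split=> //= [i j q Vq|i j k q Vq].
  by rewrite !HA// gA.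
have -> : \sum_s eta i s * partial k (partial s (H j)) q = closed_b i j k q.
  rewrite -[RHS](inv (fun m => closed_b m j k q)).
  apply: eq_bigr => s _; congr (_ * _).
  by rewrite (partial_eq_on k Vo (fun x Vx => dH j x s Vx) Vq) dE.
by rewrite /closed_b addrK.
Qed.

End at_point.
End potentials.


Theorem theorem3p1 (R : realType) (N : nat) (U : set 'rV[R]_N) (Uopen : open U)
    (eta : 'M[R]_N) (eta_sym : eta^T = eta) (eta_nondeg : eta \in unitmx)
    (P1 : hydro_op R N) (P1_smooth : smooth_op U P1)
    (P1_poisson : is_poisson U P1) :
  compatible U P1 (const_op eta) <->
  (forall p : 'rV[R]_N, U p ->
     exists (V : set 'rV[R]_N) (H : 'I_N -> 'rV[R]_N -> R),
       [/\ open V, V p, V `<=` U,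
           forall i : 'I_N, smooth_on V (H i) &
           eq_op_on V P1 (potential_op eta (Kcoef P1) H)]).
Proof.
have rel : skew_rel U P1 by exact: poisson_skew_rel Uopen P1_smooth P1_poisson.
have compE := compatible_cyc Uopen P1_smooth rel eta_sym P1_poisson.
split=> [comp p Up|pot].
  have mrel : mixed_rel U P1 eta.
    exact: cyc_mixed_rel Uopen P1_smooth rel eta_sym eta_nondeg (compE.1 comp).
  have /nbhs_ballP[r /= r0 VU] : nbhs p U by exact: open_nbhs_nbhs.
  have [H [sH EH]] := exists_local_potential P1_smooth eta_sym eta_nondeg rel mrel r0 VU.
  exists (ball p r), H; split; [exact: ball_open|exact: ballxx|exact: VU|exact: sH|exact: EH].
apply: compE.2; apply: (mixed_rel_cyc Uopen P1_smooth rel eta_sym).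
apply: (potential_mixed_rel eta_sym) => p Up.
have [V [H [Vo Vp _ sH EH]]] := pot p Up.
by exists V, H; split.
Qed.
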